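(* Let $a,b\in\mathbb{R}\setminus\{0\}$ and let $\nu_1,\nu_2:\mathbb{R}^2\to\mathbb{R}$ be smooth functions with $\nu_1(0,0)=0=\nu_2(0,0)$ and $$\frac{\partial \nu_1}{\partial j}(0,0)=0,\qquad \frac{\partial^2 \nu_1}{\partial j^2}(0,0)\neq 0,\qquad \frac{\partial \nu_1}{\partial t}(0,0)\neq 0 .$$ Let $f_{j,t}(q,p)$ be a smooth function on $\mathbb{R}^2$ depending on two real parameters $j,t$, and assume that there are coordinate changes by smooth functions such that the $6$-jet of $f_{j,t}$ at the origin can be put in the form $$H_{j,t}(q,p)=\frac{a}{2}p^2+\frac{b}{6}q^6+\frac{\nu_1(j,t)}{2}q^2+\frac{\nu_2(j,t)}{4}q^4 .$$ Then the system given by $f_{j,t}$ goes through a double flip bifurcation as $t$ passes through $0$. Moreover, for $t=\tau$ sufficiently close to $0$, let $j_0^{\pm}=j_0^{\pm}(\tau)$ be such that $\nu_1(j_0^{\pm},\tau)=0$ and $\nu_2(j_0^{\pm},\tau)\neq 0$. Then Hamiltonian flip bifurcations (with respect to the parameter $j$, at fixed $t=\tau$) occur at $(j,t)=(j_0^{\pm},\tau)$. If $a\,\nu_2(j_0^{\pm},\tau)<0$ the bifurcation is a dual Hamiltonian flip bifurcation, and if $a\,\nu_2(j_0^{\pm},\tau)>0$ it is a (non-dual) Hamiltonian flip bifurcation.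
   Context: We consider one-degree-of-freedom Hamiltonian systems on $\mathbb{R}^2$ with coordinates $(q,p)$ and symplectic form $dq\wedge dp$, invariant under the $\mathbb{Z}_2$-action $(q,p)\mapsto(-q,-p)$; the origin is a singular (equilibrium) point. A singular point $x$ is stable (in the sense of Lyapunov) if all points in a sufficiently small neighbourhood of $x$ remain close to $x$ under the flow for all time; otherwise it is unstable. It is a centre if all eigenvalues of the linearised system are non-zero and purely imaginary, and a saddle if the linearisation has no purely imaginary eigenvalues ($0$ counted as purely imaginary). Hamiltonian flip bifurcation (for a family depending on a parameter $j$, with the origin a singular point): if the origin is stable and becomes unstable as $j$ passes through $j_0$, while at the same time an additional singularity which is a centre is produced, the origin undergoes a Hamiltonian flip bifurcation at $j=j_0$. If the origin is unstable and becomes stable as $j$ passes through $j_0$, while at the same time an additional singularity which is a saddle is produced, it undergoes a dual Hamiltonian flip bifurcation at $j=j_0$. Double flip bifurcation: a two-parameter family (parameters $j,t$) goes through a double flip bifurcation as $t$ passes through $0$ if, for $t$ close to $0$ on one side of $0$, there is no value of $j$ near $0$ at which the origin undergoes a (dual or non-dual) Hamiltonian flip bifurcation with respect to $j$, whereas for $t$ close to $0$ on the other side there are exactly two such values $j_0^-(t)\neq j_0^+(t)$ near $0$, which both tend to $0$ as $t\to 0$. *)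

(* Defs.v *)
From Stdlib Require Import Reals Lra.
From Coquelicot Require Import Coquelicot.
Open Scope R_scope.

(* A point of R^n is represented by x : nat -> R (only coordinates < n matter). *)
Definition upd (x : nat -> R) (i : nat) (s : R) : nat -> R :=
  fun k => if Nat.eqb k i then s else x k.

Definition partial_n (i : nat) (F : (nat -> R) -> R) : (nat -> R) -> R :=
  fun x => Derive (fun s => F (upd x i s)) (x i).

Definition cont_n (n : nat) (F : (nat -> R) -> R) : Prop :=
  forall x (eps : R), 0 < eps -> exists delta, 0 < delta /\
    forall y, (forall i, (i < n)%nat -> Rabs (y i - x i) < delta) ->
      Rabs (F y - F x) < eps.

Fixpoint Ck_n (k n : nat) (F : (nat -> R) -> R) : Prop :=
  cont_n n F /\
  match k with
  | O => True
  | S k' => forall i, (i < n)%nat ->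
      (forall x, ex_derive (fun s => F (upd x i s)) (x i)) /\
      Ck_n k' n (partial_n i F)
  end.

Definition smooth_n (n : nat) (F : (nat -> R) -> R) : Prop := forall k, Ck_n k n F.

Definition smooth2 (g : R -> R -> R) : Prop :=
  smooth_n 2 (fun x => g (x 0%nat) (x 1%nat)).
Definition smooth4 (g : R -> R -> R -> R -> R) : Prop :=
  smooth_n 4 (fun x => g (x 0%nat) (x 1%nat) (x 2%nat) (x 3%nat)).

(* A Hamiltonian is h : R -> R -> R, h q p; symplectic form dq /\ dp,
   so the Hamiltonian vector field is (dq/ds, dp/ds) = (dh/dp, - dh/dq). *)
Definition dq (h : R -> R -> R) (q p : R) : R := Derive (fun x => h x p) q.
Definition dp (h : R -> R -> R) (q p : R) : R := Derive (fun y => h q y) p.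

Definition origin : R * R := (0, 0).

Definition dist2 (x y : R * R) : R :=
  sqrt ((fst x - fst y) ^ 2 + (snd x - snd y) ^ 2).

Definition singular (h : R -> R -> R) (x : R * R) : Prop :=
  dq h (fst x) (snd x) = 0 /\ dp h (fst x) (snd x) = 0.

Definition is_solution (h : R -> R -> R) (gam : R -> R * R) (T : R) : Prop :=
  forall s, Rabs s < T ->
    is_derive (fun u => fst (gam u)) s (dp h (fst (gam s)) (snd (gam s))) /\
    is_derive (fun u => snd (gam u)) s (- dq h (fst (gam s)) (snd (gam s))).

Definition stable (h : R -> R -> R) (x : R * R) : Prop :=
  forall eps, 0 < eps -> exists delta, 0 < delta /\
    forall gam T, is_solution h gam T -> dist2 (gam 0) x < delta ->
      forall s, Rabs s < T -> dist2 (gam s) x < eps.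

(* Linearisation of the Hamiltonian vector field at x:
     [ d(dh/dp)/dq   d(dh/dp)/dp ]
     [ -d(dh/dq)/dq  -d(dh/dq)/dp ]                                      *)
Definition lin11 h (x : R * R) := dq (dp h) (fst x) (snd x).
Definition lin12 h (x : R * R) := dp (dp h) (fst x) (snd x).
Definition lin21 h (x : R * R) := - dq (dq h) (fst x) (snd x).
Definition lin22 h (x : R * R) := - dp (dq h) (fst x) (snd x).

Definition lin_eigenvalue (h : R -> R -> R) (x : R * R) (lam : C) : Prop :=
  Cminus (Cmult (Cminus lam (RtoC (lin11 h x))) (Cminus lam (RtoC (lin22 h x))))
         (RtoC (lin12 h x * lin21 h x)) = RtoC 0.

Definition centre (h : R -> R -> R) (x : R * R) : Prop :=
  singular h x /\
  forall lam, lin_eigenvalue h x lam -> lam <> RtoC 0 /\ Re lam = 0.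

Definition saddle (h : R -> R -> R) (x : R * R) : Prop :=
  singular h x /\
  forall lam, lin_eigenvalue h x lam -> Re lam <> 0.

(* s = 1 : j passes through j0 increasingly; s = -1 : decreasingly.
   "before" = 0 < s (j0 - j) < delta, "after" = 0 < s (j - j0) < delta. *)
Definition ham_flip (h : R -> R -> R -> R) (j0 : R) : Prop :=
  exists s, (s = 1 \/ s = -1) /\ exists delta r, 0 < delta /\ 0 < r /\
    (forall j, 0 < s * (j0 - j) < delta ->
       stable (h j) origin /\
       forall x, 0 < dist2 x origin < r -> ~ singular (h j) x) /\
    (forall j, 0 < s * (j - j0) < delta -> ~ stable (h j) origin) /\
    (forall eps, 0 < eps -> exists delta', 0 < delta' /\
       forall j, 0 < s * (j - j0) < delta' ->
         exists x, 0 < dist2 x origin < eps /\ centre (h j) x).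

Definition dual_ham_flip (h : R -> R -> R -> R) (j0 : R) : Prop :=
  exists s, (s = 1 \/ s = -1) /\ exists delta r, 0 < delta /\ 0 < r /\
    (forall j, 0 < s * (j0 - j) < delta ->
       ~ stable (h j) origin /\
       forall x, 0 < dist2 x origin < r -> ~ singular (h j) x) /\
    (forall j, 0 < s * (j - j0) < delta -> stable (h j) origin) /\
    (forall eps, 0 < eps -> exists delta', 0 < delta' /\
       forall j, 0 < s * (j - j0) < delta' ->
         exists x, 0 < dist2 x origin < eps /\ saddle (h j) x).

Definition flip_at (F : R -> R -> R -> R -> R) (j t : R) : Prop :=
  ham_flip (fun j' => F j' t) j \/ dual_ham_flip (fun j' => F j' t) j.

Definition double_flip (F : R -> R -> R -> R -> R) : Prop :=
  exists s, (s = 1 \/ s = -1) /\ exists eps eta, 0 < eps /\ 0 < eta /\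
    (forall t, 0 < s * t < eta -> forall j, Rabs j < eps -> ~ flip_at F j t) /\
    (forall t, 0 < - s * t < eta -> exists jm jp, jm <> jp /\
        Rabs jm < eps /\ Rabs jp < eps /\
        forall j, Rabs j < eps -> (flip_at F j t <-> j = jm \/ j = jp)) /\
    (forall eps', 0 < eps' -> exists eta', 0 < eta' /\
       forall t, 0 < - s * t < eta' -> forall j, Rabs j < eps ->
         flip_at F j t -> Rabs j < eps').

Fixpoint Dqn (n : nat) (h : R -> R -> R) : R -> R -> R :=
  match n with O => h | S n' => fun q p => Derive (fun x => Dqn n' h x p) q end.
Fixpoint Dpn (n : nat) (h : R -> R -> R) : R -> R -> R :=
  match n with O => h | S n' => fun q p => Derive (fun y => Dpn n' h q y) p end.

Definition same_6jet (g h : R -> R -> R) : Prop :=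
  forall m n, (m + n <= 6)%nat -> Dqn m (Dpn n g) 0 0 = Dqn m (Dpn n h) 0 0.

Definition Hnf (a b : R) (nu1 nu2 : R -> R -> R) (j t q p : R) : R :=
  a / 2 * p ^ 2 + b / 6 * q ^ 6 + nu1 j t / 2 * q ^ 2 + nu2 j t / 4 * q ^ 4.

(* Main.v *)
Require Import Defs.
From Stdlib Require Import Reals Lra Lia FunctionalExtensionality ClassicalEpsilon.
From Coquelicot Require Import Coquelicot.
Open Scope R_scope.

(* The coordinate change need not be symplectic: only critical points of f, the sign of the
   determinant of its Hessian there, and the stability of the origin matter. The determinant is
   multiplied by the square of the Jacobian, so at the origin it has the sign of a nu1; if it is
   positive the energy has a strict local extremum and the origin is stable, if it is negative
   V(x) = <x, A x>, with A the linearisation, is a Chetaev function and the origin is unstable.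
   Hence a flip can only occur where nu1 = 0.
   Near (0, 0), up to signs nu1 is convex in j and increasing in t, so for t on one side of 0 it has
   no zero, and on the other side exactly two, both transversal in j.
   At a transversal zero the pulled-back Hamiltonian G satisfies G_p = a p + O(r^6), which gives a
   graph p = P(q), and on it G_q / q = nu1 (1 + O(q^2)) + d q^k (1 + O(q)) with d q^k = nu2 q^2, or
   b q^4 if nu2 vanishes there (in that case nu2 = O(nu1)). So nonzero critical points exist near
   the origin exactly when nu1 d < 0, and there the Hessian determinant is a k d q^k (1 + O(q)). *)

(** * Multivariate calculus *)

(** [stable] quantifies over solutions on arbitrary intervals, so refuting it requires a solution
    that really exists for long enough to leave a disc. This forces a global existence theorem,
    applied to a vector field made Lipschitz on the whole plane by clamping its arguments. A flip
    asks for one disc around the origin free of other critical points for all [j] on one side of the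
    crossing. Hence every estimate has to be uniform in [j]: jets are compared on a whole parameter
    neighbourhood, and Taylor bounds carry a constant independent of [j]. For the same reason the
    coordinate change needs a local inverse whose domain does not shrink with [j]: it must cover a
    full disc in the coordinates of [f]. [double_flip] demands an equivalence at every [j] near 0,
    so zeros of [nu1] at which [nu2] vanishes too cannot be set aside. There the drift of [nu2] with
    [j] is dangerous, since its term [nu2 q^3] has lower order in [q] than [b q^5]; a bound by [nu1]
    turns it into a relative error [O(q^2)] of the linear term. *)

Lemma is_derive_eps (f : R -> R) (x l : R) :
  is_derive f x l <->
  (forall eps, 0 < eps -> exists delta, 0 < delta /\
     forall y, Rabs (y - x) < delta ->
       Rabs (f y - f x - l * (y - x)) <= eps * Rabs (y - x)).
Proof.
  rewrite is_derive_Reals; split; intros H eps Heps.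
  - destruct (H eps Heps) as [d Hd].
    exists d; split; [apply cond_pos|]; intros y Hy.
    destruct (Req_dec y x) as [->|Hne].
    + replace (f x - f x - l * (x - x)) with 0 by ring.
      rewrite Rabs_R0; replace (x - x) with 0 by ring; rewrite Rabs_R0; lra.
    + assert (Hn : y - x <> 0) by lra.
      specialize (Hd (y - x) Hn Hy).
      replace (x + (y - x)) with y in Hd by ring.
      replace (f y - f x - l * (y - x))
        with (((f y - f x) / (y - x) - l) * (y - x)) by (field; lra).
      rewrite Rabs_mult; apply Rmult_le_compat_r; [apply Rabs_pos | lra].
  - destruct (H (eps / 2)) as [d [Hd0 Hd]]; [lra|].
    exists (mkposreal d Hd0); simpl; intros h Hh Hhd.
    specialize (Hd (x + h)).
    replace (x + h - x) with h in Hd by ring.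
    specialize (Hd Hhd).
    replace ((f (x + h) - f x) / h - l)
      with ((f (x + h) - f x - l * h) * / h) by (field; lra).
    rewrite Rabs_mult, Rabs_inv.
    assert (0 < Rabs h) by (apply Rabs_pos_lt; lra).
    apply Rle_lt_trans with (eps / 2 * Rabs h * / Rabs h).
    + apply Rmult_le_compat_r; [|lra]. left; apply Rinv_0_lt_compat; lra.
    + rewrite Rmult_assoc, Rinv_r by lra; lra.
Qed.

Lemma Rabs_self_lt x d : 0 < d -> Rabs (x - x) < d.
Proof. unfold Rminus; rewrite Rplus_opp_r, Rabs_R0; tauto. Qed.

Fixpoint rsum (n : nat) (u : nat -> R) : R :=
  match n with O => 0 | S m => rsum m u + u m end.

Lemma rsum_le (n : nat) (u v : nat -> R) :
  (forall i, (i < n)%nat -> u i <= v i) -> rsum n u <= rsum n v.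
Proof.
  induction n as [|n IH]; intros H; simpl; [lra|].
  apply Rplus_le_compat; [apply IH; intros; apply H; lia | apply H; lia].
Qed.

Lemma rsum_pos (n : nat) (u : nat -> R) :
  (forall i, (i < n)%nat -> 0 <= u i) -> 0 <= rsum n u.
Proof.
  induction n as [|n IH]; intros H; simpl; [lra|].
  apply Rplus_le_le_0_compat; [apply IH; intros; apply H; lia | apply H; lia].
Qed.

Lemma rsum_scal (n : nat) (c : R) (u : nat -> R) :
  rsum n (fun i => c * u i) = c * rsum n u.
Proof. induction n as [|n IH]; simpl; [ring | rewrite IH; ring]. Qed.

Lemma is_derive_rsum (n : nat) (u : nat -> R -> R) (l : nat -> R) (x : R) :
  (forall i, (i < n)%nat -> is_derive (u i) x (l i)) ->
  is_derive (fun s => rsum n (fun i => u i s)) x (rsum n l).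
Proof.
  induction n as [|n IH]; intros H; simpl.
  - apply (is_derive_const 0 x).
  - apply (is_derive_plus (fun s => rsum n (fun i => u i s)) (u n) x (rsum n l) (l n)).
    + apply IH; intros; apply H; lia.
    + apply H; lia.
Qed.

Lemma finite_delta (n : nat) (P : nat -> R -> Prop) :
  (forall i d d', P i d -> 0 < d' <= d -> P i d') ->
  (forall i, (i < n)%nat -> exists d, 0 < d /\ P i d) ->
  exists d, 0 < d /\ forall i, (i < n)%nat -> P i d.
Proof.
  intros Hmon; induction n as [|n IH]; intros H.
  - exists 1; split; [lra | intros; lia].
  - destruct IH as [d1 [H1 H1']]; [intros; apply H; lia|].
    destruct (H n) as [d2 [H2 H2']]; [lia|].
    pose proof (Rmin_l d1 d2); pose proof (Rmin_r d1 d2).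
    assert (0 < Rmin d1 d2) by (apply Rmin_glb_lt; lra).
    exists (Rmin d1 d2); split; [lra|]; intros i Hi.
    destruct (Nat.eq_dec i n) as [->|Hne].
    + apply Hmon with d2; [exact H2' | lra].
    + apply Hmon with d1; [apply H1'; lia | lra].
Qed.

Lemma upd_upd (x : nat -> R) (i : nat) (s u : R) : upd (upd x i s) i u = upd x i u.
Proof.
  apply functional_extensionality; intros k; unfold upd.
  destruct (Nat.eqb k i); reflexivity.
Qed.

Lemma upd_same (x : nat -> R) (i : nat) (s : R) : upd x i s i = s.
Proof. unfold upd; rewrite Nat.eqb_refl; reflexivity. Qed.

Lemma upd_id (x : nat -> R) (i : nat) : upd x i (x i) = x.
Proof.
  apply functional_extensionality; intros k; unfold upd.
  destruct (Nat.eqb_spec k i) as [->|]; reflexivity.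
Qed.

Lemma upd_other (x : nat -> R) (i k : nat) (s : R) : k <> i -> upd x i s k = x k.
Proof.
  intros H; unfold upd; destruct (Nat.eqb_spec k i); [contradiction | reflexivity].
Qed.

Lemma upd_comm (x : nat -> R) (i l : nat) (s u : R) :
  i <> l -> upd (upd x i s) l u = upd (upd x l u) i s.
Proof.
  intros H; apply functional_extensionality; intros k; unfold upd.
  destruct (Nat.eqb_spec k l), (Nat.eqb_spec k i); congruence.
Qed.

(* Continuity with respect to the first [n] coordinates forces [F] to ignore the others. *)
Lemma cont_n_dep (n : nat) F x y :
  cont_n n F -> (forall i, (i < n)%nat -> y i = x i) -> F y = F x.
Proof.
  intros HF H.
  destruct (Req_dec (F y) (F x)) as [|Hne]; [assumption|exfalso].
  assert (Hp : 0 < Rabs (F y - F x)) by (apply Rabs_pos_lt; lra).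
  destruct (HF x _ Hp) as [d [Hd Hd']].
  specialize (Hd' y); apply (Rlt_irrefl (Rabs (F y - F x))), Hd'.
  intros i Hi; rewrite (H i Hi); apply Rabs_self_lt, Hd.
Qed.

Lemma cont_n_const (n : nat) (c : R) : cont_n n (fun _ => c).
Proof.
  intros x e He; exists 1; split; [lra|]; intros.
  apply Rabs_self_lt, He.
Qed.

Lemma cont_n_proj (n i : nat) : (i < n)%nat -> cont_n n (fun x => x i).
Proof. intros Hi x e He; exists e; split; [lra|]; intros y H; apply H, Hi. Qed.

Lemma cont_n_comp (m n : nat) F (G : nat -> (nat -> R) -> R) :
  cont_n m F -> (forall i, (i < m)%nat -> cont_n n (G i)) ->
  cont_n n (fun x => F (fun i => G i x)).
Proof.
  intros HF HG x e He.
  destruct (HF (fun i => G i x) e He) as [d [Hd Hd']].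
  destruct (finite_delta m (fun i d1 => forall y, (forall l, (l < n)%nat -> Rabs (y l - x l) < d1) ->
     Rabs (G i y - G i x) < d)) as [d1 [H1 H1']].
  - intros i d1 d2 H H12 y Hy; apply H; intros l Hl; specialize (Hy l Hl); lra.
  - intros i Hi; apply (HG i Hi x d Hd).
  - exists d1; split; [exact H1|]; intros y Hy.
    apply Hd'; intros i Hi; apply H1'; assumption.
Qed.

Lemma cont_n_plus (n : nat) F G :
  cont_n n F -> cont_n n G -> cont_n n (fun x => F x + G x).
Proof.
  intros HF HG x e He.
  destruct (HF x (e / 2)) as [d1 [H1 H1']]; [lra|].
  destruct (HG x (e / 2)) as [d2 [H2 H2']]; [lra|].
  pose proof (Rmin_l d1 d2); pose proof (Rmin_r d1 d2).
  exists (Rmin d1 d2); split; [apply Rmin_glb_lt; lra|]; intros y Hy.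
  assert (A1 := H1' y); assert (A2 := H2' y).
  replace (F y + G y - (F x + G x)) with ((F y - F x) + (G y - G x)) by ring.
  eapply Rle_lt_trans; [apply Rabs_triang|].
  assert (Rabs (F y - F x) < e / 2) by (apply A1; intros i Hi; specialize (Hy i Hi); lra).
  assert (Rabs (G y - G x) < e / 2) by (apply A2; intros i Hi; specialize (Hy i Hi); lra).
  lra.
Qed.

Lemma cont_n_mult (n : nat) F G :
  cont_n n F -> cont_n n G -> cont_n n (fun x => F x * G x).
Proof.
  intros HF HG x e He.
  set (A := Rabs (F x) + 1); set (B := Rabs (G x) + 1).
  assert (HA : 1 <= A) by (unfold A; pose proof (Rabs_pos (F x)); lra).
  assert (HB : 1 <= B) by (unfold B; pose proof (Rabs_pos (G x)); lra).
  set (e1 := Rmin 1 (e / (2 * A * B))).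
  assert (He1 : 0 < e1).
  { apply Rmin_glb_lt; [lra|]. apply Rdiv_lt_0_compat; nra. }
  assert (He1' : e1 * (2 * A * B) <= e).
  { pose proof (Rmin_r 1 (e / (2 * A * B))) as Hr; fold e1 in Hr.
    apply Rmult_le_compat_r with (r := 2 * A * B) in Hr; [|nra].
    replace (e / (2 * A * B) * (2 * A * B)) with e in Hr by (field; split; lra). exact Hr. }
  assert (He11 : e1 <= 1) by apply Rmin_l.
  destruct (HF x e1 He1) as [d1 [H1 H1']].
  destruct (HG x e1 He1) as [d2 [H2 H2']].
  pose proof (Rmin_l d1 d2); pose proof (Rmin_r d1 d2).
  exists (Rmin d1 d2); split; [apply Rmin_glb_lt; lra|]; intros y Hy.
  assert (A1 : Rabs (F y - F x) < e1) by (apply H1'; intros i Hi; specialize (Hy i Hi); lra).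
  assert (A2 : Rabs (G y - G x) < e1) by (apply H2'; intros i Hi; specialize (Hy i Hi); lra).
  replace (F y * G y - F x * G x)
    with ((F y - F x) * (G y - G x) + (F x * (G y - G x) + (F y - F x) * G x)) by ring.
  eapply Rle_lt_trans; [apply Rabs_triang|].
  pose proof (Rabs_triang (F x * (G y - G x)) ((F y - F x) * G x)) as T.
  rewrite !Rabs_mult in T; rewrite Rabs_mult.
  set (u := Rabs (F y - F x)) in *; set (v := Rabs (G y - G x)) in *.
  assert (0 <= u) by apply Rabs_pos; assert (0 <= v) by apply Rabs_pos.
  assert (E1 : u * v <= e1 * v) by (apply Rmult_le_compat_r; lra).
  assert (E1' : e1 * v <= 1 * v) by (apply Rmult_le_compat_r; lra).
  assert (E2 : Rabs (F x) * v = (A - 1) * v) by (unfold A; ring).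
  assert (E3 : u * Rabs (G x) = u * (B - 1)) by (unfold B; ring).
  assert (E4 : A * v < A * e1) by (apply Rmult_lt_compat_l; lra).
  assert (E5 : u * (B - 1) <= e1 * (B - 1)) by (apply Rmult_le_compat_r; lra).
  assert (A * e1 <= e1 * (A * B)).
  { rewrite Rmult_comm; apply Rmult_le_compat_l; [lra|].
    rewrite <- (Rmult_1_r A) at 1; apply Rmult_le_compat_l; lra. }
  assert (e1 * (B - 1) <= e1 * (A * B)).
  { apply Rmult_le_compat_l; [lra|]. apply Rle_trans with (1 * B); [lra|].
    apply Rmult_le_compat_r; lra. }
  lra.
Qed.

Lemma Ck_cont (k n : nat) F : Ck_n k n F -> cont_n n F.
Proof. destruct k; simpl; tauto. Qed.

Lemma Ck_pred (k n : nat) F : Ck_n (S k) n F -> Ck_n k n F.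
Proof.
  revert F; induction k as [|k IH]; intros F [HC HD].
  - split; [exact HC | exact I].
  - split; [exact HC|]; intros i Hi; destruct (HD i Hi) as [H1 H2].
    split; [exact H1 | apply IH, H2].
Qed.

Lemma Ck_is_derive (k n : nat) F i x s :
  Ck_n (S k) n F -> (i < n)%nat ->
  is_derive (fun u => F (upd x i u)) s (partial_n i F (upd x i s)).
Proof.
  intros [_ HD] Hi; destruct (HD i Hi) as [H1 _].
  specialize (H1 (upd x i s)); unfold partial_n.
  rewrite upd_same in *.
  apply is_derive_ext with (fun u => F (upd (upd x i s) i u));
    [intros u; rewrite upd_upd; reflexivity|].
  apply Derive_correct, H1.
Qed.

(* The increment is telescoped by switching the coordinates of [x] to those of [y] one at a time. *)
Lemma C1_differentiable (n : nat) F x eps :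
  Ck_n 1 n F -> 0 < eps -> exists delta, 0 < delta /\
    forall y, (forall i, (i < n)%nat -> Rabs (y i - x i) < delta) ->
      Rabs (F y - F x - rsum n (fun i => partial_n i F x * (y i - x i)))
        <= eps * rsum n (fun i => Rabs (y i - x i)).
Proof.
  intros HF He.
  destruct (finite_delta n (fun i d => forall y,
     (forall l, (l < n)%nat -> Rabs (y l - x l) < d) ->
     Rabs (partial_n i F y - partial_n i F x) < eps)) as [d [Hd Hd']].
  - intros i d1 d2 H H12 y Hy; apply H; intros l Hl; specialize (Hy l Hl); lra.
  - intros i Hi; destruct HF as [_ HD]; destruct (HD i Hi) as [_ [HC _]].
    apply HC, He.
  - exists d; split; [exact Hd|]; intros y Hy.
    set (z := fun m k => if Nat.ltb k m then y k else x k).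
    assert (Hz : forall m, (m <= n)%nat ->
      Rabs (F (z m) - F x - rsum m (fun i => partial_n i F x * (y i - x i)))
        <= eps * rsum m (fun i => Rabs (y i - x i))).
    { induction m as [|m IH]; intros Hm; simpl.
      - replace (z 0%nat) with x by (apply functional_extensionality; intros; reflexivity).
        replace (F x - F x - 0) with 0 by ring; rewrite Rabs_R0; lra.
      - specialize (IH ltac:(lia)).
        assert (Ez : z (S m) = upd (z m) m (y m)).
        { apply functional_extensionality; intros k; unfold z, upd.
          destruct (Nat.ltb_spec k (S m)), (Nat.eqb_spec k m),
            (Nat.ltb_spec k m); subst; try reflexivity; lia. }
        assert (Ez' : z m = upd (z m) m (x m)).
        { apply functional_extensionality; intros k; unfold z, upd.
          destruct (Nat.eqb_spec k m),
            (Nat.ltb_spec k m); subst; try reflexivity; lia. }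
        destruct (MVT_gen (fun s => F (upd (z m) m s)) (x m) (y m)
                   (fun s => partial_n m F (upd (z m) m s))) as [c [Hc HM]].
        + intros s _; apply (Ck_is_derive 0 n); [exact HF | lia].
        + intros s _; apply continuity_pt_filterlim, (ex_derive_continuous (fun s => F (upd (z m) m s))).
          eexists; apply (Ck_is_derive 0 n); [exact HF | lia].
        + rewrite <- Ez, <- Ez' in HM.
          assert (HP : Rabs (partial_n m F (upd (z m) m c) - partial_n m F x) < eps).
          { apply Hd'; [lia|]; intros l Hl.
            destruct (Nat.eq_dec l m) as [->|Hlm].
            - rewrite upd_same; apply Rle_lt_trans with (Rabs (y m - x m)); [|apply Hy, Hl].
              revert Hc; unfold Rmin, Rmax; destruct (Rle_dec (x m) (y m));
                intros; unfold Rabs; repeat destruct Rcase_abs; lra.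
            - rewrite upd_other by assumption; unfold z.
              destruct (Nat.ltb l m); [apply Hy, Hl|].
              apply Rabs_self_lt, Hd. }
          replace (F (z (S m)) - F x -
             (rsum m (fun i => partial_n i F x * (y i - x i)) + partial_n m F x * (y m - x m)))
            with ((F (z m) - F x - rsum m (fun i => partial_n i F x * (y i - x i)))
              + (partial_n m F (upd (z m) m c) - partial_n m F x) * (y m - x m)) by lra.
          eapply Rle_trans; [apply Rabs_triang|].
          rewrite Rmult_plus_distr_l; apply Rplus_le_compat; [exact IH|].
          rewrite Rabs_mult; apply Rmult_le_compat_r; [apply Rabs_pos | lra]. }
    specialize (Hz n (Nat.le_refl n)).
    (* [z n] and [y] agree only on the coordinates below [n]; continuity is what makes [F] blind to
       the others. *)
    replace (F y) with (F (z n)); [exact Hz|].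
    apply (cont_n_dep n); [apply (Ck_cont 1), HF|].
    intros i Hi; unfold z; apply Nat.ltb_lt in Hi; rewrite Hi; reflexivity.
Qed.

(** The linear part of [F] along the curve is differentiated coordinatewise. What remains is the
    error in [C1_differentiable], small relative to the increments of the curve, whose sum is at
    most [A |u - s|]; each [+ 1] in [A] is the slack in the differentiability of one coordinate. *)
Lemma chain_rule (n : nat) F (c : R -> nat -> R) (l : nat -> R) (s : R) :
  Ck_n 1 n F -> (forall i, (i < n)%nat -> is_derive (fun u => c u i) s (l i)) ->
  is_derive (fun u => F (c u)) s (rsum n (fun i => partial_n i F (c s) * l i)).
Proof.
  intros HF Hc.
  assert (HL : is_derive (fun u => rsum n (fun i => partial_n i F (c s) * (c u i - c s i))) s
                 (rsum n (fun i => partial_n i F (c s) * l i))).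
  { apply is_derive_rsum; intros i Hi.
    evar_last; [apply is_derive_scal, (is_derive_minus (fun u => c u i) (fun _ => c s i));
                [apply Hc, Hi | apply is_derive_const] |].
    simpl; unfold minus, plus, opp, zero; simpl; ring. }
  apply is_derive_eps; intros eps He.
  set (A := rsum n (fun i => Rabs (l i) + 1)).
  assert (HA : 0 <= A).
  { apply rsum_pos; intros i _; pose proof (Rabs_pos (l i)); lra. }
  assert (He' : 0 < eps / (2 * (A + 1))) by (apply Rdiv_lt_0_compat; lra).
  destruct (C1_differentiable n F (c s) _ HF He') as [d1 [Hd1 H1]].
  destruct (proj1 (is_derive_eps _ _ _) HL (eps / 2)) as [d2 [Hd2 H2]]; [lra|].
  destruct (finite_delta n (fun i d => forall u, Rabs (u - s) < d ->
     Rabs (c u i - c s i) <= (Rabs (l i) + 1) * Rabs (u - s) /\ Rabs (c u i - c s i) < d1))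
    as [d3 [Hd3 H3]].
  - intros i d d' H Hdd u Hu; apply H; lra.
  - intros i Hi; destruct (proj1 (is_derive_eps _ _ _) (Hc i Hi) 1) as [d [Hd Hd']]; [lra|].
    pose proof (Rabs_pos (l i)) as Hl.
    assert (Hq : 0 < d1 / (Rabs (l i) + 1)) by (apply Rdiv_lt_0_compat; lra).
    pose proof (Rmin_l d (d1 / (Rabs (l i) + 1))); pose proof (Rmin_r d (d1 / (Rabs (l i) + 1))).
    exists (Rmin d (d1 / (Rabs (l i) + 1))); split; [apply Rmin_glb_lt; lra|].
    intros u Hu.
    assert (B : Rabs (c u i - c s i) <= (Rabs (l i) + 1) * Rabs (u - s)).
    { specialize (Hd' u ltac:(lra)).
      replace (c u i - c s i) with ((c u i - c s i - l i * (u - s)) + l i * (u - s)) by ring.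
      eapply Rle_trans; [apply Rabs_triang|]; rewrite Rabs_mult; lra. }
    split; [exact B|]; eapply Rle_lt_trans; [exact B|].
    apply Rlt_le_trans with ((Rabs (l i) + 1) * (d1 / (Rabs (l i) + 1))).
    + apply Rmult_lt_compat_l; lra.
    + right; field; lra.
  - pose proof (Rmin_l d2 d3); pose proof (Rmin_r d2 d3).
    exists (Rmin d2 d3); split; [apply Rmin_glb_lt; lra|]; intros u Hu.
    specialize (H2 u ltac:(lra)).
    assert (H1u := H1 (c u) (fun i Hi => proj2 (H3 i Hi u ltac:(lra)))).
    assert (S0 : rsum n (fun i => partial_n i F (c s) * (c s i - c s i)) = 0).
    { clear; induction n as [|n IH]; simpl; [reflexivity | rewrite IH; ring]. }
    rewrite S0 in H2.
    set (Lu := rsum n (fun i => partial_n i F (c s) * (c u i - c s i))) in *.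
    set (D := rsum n (fun i => partial_n i F (c s) * l i)) in *.
    replace (F (c u) - F (c s) - D * (u - s))
      with ((F (c u) - F (c s) - Lu) + (Lu - 0 - D * (u - s))) by ring.
    eapply Rle_trans; [apply Rabs_triang|].
    assert (HS : rsum n (fun i => Rabs (c u i - c s i)) <= Rabs (u - s) * A).
    { unfold A; rewrite <- rsum_scal; apply rsum_le; intros i Hi.
      rewrite (Rmult_comm (Rabs (u - s))); apply H3; [exact Hi | lra]. }
    assert (HF1 : eps / (2 * (A + 1)) * rsum n (fun i => Rabs (c u i - c s i))
              <= eps / 2 * Rabs (u - s)).
    { apply Rle_trans with (eps / (2 * (A + 1)) * (Rabs (u - s) * (A + 1))).
      - apply Rmult_le_compat_l; [lra|]. pose proof (Rabs_pos (u - s)); nra.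
      - right; field; lra. }
    lra.
Qed.

(** * Closure properties of the class C^k and symmetry of second derivatives *)

Lemma partial_const (i : nat) (c : R) : partial_n i (fun _ => c) = fun _ => 0.
Proof. apply functional_extensionality; intros x; unfold partial_n; apply Derive_const. Qed.

Lemma Ck_const (k n : nat) (c : R) : Ck_n k n (fun _ => c).
Proof.
  revert c; induction k as [|k IH]; intros c; (split; [apply cont_n_const|]); [exact I|].
  intros i Hi; split; [intros x; apply ex_derive_const|].
  rewrite partial_const; apply IH.
Qed.

Lemma Ck_proj (k n l : nat) : (l < n)%nat -> Ck_n k n (fun x => x l).
Proof.
  intros Hl; destruct k as [|k]; (split; [apply cont_n_proj, Hl|]); [exact I|].
  intros i Hi.
  assert (HD : forall x, is_derive (fun s => upd x i s l) (x i) (if Nat.eqb l i then 1 else 0)).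
  { intros x; unfold upd; destruct (Nat.eqb l i); [apply @is_derive_id | apply @is_derive_const]. }
  split; [intros x; eexists; apply HD|].
  replace (partial_n i (fun x => x l)) with (fun _ : nat -> R => if Nat.eqb l i then 1 else 0)
    by (apply functional_extensionality; intros x; symmetry; apply is_derive_unique, HD).
  apply Ck_const.
Qed.

Lemma Ck_is_derive0 (k n : nat) F i x :
  Ck_n (S k) n F -> (i < n)%nat ->
  is_derive (fun u => F (upd x i u)) (x i) (partial_n i F x).
Proof.
  intros HF Hi; assert (H := Ck_is_derive k n F i x (x i) HF Hi).
  rewrite upd_id in H; exact H.
Qed.

Lemma Ck_partial (k n i : nat) F : Ck_n (S k) n F -> (i < n)%nat -> Ck_n k n (partial_n i F).
Proof. intros [_ H] Hi; apply H, Hi. Qed.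

(** Lets an induction on [k] supply explicit formulas for the partial derivatives; extensionality
    identifies them with [partial_n]. *)
Lemma Ck_intro (k n : nat) F (dF : nat -> (nat -> R) -> R) :
  cont_n n F ->
  (forall i x, (i < n)%nat -> is_derive (fun u => F (upd x i u)) (x i) (dF i x)) ->
  (forall i, (i < n)%nat -> Ck_n k n (dF i)) -> Ck_n (S k) n F.
Proof.
  intros HC HD HK; split; [exact HC|]; intros i Hi.
  split; [intros x; eexists; apply HD, Hi|].
  replace (partial_n i F) with (dF i); [apply HK, Hi|].
  apply functional_extensionality; intros x; symmetry; apply is_derive_unique, HD, Hi.
Qed.

Lemma Ck_plus (k n : nat) F G : Ck_n k n F -> Ck_n k n G -> Ck_n k n (fun x => F x + G x).
Proof.
  revert F G; induction k as [|k IH]; intros F G HF HG.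
  - split; [apply cont_n_plus; [apply HF | apply HG] | exact I].
  - apply Ck_intro with (fun i x => partial_n i F x + partial_n i G x).
    + apply cont_n_plus; [apply HF | apply HG].
    + intros i x Hi; apply @is_derive_plus; eapply Ck_is_derive0; eassumption.
    + intros i Hi; apply IH; apply Ck_partial; assumption.
Qed.

Lemma Ck_mult (k n : nat) F G : Ck_n k n F -> Ck_n k n G -> Ck_n k n (fun x => F x * G x).
Proof.
  revert F G; induction k as [|k IH]; intros F G HF HG.
  - split; [apply cont_n_mult; [apply HF | apply HG] | exact I].
  - apply Ck_intro with (fun i x => partial_n i F x * G x + F x * partial_n i G x).
    + apply cont_n_mult; [apply HF | apply HG].
    + intros i x Hi.
      evar_last; [apply (is_derive_mult (fun u => F (upd x i u)) (fun u => G (upd x i u)));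
        [eapply Ck_is_derive0; eassumption | eapply Ck_is_derive0; eassumption |
         intros; apply Rmult_comm] |].
      rewrite !upd_id; reflexivity.
    + intros i Hi; apply Ck_plus; apply IH;
        solve [apply Ck_partial; assumption | apply Ck_pred; assumption].
Qed.

Lemma Ck_rsum (k n m : nat) (F : nat -> (nat -> R) -> R) :
  (forall i, (i < m)%nat -> Ck_n k n (F i)) -> Ck_n k n (fun x => rsum m (fun i => F i x)).
Proof.
  induction m as [|m IH]; intros H; simpl; [apply Ck_const|].
  apply Ck_plus; [apply IH; intros; apply H; lia | apply H; lia].
Qed.

(** By the chain rule a partial derivative of the composite is a sum of products, one factor being
    again a composite, with [partial_n i F] outside. The induction therefore has to generalise over
    [F]. *)
Lemma Ck_comp (k m n : nat) F (G : nat -> (nat -> R) -> R) :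
  Ck_n k m F -> (forall i, (i < m)%nat -> Ck_n k n (G i)) ->
  Ck_n k n (fun x => F (fun i => G i x)).
Proof.
  revert F G; induction k as [|k IH]; intros F G HF HG.
  - split; [|exact I]; apply (cont_n_comp m); [apply HF | intros; apply HG; assumption].
  - apply Ck_intro with (fun l x => rsum m (fun i => partial_n i F (fun i => G i x) * partial_n l (G i) x)).
    + apply (cont_n_comp m); [apply HF | intros; apply HG; assumption].
    + intros l x Hl.
      assert (H1 : Ck_n 1 m F).
      { clear - HF; induction k as [|k IH]; [exact HF | apply IH, Ck_pred, HF]. }
      assert (H := chain_rule m F (fun u i => G i (upd x l u)) (fun i => partial_n l (G i) x) (x l) H1).
      simpl in H; rewrite upd_id in H; apply H.
      intros i Hi; eapply Ck_is_derive0; [apply HG, Hi | exact Hl].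
    + intros l Hl; apply Ck_rsum; intros i Hi; apply Ck_mult.
      * apply IH; [apply Ck_partial; assumption | intros; apply Ck_pred, HG; assumption].
      * apply Ck_partial; [apply HG, Hi | exact Hl].
Qed.

(** Schwarz's theorem for the restriction [w] of [F] to a coordinate plane; the preliminary
    identities turn derivatives of slices into iterated partials at a point of that plane. *)
Lemma partial_comm (n i l : nat) F x :
  Ck_n 2 n F -> (i < n)%nat -> (l < n)%nat -> i <> l ->
  partial_n i (partial_n l F) x = partial_n l (partial_n i F) x.
Proof.
  intros HF Hi Hl Hil.
  set (w := fun u v => F (upd (upd x i u) l v)).
  assert (HF1 := Ck_pred _ _ _ HF).
  assert (D1 : forall u v, is_derive (fun z => w z v) u (partial_n i F (upd (upd x i u) l v))).
  { intros u v; unfold w; rewrite upd_comm by assumption.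
    apply is_derive_ext with (fun z => F (upd (upd x l v) i z));
      [intros; rewrite upd_comm by congruence; reflexivity|].
    eapply Ck_is_derive; eassumption. }
  assert (D2 : forall u v, is_derive (fun z => w u z) v (partial_n l F (upd (upd x i u) l v))).
  { intros u v; unfold w; eapply Ck_is_derive; eassumption. }
  assert (Hp : forall u v, is_derive (fun z => partial_n l F (upd (upd x i z) l v)) u
                 (partial_n i (partial_n l F) (upd (upd x i u) l v))).
  { intros u v; rewrite upd_comm by assumption.
    apply is_derive_ext with (fun z => partial_n l F (upd (upd x l v) i z));
      [intros; rewrite upd_comm by congruence; reflexivity|].
    eapply Ck_is_derive; [apply Ck_partial; eassumption | exact Hi]. }
  assert (Hq : forall u v, is_derive (fun z => partial_n i F (upd (upd x i u) l z)) v
                 (partial_n l (partial_n i F) (upd (upd x i u) l v))).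
  { intros u v; eapply Ck_is_derive; [apply Ck_partial; eassumption | exact Hl]. }
  assert (Up : forall u v, Derive (fun z : R => partial_n l F (upd (upd x i z) l v)) u
                 = partial_n i (partial_n l F) (upd (upd x i u) l v)).
  { intros; apply is_derive_unique, Hp. }
  assert (Uq : forall u v, Derive (fun z : R => partial_n i F (upd (upd x i u) l z)) v
                 = partial_n l (partial_n i F) (upd (upd x i u) l v)).
  { intros; apply is_derive_unique, Hq. }
  assert (E1 : forall v, (fun z => Derive (fun t => w z t) v)
                = fun z => partial_n l F (upd (upd x i z) l v)).
  { intros v; apply functional_extensionality; intros z; apply is_derive_unique, D2. }
  assert (E2 : forall u, (fun z => Derive (fun t => w t z) u)
                = fun z => partial_n i F (upd (upd x i u) l z)).
  { intros v; apply functional_extensionality; intros z; apply is_derive_unique, D1. }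
  assert (Hx : upd (upd x i (x i)) l (x l) = x).
  { rewrite upd_id, upd_id; reflexivity. }
  assert (HC : forall r r', (r < n)%nat -> (r' < n)%nat -> forall e, 0 < e -> exists d, 0 < d /\
    forall y, (forall i, (i < n)%nat -> Rabs (y i - x i) < d) ->
      Rabs (partial_n r (partial_n r' F) y - partial_n r (partial_n r' F) x) < e).
  { intros r r' Hr Hr'; apply (Ck_cont 0), Ck_partial; [apply Ck_partial|]; assumption. }
  assert (Hclose : forall u v d, Rabs (u - x i) < d -> Rabs (v - x l) < d ->
    forall r, (r < n)%nat -> Rabs (upd (upd x i u) l v r - x r) < d).
  { intros u v d Hu Hv r _; unfold upd.
    destruct (Nat.eqb_spec r l) as [->|]; [exact Hv|].
    destruct (Nat.eqb_spec r i) as [->|]; [exact Hu|].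
    apply Rabs_self_lt; pose proof (Rabs_pos (u - x i)); lra. }
  assert (HS := Schwarz w (x i) (x l)).
  rewrite E1, E2 in HS.
  rewrite Up, Uq, Hx in HS; apply HS; clear HS.
  - exists (mkposreal 1 Rlt_0_1); intros u v _ _; rewrite E1, E2; repeat split; eexists;
      [apply D1 | apply D2 | apply Hp | apply Hq].
  - intros e; destruct (HC i l Hi Hl e (cond_pos e)) as [d [Hd Hd']].
    exists (mkposreal d Hd); simpl; intros u v Hu Hv; rewrite !E1, !Up, Hx; apply Hd', Hclose; assumption.
  - intros e; destruct (HC l i Hl Hi e (cond_pos e)) as [d [Hd Hd']].
    exists (mkposreal d Hd); simpl; intros u v Hu Hv; rewrite !E2, !Uq, Hx; apply Hd', Hclose; assumption.
Qed.

(** * Smooth families of functions of (q, p) *)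

(** At closed indices both this match and [upd] compute, so slices such as
    [upd (point4 j t q p) 2 u] are convertible to [f j t u p] and the general lemmas apply
    directly. *)
Definition point4 (j t q p : R) : nat -> R :=
  fun k => match k with 0%nat => j | 1%nat => t | 2%nat => q | 3%nat => p | _ => 0 end.

Lemma smooth4_dq f : smooth4 f -> smooth4 (fun j t => dq (f j t)).
Proof. intros H k; exact (Ck_partial k 4 2 _ (H (S k)) ltac:(lia)). Qed.

Lemma smooth4_dp f : smooth4 f -> smooth4 (fun j t => dp (f j t)).
Proof. intros H k; exact (Ck_partial k 4 3 _ (H (S k)) ltac:(lia)). Qed.

Lemma is_derive_dq f j t q p :
  smooth4 f -> is_derive (fun x => f j t x p) q (dq (f j t) q p).
Proof. intros H; exact (Ck_is_derive0 0 4 _ 2 (point4 j t q p) (H 1%nat) ltac:(lia)). Qed.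

Lemma is_derive_dp f j t q p :
  smooth4 f -> is_derive (fun y => f j t q y) p (dp (f j t) q p).
Proof. intros H; exact (Ck_is_derive0 0 4 _ 3 (point4 j t q p) (H 1%nat) ltac:(lia)). Qed.

Lemma dq_dp_comm f j t q p :
  smooth4 f -> dq (dp (f j t)) q p = dp (dq (f j t)) q p.
Proof.
  intros H; exact (partial_comm 4 2 3 _ (point4 j t q p) (H 2%nat)
    ltac:(lia) ltac:(lia) ltac:(lia)).
Qed.

Lemma smooth4_cont f j t q p eps :
  smooth4 f -> 0 < eps -> exists delta, 0 < delta /\ forall j' t' q' p',
    Rabs (j' - j) < delta -> Rabs (t' - t) < delta ->
    Rabs (q' - q) < delta -> Rabs (p' - p) < delta ->
    Rabs (f j' t' q' p' - f j t q p) < eps.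
Proof.
  intros H He; destruct (Ck_cont _ _ _ (H 0%nat) (point4 j t q p) eps He) as [d [Hd Hd']].
  exists d; split; [exact Hd|]; intros.
  apply (Hd' (point4 j' t' q' p')); intros i Hi.
  destruct i as [|[|[|[|i]]]]; simpl; try assumption; lia.
Qed.

Lemma smooth4_comp f A B C D :
  smooth4 f -> smooth4 A -> smooth4 B -> smooth4 C -> smooth4 D ->
  smooth4 (fun j t q p => f (A j t q p) (B j t q p) (C j t q p) (D j t q p)).
Proof.
  intros Hf HA HB HC HD k.
  apply (Ck_comp k 4 4 _ (fun i x => match i with
    | 0%nat => A (x 0%nat) (x 1%nat) (x 2%nat) (x 3%nat)
    | 1%nat => B (x 0%nat) (x 1%nat) (x 2%nat) (x 3%nat)
    | 2%nat => C (x 0%nat) (x 1%nat) (x 2%nat) (x 3%nat)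
    | _ => D (x 0%nat) (x 1%nat) (x 2%nat) (x 3%nat) end) (Hf k)).
  intros [|[|[|i]]] _; [apply HA | apply HB | apply HC | apply HD].
Qed.

Lemma smooth2_comp g A B :
  smooth2 g -> smooth4 A -> smooth4 B ->
  smooth4 (fun j t q p => g (A j t q p) (B j t q p)).
Proof.
  intros Hg HA HB k.
  apply (Ck_comp k 2 4 _ (fun i x => match i with
    | 0%nat => A (x 0%nat) (x 1%nat) (x 2%nat) (x 3%nat)
    | _ => B (x 0%nat) (x 1%nat) (x 2%nat) (x 3%nat) end) (Hg k)).
  intros [|i] _; [apply HA | apply HB].
Qed.

Lemma smooth4_const c : smooth4 (fun _ _ _ _ => c).
Proof. intros k; apply Ck_const. Qed.

Lemma smooth4_j : smooth4 (fun j _ _ _ => j).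
Proof. intros k; apply (Ck_proj k 4 0); lia. Qed.

Lemma smooth4_t : smooth4 (fun _ t _ _ => t).
Proof. intros k; apply (Ck_proj k 4 1); lia. Qed.

Lemma smooth4_q : smooth4 (fun _ _ q _ => q).
Proof. intros k; apply (Ck_proj k 4 2); lia. Qed.

Lemma smooth4_p : smooth4 (fun _ _ _ p => p).
Proof. intros k; apply (Ck_proj k 4 3); lia. Qed.

Lemma smooth4_plus f g :
  smooth4 f -> smooth4 g -> smooth4 (fun j t q p => f j t q p + g j t q p).
Proof. intros Hf Hg k; apply Ck_plus; [apply Hf | apply Hg]. Qed.

Lemma smooth4_mult f g :
  smooth4 f -> smooth4 g -> smooth4 (fun j t q p => f j t q p * g j t q p).
Proof. intros Hf Hg k; apply Ck_mult; [apply Hf | apply Hg]. Qed.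

Lemma smooth4_opp f : smooth4 f -> smooth4 (fun j t q p => - f j t q p).
Proof.
  intros H; replace (fun j t q p => - f j t q p) with (fun j t q p => -1 * f j t q p).
  - apply smooth4_mult; [apply smooth4_const | exact H].
  - do 4 (apply functional_extensionality; intro); ring.
Qed.

Lemma smooth4_minus f g :
  smooth4 f -> smooth4 g -> smooth4 (fun j t q p => f j t q p - g j t q p).
Proof. intros; apply smooth4_plus; [assumption | apply smooth4_opp; assumption]. Qed.

Lemma smooth4_pow f n : smooth4 f -> smooth4 (fun j t q p => f j t q p ^ n).
Proof.
  intros H; induction n as [|n IH]; simpl; [apply smooth4_const|].
  apply smooth4_mult; assumption.
Qed.

Lemma chain_rule2 f j t (u v : R -> R) s lu lv :
  smooth4 f -> is_derive u s lu -> is_derive v s lv ->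
  is_derive (fun x => f j t (u x) (v x)) s
    (dq (f j t) (u s) (v s) * lu + dp (f j t) (u s) (v s) * lv).
Proof.
  intros Hf Hu Hv.
  assert (H := chain_rule 4 _ (fun x => point4 j t (u x) (v x))
    (fun i => match i with 2%nat => lu | 3%nat => lv | _ => 0 end) s (Hf 1%nat)).
  evar_last; [apply H|].
  - intros [|[|[|[|i]]]] Hi; simpl; [apply @is_derive_const | apply @is_derive_const
      | exact Hu | exact Hv | lia].
  - unfold rsum, partial_n, dq, dp, upd; simpl; ring.
Qed.

Lemma dq_comp f A B j t q p :
  smooth4 f -> smooth4 A -> smooth4 B ->
  dq (fun q p => f j t (A j t q p) (B j t q p)) q p
  = dq (f j t) (A j t q p) (B j t q p) * dq (A j t) q p
    + dp (f j t) (A j t q p) (B j t q p) * dq (B j t) q p.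
Proof.
  intros Hf HA HB; apply is_derive_unique.
  apply (chain_rule2 f j t (fun x => A j t x p) (fun x => B j t x p) q);
    [assumption | apply is_derive_dq, HA | apply is_derive_dq, HB].
Qed.

Lemma dp_comp f A B j t q p :
  smooth4 f -> smooth4 A -> smooth4 B ->
  dp (fun q p => f j t (A j t q p) (B j t q p)) q p
  = dq (f j t) (A j t q p) (B j t q p) * dp (A j t) q p
    + dp (f j t) (A j t q p) (B j t q p) * dp (B j t) q p.
Proof.
  intros Hf HA HB; apply is_derive_unique.
  apply (chain_rule2 f j t (fun y => A j t q y) (fun y => B j t q y) p);
    [assumption | apply is_derive_dp, HA | apply is_derive_dp, HB].
Qed.

Lemma dq_plus f g j t q p : smooth4 f -> smooth4 g ->
  dq (fun q p => f j t q p + g j t q p) q p = dq (f j t) q p + dq (g j t) q p.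
Proof. intros; apply Derive_plus; eexists; apply is_derive_dq; assumption. Qed.

Lemma dp_plus f g j t q p : smooth4 f -> smooth4 g ->
  dp (fun q p => f j t q p + g j t q p) q p = dp (f j t) q p + dp (g j t) q p.
Proof. intros; apply Derive_plus; eexists; apply is_derive_dp; assumption. Qed.

Lemma dq_minus f g j t q p : smooth4 f -> smooth4 g ->
  dq (fun q p => f j t q p - g j t q p) q p = dq (f j t) q p - dq (g j t) q p.
Proof. intros; apply Derive_minus; eexists; apply is_derive_dq; assumption. Qed.

Lemma dp_minus f g j t q p : smooth4 f -> smooth4 g ->
  dp (fun q p => f j t q p - g j t q p) q p = dp (f j t) q p - dp (g j t) q p.
Proof. intros; apply Derive_minus; eexists; apply is_derive_dp; assumption. Qed.

Lemma dq_mult f g j t q p : smooth4 f -> smooth4 g ->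
  dq (fun q p => f j t q p * g j t q p) q p
  = dq (f j t) q p * g j t q p + f j t q p * dq (g j t) q p.
Proof. intros; apply Derive_mult; eexists; apply is_derive_dq; assumption. Qed.

Lemma dp_mult f g j t q p : smooth4 f -> smooth4 g ->
  dp (fun q p => f j t q p * g j t q p) q p
  = dp (f j t) q p * g j t q p + f j t q p * dp (g j t) q p.
Proof. intros; apply Derive_mult; eexists; apply is_derive_dp; assumption. Qed.

Lemma smooth4_Dpn n f : smooth4 f -> smooth4 (fun j t => Dpn n (f j t)).
Proof.
  intros H; induction n as [|n IH]; simpl; [exact H | exact (smooth4_dp _ IH)].
Qed.

Lemma smooth4_Dqn n f : smooth4 f -> smooth4 (fun j t => Dqn n (f j t)).
Proof.
  intros H; induction n as [|n IH]; simpl; [exact H | exact (smooth4_dq _ IH)].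
Qed.

Lemma Dqn_shift n h : Dqn n (dq h) = Dqn (S n) h.
Proof.
  induction n as [|n IH]; [reflexivity|].
  change (Dqn (S n) (dq h)) with (dq (Dqn n (dq h))); rewrite IH; reflexivity.
Qed.

Lemma Dpn_shift n h : Dpn n (dp h) = Dpn (S n) h.
Proof.
  induction n as [|n IH]; [reflexivity|].
  change (Dpn (S n) (dp h)) with (dp (Dpn n (dp h))); rewrite IH; reflexivity.
Qed.

(** Jets are written with the [p]-derivatives innermost, so an inner [dq] has to pass through them
    before it can join the outer [q]-derivatives. *)
Lemma Dpn_dq n f j t : smooth4 f -> Dpn n (dq (f j t)) = dq (Dpn n (f j t)).
Proof.
  intros H; induction n as [|n IH]; [reflexivity|].
  change (Dpn (S n) (dq (f j t))) with (dp (Dpn n (dq (f j t)))); rewrite IH.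
  do 2 (apply functional_extensionality; intro); symmetry.
  apply (dq_dp_comm (fun j t => Dpn n (f j t))), smooth4_Dpn, H.
Qed.

Lemma Dpn_minus n f g j t : smooth4 f -> smooth4 g ->
  Dpn n (fun q p => f j t q p - g j t q p) = fun q p => Dpn n (f j t) q p - Dpn n (g j t) q p.
Proof.
  intros Hf Hg; induction n as [|n IH]; [reflexivity|].
  change (dp (Dpn n (fun q p => f j t q p - g j t q p))
    = fun q p => Dpn (S n) (f j t) q p - Dpn (S n) (g j t) q p).
  rewrite IH; do 2 (apply functional_extensionality; intro).
  apply (dp_minus (fun j t => Dpn n (f j t)) (fun j t => Dpn n (g j t))); apply smooth4_Dpn; assumption.
Qed.

Lemma Dqn_minus n f g j t : smooth4 f -> smooth4 g ->
  Dqn n (fun q p => f j t q p - g j t q p) = fun q p => Dqn n (f j t) q p - Dqn n (g j t) q p.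
Proof.
  intros Hf Hg; induction n as [|n IH]; [reflexivity|].
  change (dq (Dqn n (fun q p => f j t q p - g j t q p))
    = fun q p => Dqn (S n) (f j t) q p - Dqn (S n) (g j t) q p).
  rewrite IH; do 2 (apply functional_extensionality; intro).
  apply (dq_minus (fun j t => Dqn n (f j t)) (fun j t => Dqn n (g j t))); apply smooth4_Dqn; assumption.
Qed.

(** * Estimates near the origin, uniform in the parameter *)

Definition near (j0 : R) (P : R -> R -> R -> Prop) : Prop :=
  exists delta, 0 < delta /\ forall j q p,
    Rabs (j - j0) < delta -> Rabs q < delta -> Rabs p < delta -> P j q p.

Lemma near_and j0 (P Q : R -> R -> R -> Prop) :
  near j0 P -> near j0 Q -> near j0 (fun j q p => P j q p /\ Q j q p).
Proof.
  intros [d1 [H1 H1']] [d2 [H2 H2']].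
  pose proof (Rmin_l d1 d2); pose proof (Rmin_r d1 d2).
  exists (Rmin d1 d2); split; [apply Rmin_glb_lt; lra|].
  intros; split; [apply H1' | apply H2']; lra.
Qed.

Lemma near_imp j0 (P Q : R -> R -> R -> Prop) :
  (forall j q p, P j q p -> Q j q p) -> near j0 P -> near j0 Q.
Proof. intros H [d [H1 H1']]; exists d; split; [exact H1|]; intros; apply H, H1'; assumption. Qed.

Lemma near_cont f j0 tau eps :
  smooth4 f -> 0 < eps -> near j0 (fun j q p => Rabs (f j tau q p - f j0 tau 0 0) < eps).
Proof.
  intros Hf He; destruct (smooth4_cont f j0 tau 0 0 eps Hf He) as [d [Hd Hd']].
  exists d; split; [exact Hd|]; intros; apply Hd'; try assumption;
    unfold Rminus; rewrite ?Ropp_0, ?Rplus_0_r; try assumption.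
  rewrite Rplus_opp_r, Rabs_R0; exact Hd.
Qed.

Lemma near_bound f j0 tau :
  smooth4 f -> exists C, 0 < C /\ near j0 (fun j q p => Rabs (f j tau q p) <= C).
Proof.
  intros Hf; exists (Rabs (f j0 tau 0 0) + 1); split; [pose proof (Rabs_pos (f j0 tau 0 0)); lra|].
  eapply near_imp; [|apply (near_cont f j0 tau 1 Hf Rlt_0_1)].
  intros j q p H; simpl in H; pose proof (Rabs_triang_inv (f j tau q p) (f j0 tau 0 0)); lra.
Qed.

Lemma MVT_bound (f df : R -> R) (x y C : R) :
  (forall z, Rmin x y <= z <= Rmax x y -> is_derive f z (df z)) ->
  (forall z, Rmin x y <= z <= Rmax x y -> Rabs (df z) <= C) ->
  Rabs (f y - f x) <= C * Rabs (y - x).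
Proof.
  intros Hd Hb; destruct (MVT_gen f x y df) as [c [Hc E]].
  - intros z Hz; apply Hd; lra.
  - intros z Hz; apply continuity_pt_filterlim, (ex_derive_continuous f); eexists; apply Hd, Hz.
  - rewrite E, Rabs_mult; apply Rmult_le_compat_r; [apply Rabs_pos | apply Hb, Hc].
Qed.

Lemma between_abs x z : Rmin 0 x <= z <= Rmax 0 x -> Rabs z <= Rabs x.
Proof.
  unfold Rmin, Rmax; destruct (Rle_dec 0 x); intros; unfold Rabs; repeat destruct Rcase_abs; lra.
Qed.

(** Taylor's estimate by induction on the order: the first derivatives have a vanishing jet of one
    order less, and integrating their bounds along the path from the origin through [(0, p)] to
    [(q, p)] gains one power. Because the jet vanishes for all nearby [j], the constant does not
    depend on [j]. *)
Lemma flat_bound k : forall f j0 tau,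
  smooth4 f ->
  near j0 (fun j _ _ => forall m n, (m + n <= k)%nat -> Dqn m (Dpn n (f j tau)) 0 0 = 0) ->
  exists C, 0 < C /\
    near j0 (fun j q p => Rabs (f j tau q p) <= C * (Rabs q + Rabs p) ^ S k).
Proof.
  assert (Step : forall k f j0 tau C, smooth4 f -> 0 < C ->
    near j0 (fun j _ _ => f j tau 0 0 = 0) ->
    near j0 (fun j q p => Rabs (dq (f j tau) q p) <= C * (Rabs q + Rabs p) ^ k) ->
    near j0 (fun j q p => Rabs (dp (f j tau) q p) <= C * (Rabs q + Rabs p) ^ k) ->
    near j0 (fun j q p => Rabs (f j tau q p) <= C * (Rabs q + Rabs p) ^ S k)).
  { clear k; intros k f j0 tau C Hf HC H0 Hq Hp.
    destruct (near_and _ _ _ H0 (near_and _ _ _ Hq Hp)) as [d [Hd Hd']].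
    exists d; split; [exact Hd|]; intros j q p Hj Hqd Hpd.
    assert (Ez : f j tau 0 0 = 0).
    { apply (Hd' j 0 0); rewrite ?Rabs_R0; assumption. }
    pose proof (Rabs_pos q); pose proof (Rabs_pos p).
    assert (B1 : Rabs (f j tau 0 p - f j tau 0 0)
              <= C * (Rabs q + Rabs p) ^ k * Rabs (p - 0)).
    { apply (MVT_bound (fun y => f j tau 0 y) (fun y => dp (f j tau) 0 y));
        intros z Hz; [apply is_derive_dp, Hf|].
      apply between_abs in Hz.
      apply Rle_trans with (C * (Rabs 0 + Rabs z) ^ k);
        [apply Hd'; rewrite ?Rabs_R0; lra|].
      apply Rmult_le_compat_l; [lra|]; apply pow_incr; pose proof (Rabs_pos z).
      rewrite Rabs_R0; lra. }
    assert (B2 : Rabs (f j tau q p - f j tau 0 p)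
              <= C * (Rabs q + Rabs p) ^ k * Rabs (q - 0)).
    { apply (MVT_bound (fun x => f j tau x p) (fun x => dq (f j tau) x p));
        intros z Hz; [apply is_derive_dq, Hf|].
      apply between_abs in Hz.
      apply Rle_trans with (C * (Rabs z + Rabs p) ^ k);
        [apply Hd'; lra|].
      apply Rmult_le_compat_l; [lra|]; apply pow_incr; pose proof (Rabs_pos z); lra. }
    rewrite Ez, !Rminus_0_r in B1; rewrite Rminus_0_r in B2.
    replace (f j tau q p) with ((f j tau q p - f j tau 0 p) + f j tau 0 p) by ring.
    eapply Rle_trans; [apply Rabs_triang|]; simpl; nra. }
  induction k as [|k IH]; intros f j0 tau Hf HJ.
  - destruct (near_bound _ j0 tau (smooth4_dq f Hf)) as [C1 [HC1 N1]].
    destruct (near_bound _ j0 tau (smooth4_dp f Hf)) as [C2 [HC2 N2]].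
    exists (C1 + C2); split; [lra|]; apply Step; try assumption; try lra.
    + eapply near_imp; [|apply HJ]; intros j q p H; apply (H 0%nat 0%nat); lia.
    + eapply near_imp; [|apply N1]; intros j q p H; simpl in *; lra.
    + eapply near_imp; [|apply N2]; intros j q p H; simpl in *; lra.
  - destruct (IH (fun j t => dq (f j t)) j0 tau (smooth4_dq f Hf)) as [C1 [HC1 N1]].
    { eapply near_imp; [|apply HJ]; intros j q p H m n Hmn.
      rewrite (Dpn_dq n f j tau Hf), Dqn_shift; apply H; lia. }
    destruct (IH (fun j t => dp (f j t)) j0 tau (smooth4_dp f Hf)) as [C2 [HC2 N2]].
    { eapply near_imp; [|apply HJ]; intros j q p H m n Hmn.
      rewrite Dpn_shift; apply H; lia. }
    exists (C1 + C2); split; [lra|]; apply Step; try assumption; try lra.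
    + eapply near_imp; [|apply HJ]; intros j q p H; apply (H 0%nat 0%nat); lia.
    + eapply near_imp; [|apply N1]; intros j q p H; cbv beta in *.
      assert (0 <= (Rabs q + Rabs p) ^ S k)
        by (apply pow_le; pose proof (Rabs_pos q); pose proof (Rabs_pos p); lra); nra.
    + eapply near_imp; [|apply N2]; intros j q p H; cbv beta in *.
      assert (0 <= (Rabs q + Rabs p) ^ S k)
        by (apply pow_le; pose proof (Rabs_pos q); pose proof (Rabs_pos p); lra); nra.
Qed.

(** * Global solutions of Lipschitz systems *)

(** A sigma type, so that limits taken at each time can be assembled into a function by [proj1_sig].
    The factor 2 is the sum of the geometric tail. *)
Lemma geometric_limit (u : nat -> R) (c : R) :
  (forall n, Rabs (u (S n) - u n) <= c * (1 / 2) ^ n) ->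
  {l : R | forall n, Rabs (u n - l) <= 2 * c * (1 / 2) ^ n}.
Proof.
  intros H.
  assert (Hc : 0 <= c).
  { specialize (H 0%nat); simpl in H; pose proof (Rabs_pos (u 1%nat - u 0%nat)); lra. }
  assert (Hpos : forall n, 0 < (1 / 2) ^ n) by (intros; apply pow_lt; lra).
  assert (Hm : forall n m, Rabs (u (n + m)%nat - u n) <= 2 * c * ((1 / 2) ^ n - (1 / 2) ^ (n + m))).
  { intros n; induction m as [|m IH].
    - rewrite Nat.add_0_r; unfold Rminus; rewrite !Rplus_opp_r, Rabs_R0; lra.
    - rewrite Nat.add_succ_r.
      replace (u (S (n + m)) - u n) with ((u (S (n + m)) - u (n + m)%nat) + (u (n + m)%nat - u n)) by ring.
      eapply Rle_trans; [apply Rabs_triang|].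
      specialize (H (n + m)%nat); simpl; lra. }
  assert (Hb : forall n m, (n <= m)%nat -> Rabs (u m - u n) <= 2 * c * (1 / 2) ^ n).
  { intros n m Hnm; replace m with (n + (m - n))%nat by lia.
    eapply Rle_trans; [apply Hm|].
    apply Rmult_le_compat_l; [lra|]; specialize (Hpos (n + (m - n))%nat); lra. }
  destruct (Rcomplete.R_complete u) as [l Hl].
  - intros e He.
    (* Two tails contribute [4 c (1/2)^N]; the extra 1 covers [c = 0]. *)
    destruct (pow_lt_1_zero (1 / 2)) with (y := e / (4 * c + 1)) as [N HN].
    + rewrite Rabs_pos_eq; lra.
    + apply Rdiv_lt_0_compat; lra.
    + exists N; intros n m Hn Hm'; unfold Rdist.
      specialize (HN N (Nat.le_refl N)); rewrite Rabs_pos_eq in HN by (left; apply Hpos).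
      replace (u n - u m) with ((u n - u N) + - (u m - u N)) by ring.
      eapply Rle_lt_trans; [apply Rabs_triang|]; rewrite Rabs_Ropp.
      pose proof (Hb N n Hn); pose proof (Hb N m Hm').
      apply Rle_lt_trans with ((4 * c) * (1 / 2) ^ N); [lra|].
      apply Rle_lt_trans with ((4 * c + 1) * (1 / 2) ^ N); [specialize (Hpos N); nra|].
      apply Rlt_le_trans with ((4 * c + 1) * (e / (4 * c + 1))).
      * apply Rmult_lt_compat_l; lra.
      * right; field; lra.
  - exists l; intros n; apply le_epsilon; intros e He.
    destruct (Hl e He) as [N HN].
    specialize (HN (n + N)%nat ltac:(lia)); unfold Rdist in HN.
    replace (u n - l) with (- (u (n + N)%nat - u n) + (u (n + N)%nat - l)) by ring.
    eapply Rle_trans; [apply Rabs_triang|]; rewrite Rabs_Ropp.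
    specialize (Hb n (n + N)%nat ltac:(lia)); lra.
Qed.

Lemma le_geometric_zero (x c : R) : (forall n, x <= c * (1 / 2) ^ n) -> x <= 0.
Proof.
  intros H; destruct (Rle_or_lt x 0) as [|Hx]; [assumption|exfalso].
  assert (Hc : 0 < c) by (specialize (H 0%nat); simpl in H; lra).
  destruct (pow_lt_1_zero (1 / 2)) with (y := x / c) as [N HN].
  - rewrite Rabs_pos_eq; lra.
  - apply Rdiv_lt_0_compat; lra.
  - specialize (HN N (Nat.le_refl N)); rewrite Rabs_pos_eq in HN by (apply pow_le; lra).
    specialize (H N); apply (Rmult_lt_compat_l c) in HN; [|lra].
    replace (c * (x / c)) with x in HN by (field; lra); lra.
Qed.

Lemma is_derive_cosh k s : is_derive (fun s => cosh (k * s)) s (k * sinh (k * s)).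
Proof. unfold cosh, sinh; auto_derive; [exact I | field]. Qed.

Lemma is_derive_sinh k s : is_derive (fun s => sinh (k * s)) s (k * cosh (k * s)).
Proof. unfold cosh, sinh; auto_derive; [exact I | field]. Qed.

Lemma cosh_ge_1 x : 1 <= cosh x.
Proof.
  unfold cosh; pose proof (exp_pos x); pose proof (exp_pos (- x)).
  assert (exp x * exp (- x) = 1) by (rewrite <- exp_plus, Rplus_opp_r, exp_0; reflexivity).
  pose proof (pow2_ge_0 (exp x - exp (- x))).
  apply Rnot_lt_le; intros Hlt.
  assert (0 < (2 - (exp x + exp (- x))) * (2 + (exp x + exp (- x)))) by (apply Rmult_lt_0_compat; lra).
  nra.
Qed.

Lemma abs_sinh_le_cosh x : Rabs (sinh x) <= cosh x.
Proof.
  apply Rabs_le; unfold sinh, cosh; pose proof (exp_pos x); pose proof (exp_pos (- x)); lra.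
Qed.

(* The weight cosh(k s) grows at rate k in both time directions, so integrating against it
   gains a factor 1/k; this makes the Picard map a contraction on the whole line. *)
Lemma cosh_weight (D dD : R -> R) (A k : R) :
  0 < k -> 0 <= A -> D 0 = 0 -> (forall s, is_derive D s (dD s)) ->
  (forall s, Rabs (dD s) <= A * cosh (k * s)) ->
  forall s, Rabs (D s) <= A / k * cosh (k * s).
Proof.
  intros Hk HA H0 HD Hb s.
  (* Both [A/k sinh(k s) + D s] and [A/k sinh(k s) - D s] vanish at 0 and have a nonnegative
     derivative, so each has the sign of [s]. Positive and negative times are thus treated
     together. *)
  assert (HE : forall sg, (sg = 1 \/ sg = -1) ->
     exists c, 0 <= c /\ A / k * sinh (k * s) + sg * D s = c * s).
  { intros sg Hsg.
    destruct (MVT_gen (fun s => A / k * sinh (k * s) + sg * D s) 0 s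
       (fun s => A * cosh (k * s) + sg * dD s)) as [c [_ Hc]].
    - intros x _; evar_last.
      + apply @is_derive_plus; [apply is_derive_scal, is_derive_sinh | apply is_derive_scal, HD].
      + unfold plus; simpl; field; lra.
    - intros x _; apply continuity_pt_filterlim.
      apply (ex_derive_continuous (fun s => A / k * sinh (k * s) + sg * D s)).
      eexists; apply @is_derive_plus; [apply is_derive_scal, is_derive_sinh | apply is_derive_scal, HD].
    - exists (A * cosh (k * c) + sg * dD c); split.
      + specialize (Hb c); apply Rabs_le_between in Hb; destruct Hsg; subst; lra.
      + rewrite H0, Rmult_0_r, sinh_0 in Hc; rewrite Rminus_0_r in Hc; lra. }
  destruct (HE 1 (or_introl eq_refl)) as [c1 [P1 E1]].
  destruct (HE (-1) (or_intror eq_refl)) as [c2 [P2 E2]].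
  assert (HS : Rabs (D s) <= A / k * Rabs (sinh (k * s))).
  { assert (HAk : 0 <= A / k) by (apply Rdiv_le_0_compat; lra).
    rewrite <- (Rabs_pos_eq (A / k)) by exact HAk; rewrite <- Rabs_mult.
    destruct (Rle_or_lt 0 s) as [Hs|Hs].
    - assert (0 <= c1 * s) by nra; assert (0 <= c2 * s) by nra.
      unfold Rabs; repeat destruct Rcase_abs; lra.
    - assert (c1 * s <= 0) by nra; assert (c2 * s <= 0) by nra.
      unfold Rabs; repeat destruct Rcase_abs; lra. }
  eapply Rle_trans; [exact HS|]; apply Rmult_le_compat_l;
    [apply Rdiv_le_0_compat; lra | apply abs_sinh_le_cosh].
Qed.

Lemma is_derive_RInt_continuous (g : R -> R) (a s : R) :
  (forall x, continuous g x) -> is_derive (fun s => RInt g a s) s (g s).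
Proof.
  intros Hg; apply is_derive_RInt with a; [|apply Hg].
  exists (mkposreal 1 Rlt_0_1); intros y _; apply (RInt_correct g), (ex_RInt_continuous g); intros; apply Hg.
Qed.

Definition lipschitz2 (X : R -> R -> R) (L : R) : Prop :=
  forall q p q' p', Rabs (X q p - X q' p') <= L * (Rabs (q - q') + Rabs (p - p')).

Lemma continuous_eps (g : R -> R) (x : R) :
  continuous g x <-> forall eps, 0 < eps -> exists delta, 0 < delta /\
    forall y, Rabs (y - x) < delta -> Rabs (g y - g x) < eps.
Proof.
  split.
  - intros H eps He.
    assert (H' := proj1 (filterlim_locally g (g x)) H (mkposreal eps He)).
    destruct H' as [d Hd]; exists d; split; [apply cond_pos|]; intros y Hy; apply Hd, Hy.
  - intros H; apply filterlim_locally; intros eps.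
    destruct (H eps (cond_pos eps)) as [d [Hd Hd']].
    exists (mkposreal d Hd); intros y Hy; apply Hd', Hy.
Qed.

Lemma lipschitz2_continuous X L (u v : R -> R) s :
  0 < L -> lipschitz2 X L -> continuous u s -> continuous v s ->
  continuous (fun r => X (u r) (v r)) s.
Proof.
  intros HL HX Hu Hv; apply continuous_eps; intros e He.
  assert (He' : 0 < e / (2 * L)) by (apply Rdiv_lt_0_compat; lra).
  destruct (proj1 (continuous_eps u s) Hu _ He') as [d1 [H1 H1']].
  destruct (proj1 (continuous_eps v s) Hv _ He') as [d2 [H2 H2']].
  pose proof (Rmin_l d1 d2); pose proof (Rmin_r d1 d2).
  exists (Rmin d1 d2); split; [apply Rmin_glb_lt; lra|]; intros y Hy.
  eapply Rle_lt_trans; [apply HX|].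
  apply Rlt_le_trans with (L * (e / (2 * L) + e / (2 * L))).
  - apply Rmult_lt_compat_l; [lra|]; specialize (H1' y ltac:(lra)); specialize (H2' y ltac:(lra)); lra.
  - right; field; lra.
Qed.

Section Picard.

Variables (X Y : R -> R -> R) (L q0 p0 : R).
Hypothesis (HL : 0 < L) (HX : lipschitz2 X L) (HY : lipschitz2 Y L).

Fixpoint picard_iter (n : nat) : (R -> R) * (R -> R) :=
  match n with
  | O => (fun _ => q0, fun _ => p0)
  | S n => let z := picard_iter n in
      (fun s => q0 + RInt (fun r => X (fst z r) (snd z r)) 0 s,
       fun s => p0 + RInt (fun r => Y (fst z r) (snd z r)) 0 s)
  end.

Lemma is_derive_integral (Z : R -> R -> R) (u v : R -> R) (c s : R) :
  lipschitz2 Z L -> (forall r, continuous u r) -> (forall r, continuous v r) ->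
  is_derive (fun s => c + RInt (fun r => Z (u r) (v r)) 0 s) s (Z (u s) (v s)).
Proof.
  intros HZ Hu Hv; evar_last.
  - apply @is_derive_plus; [apply @is_derive_const|].
    apply (is_derive_RInt_continuous (fun r => Z (u r) (v r))).
    intros x; apply lipschitz2_continuous with L; auto.
  - apply plus_zero_l.
Qed.

Lemma picard_iter_continuous n s :
  continuous (fst (picard_iter n)) s /\ continuous (snd (picard_iter n)) s.
Proof.
  revert s; induction n as [|n IH]; intros s; simpl.
  - split; apply continuous_const.
  - split; [apply (ex_derive_continuous (fun s => q0 + RInt _ 0 s))
           |apply (ex_derive_continuous (fun s => p0 + RInt _ 0 s))];
      eexists; apply is_derive_integral; try assumption; intros; apply IH.
Qed.

(** [cosh_weight] gains [1 / k], and each of the two components has Lipschitz constant [L]: together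
    they contract by [2 L / k = 1/2]. [B] measures the first Picard step. *)
Let k := 4 * L.
Let B := (Rabs (X q0 p0) + Rabs (Y q0 p0)) / k.

Lemma picard_step n s :
  Rabs (fst (picard_iter (S n)) s - fst (picard_iter n) s)
  + Rabs (snd (picard_iter (S n)) s - snd (picard_iter n) s)
  <= B * cosh (k * s) * (1 / 2) ^ n.
Proof.
  assert (Hk : 0 < k) by (unfold k; lra).
  revert s; induction n as [|n IH]; intros s.
  - simpl.
    assert (HE : forall Z c, lipschitz2 Z L ->
      Rabs (c + RInt (fun _ => Z q0 p0) 0 s - c) <= Rabs (Z q0 p0) / k * cosh (k * s)).
    { intros Z c HZ.
      apply (cosh_weight (fun s => c + RInt (fun _ => Z q0 p0) 0 s - c) (fun _ => Z q0 p0));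
        try assumption; [apply Rabs_pos | | |].
      - rewrite RInt_point; unfold zero; simpl; ring.
      - intros r; evar_last.
        + apply @is_derive_minus; [|apply @is_derive_const].
          apply (is_derive_integral Z (fun _ => q0) (fun _ => p0) c r HZ); intros; apply continuous_const.
        + apply Rminus_0_r.
      - intros r; rewrite <- (Rmult_1_r (Rabs (Z q0 p0))) at 1.
        apply Rmult_le_compat_l; [apply Rabs_pos | apply cosh_ge_1]. }
    pose proof (HE X q0 HX); pose proof (HE Y p0 HY).
    unfold B; unfold Rdiv in *; lra.
  - assert (HE : forall Z c, lipschitz2 Z L ->
      Rabs ((c + RInt (fun r => Z (fst (picard_iter (S n)) r) (snd (picard_iter (S n)) r)) 0 s)
          - (c + RInt (fun r => Z (fst (picard_iter n) r) (snd (picard_iter n) r)) 0 s))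
      <= L * (B * (1 / 2) ^ n) / k * cosh (k * s)).
    { intros Z c HZ.
      apply (cosh_weight (fun s => (c + RInt (fun r => Z (fst (picard_iter (S n)) r) (snd (picard_iter (S n)) r)) 0 s)
          - (c + RInt (fun r => Z (fst (picard_iter n) r) (snd (picard_iter n) r)) 0 s))
        (fun s => Z (fst (picard_iter (S n)) s) (snd (picard_iter (S n)) s)
            - Z (fst (picard_iter n) s) (snd (picard_iter n) s))); try assumption.
      - assert (0 <= B).
        { unfold B; apply Rdiv_le_0_compat; [|exact Hk].
          pose proof (Rabs_pos (X q0 p0)); pose proof (Rabs_pos (Y q0 p0)); lra. }
        assert (0 <= (1 / 2) ^ n) by (apply pow_le; lra).
        apply Rmult_le_pos; [lra|]; apply Rmult_le_pos; assumption.
      - rewrite !RInt_point; unfold zero; simpl; ring.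
      - intros r; apply @is_derive_minus; apply is_derive_integral; try assumption;
          intros; apply picard_iter_continuous.
      - intros r; eapply Rle_trans; [apply HZ|].
        specialize (IH r).
        replace (L * (B * (1 / 2) ^ n) * cosh (k * r)) with (L * (B * cosh (k * r) * (1 / 2) ^ n)) by ring.
        apply Rmult_le_compat_l; lra. }
    pose proof (HE X q0 HX) as E1; pose proof (HE Y p0 HY) as E2.
    change (fst (picard_iter (S (S n))) s) with
      (q0 + RInt (fun r => X (fst (picard_iter (S n)) r) (snd (picard_iter (S n)) r)) 0 s).
    change (snd (picard_iter (S (S n))) s) with
      (p0 + RInt (fun r => Y (fst (picard_iter (S n)) r) (snd (picard_iter (S n)) r)) 0 s).
    change (fst (picard_iter (S n)) s) with
      (q0 + RInt (fun r => X (fst (picard_iter n) r) (snd (picard_iter n) r)) 0 s).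
    change (snd (picard_iter (S n)) s) with
      (p0 + RInt (fun r => Y (fst (picard_iter n) r) (snd (picard_iter n) r)) 0 s).
    eapply Rle_trans; [apply Rplus_le_compat; [apply E1 | apply E2]|].
    right; unfold k; simpl; field; lra.
Qed.

(** The iterates converge with error [2 B cosh(k s) (1/2)^n], locally uniformly in [s]. Hence the
    limit is continuous, the integral equation passes to the limit, and the fundamental theorem of
    calculus turns it back into the differential equation. *)
Lemma picard : exists u v : R -> R, u 0 = q0 /\ v 0 = p0 /\
  forall s, is_derive u s (X (u s) (v s)) /\ is_derive v s (Y (u s) (v s)).
Proof.
  assert (Hk : 0 < k) by (unfold k; lra).
  assert (HB : 0 <= B).
  { unfold B; apply Rdiv_le_0_compat; [|exact Hk].
    pose proof (Rabs_pos (X q0 p0)); pose proof (Rabs_pos (Y q0 p0)); lra. }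
  assert (Hu : forall s n, Rabs (fst (picard_iter (S n)) s - fst (picard_iter n) s)
            <= B * cosh (k * s) * (1 / 2) ^ n).
  { intros s n; pose proof (picard_step n s);
      pose proof (Rabs_pos (snd (picard_iter (S n)) s - snd (picard_iter n) s)); lra. }
  assert (Hv : forall s n, Rabs (snd (picard_iter (S n)) s - snd (picard_iter n) s)
            <= B * cosh (k * s) * (1 / 2) ^ n).
  { intros s n; pose proof (picard_step n s);
      pose proof (Rabs_pos (fst (picard_iter (S n)) s - fst (picard_iter n) s)); lra. }
  set (u := fun s => proj1_sig (geometric_limit _ _ (Hu s))).
  set (v := fun s => proj1_sig (geometric_limit _ _ (Hv s))).
  assert (Lu : forall s n, Rabs (fst (picard_iter n) s - u s) <= 2 * (B * cosh (k * s)) * (1 / 2) ^ n).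
  { intros s; apply (proj2_sig (geometric_limit _ _ (Hu s))). }
  assert (Lv : forall s n, Rabs (snd (picard_iter n) s - v s) <= 2 * (B * cosh (k * s)) * (1 / 2) ^ n).
  { intros s; apply (proj2_sig (geometric_limit _ _ (Hv s))). }
  assert (Hcont : forall (w : R -> R) (wn : nat -> R -> R),
    (forall n s, continuous (wn n) s) ->
    (forall s n, Rabs (wn n s - w s) <= 2 * (B * cosh (k * s)) * (1 / 2) ^ n) ->
    forall s, continuous w s).
  { intros w wn Hwn Hw s; apply continuous_eps; intros e He.
    (* Near [s] the weight is at most [cosh (k * s) + 1], so one index [N] serves a whole
       neighbourhood. *)
    set (A := 2 * (B * (cosh (k * s) + 1))).
    assert (HA : 0 <= A) by (unfold A; pose proof (cosh_ge_1 (k * s)); nra).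
    destruct (pow_lt_1_zero (1 / 2)) with (y := e / (4 * (A + 1))) as [N HN].
    { rewrite Rabs_pos_eq; lra. }
    { apply Rdiv_lt_0_compat; lra. }
    specialize (HN N (Nat.le_refl N)); rewrite Rabs_pos_eq in HN by (apply pow_le; lra).
    assert (HAN : A * (1 / 2) ^ N <= e / 4).
    { apply Rle_trans with ((A + 1) * (e / (4 * (A + 1)))); [|right; field; lra].
      assert (0 <= (1 / 2) ^ N) by (apply pow_le; lra); nra. }
    destruct (proj1 (continuous_eps _ s) (Hwn N s) (e / 4)) as [d1 [H1 H1']]; [lra|].
    assert (Hc : continuous (fun s => cosh (k * s)) s).
    { apply (ex_derive_continuous (fun s => cosh (k * s))); eexists; apply is_derive_cosh. }
    destruct (proj1 (continuous_eps _ s) Hc 1) as [d2 [H2 H2']]; [lra|].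
    pose proof (Rmin_l d1 d2); pose proof (Rmin_r d1 d2).
    exists (Rmin d1 d2); split; [apply Rmin_glb_lt; lra|]; intros y Hy.
    specialize (H1' y ltac:(lra)); specialize (H2' y ltac:(lra)).
    assert (Hwy : forall z, cosh (k * z) <= cosh (k * s) + 1 -> Rabs (wn N z - w z) <= e / 4).
    { intros z Hz; eapply Rle_trans; [apply Hw|]; eapply Rle_trans; [|exact HAN].
      apply Rmult_le_compat_r; [apply pow_le; lra|]; unfold A.
      apply Rmult_le_compat_l; [lra|]; apply Rmult_le_compat_l; lra. }
    assert (C1 := Hwy s ltac:(lra)).
    assert (C2 : Rabs (wn N y - w y) <= e / 4).
    { apply Hwy; apply Rabs_def2 in H2'; lra. }
    replace (w y - w s) with (- (wn N y - w y) + ((wn N y - wn N s) + (wn N s - w s))) by ring.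
    eapply Rle_lt_trans; [apply Rabs_triang|]; rewrite Rabs_Ropp.
    pose proof (Rabs_triang (wn N y - wn N s) (wn N s - w s)); lra. }
  assert (Cu : forall s, continuous u s).
  { apply (Hcont u (fun n => fst (picard_iter n))); [intros; apply picard_iter_continuous | exact Lu]. }
  assert (Cv : forall s, continuous v s).
  { apply (Hcont v (fun n => snd (picard_iter n))); [intros; apply picard_iter_continuous | exact Lv]. }
  assert (Hfix : forall (Z : R -> R -> R) c (w : R -> R) (wn : nat -> R -> R), lipschitz2 Z L ->
    (forall n s, wn (S n) s = c + RInt (fun r => Z (fst (picard_iter n) r) (snd (picard_iter n) r)) 0 s) ->
    (forall s n, Rabs (wn n s - w s) <= 2 * (B * cosh (k * s)) * (1 / 2) ^ n) ->
    forall s, w s = c + RInt (fun r => Z (u r) (v r)) 0 s).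
  { intros Z c w wn HZ Hwn Hw s.
    set (U := fun s => c + RInt (fun r => Z (u r) (v r)) 0 s).
    assert (HU : forall n, Rabs (U s - wn (S n) s) <= B * cosh (k * s) * (1 / 2) ^ n).
    { intros n; rewrite Hwn.
      (* The errors of [u] and [v] add up to [4 B cosh(k s) (1/2)^n], and [4 L / k = 1]. *)
      replace (B * cosh (k * s) * (1 / 2) ^ n)
        with (L * (4 * B * (1 / 2) ^ n) / k * cosh (k * s)) by (unfold k; field; lra).
      apply (cosh_weight
        (fun s => U s - (c + RInt (fun r => Z (fst (picard_iter n) r) (snd (picard_iter n) r)) 0 s))
        (fun s => Z (u s) (v s) - Z (fst (picard_iter n) s) (snd (picard_iter n) s))); try assumption.
      - assert (0 <= (1 / 2) ^ n) by (apply pow_le; lra).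
        apply Rmult_le_pos; [lra|]; apply Rmult_le_pos; lra.
      - unfold U; rewrite !RInt_point; unfold zero; simpl; ring.
      - intros r; apply @is_derive_minus; apply is_derive_integral; try assumption;
          intros; apply picard_iter_continuous.
      - intros r; eapply Rle_trans; [apply HZ|].
        specialize (Lu r n); specialize (Lv r n); rewrite Rabs_minus_sym in Lu, Lv.
        replace (L * (4 * B * (1 / 2) ^ n) * cosh (k * r))
          with (L * (4 * (B * cosh (k * r)) * (1 / 2) ^ n)) by ring.
        apply Rmult_le_compat_l; lra. }
    assert (Hz : Rabs (w s - U s) <= 0).
    { apply le_geometric_zero with (2 * B * cosh (k * s)); intros n.
      replace (w s - U s) with (- (wn (S n) s - w s) + - (U s - wn (S n) s)) by ring.
      eapply Rle_trans; [apply Rabs_triang|]; rewrite !Rabs_Ropp.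
      specialize (HU n); specialize (Hw s (S n)); simpl in Hw; lra. }
    pose proof (Rabs_pos (w s - U s)).
    assert (E : Rabs (w s - U s) = 0) by lra.
    destruct (Req_dec (w s - U s) 0) as [E'|E']; [unfold U in E'; lra|].
    apply Rabs_no_R0 in E'; contradiction. }
  assert (Fu := Hfix X q0 u (fun n => fst (picard_iter n)) HX (fun n s => eq_refl) Lu).
  assert (Fv := Hfix Y p0 v (fun n => snd (picard_iter n)) HY (fun n s => eq_refl) Lv).
  exists u, v; split; [|split].
  - rewrite Fu, RInt_point; unfold zero; simpl; ring.
  - rewrite Fv, RInt_point; unfold zero; simpl; ring.
  - intros s; split.
    + apply is_derive_ext with (fun s => q0 + RInt (fun r => X (u r) (v r)) 0 s);
        [intros; symmetry; apply Fu | apply is_derive_integral; assumption].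
    + apply is_derive_ext with (fun s => p0 + RInt (fun r => Y (u r) (v r)) 0 s);
        [intros; symmetry; apply Fv | apply is_derive_integral; assumption].
Qed.

End Picard.

(** * Lyapunov stability of a nondegenerate equilibrium *)

Lemma dist2_origin x : dist2 x origin = sqrt (fst x ^ 2 + snd x ^ 2).
Proof. unfold dist2, origin; simpl fst; simpl snd; rewrite !Rminus_0_r; reflexivity. Qed.

Lemma dist2_origin_lt x e : 0 < e -> (dist2 x origin < e <-> fst x ^ 2 + snd x ^ 2 < e ^ 2).
Proof.
  intros He; rewrite dist2_origin; pose proof (pow2_ge_0 (fst x)); pose proof (pow2_ge_0 (snd x)).
  rewrite <- (sqrt_pow2 e) at 1 by lra; split; intros H1.
  - apply sqrt_lt_0_alt in H1; exact H1.
  - apply sqrt_lt_1_alt; lra.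
Qed.

Lemma abs_lt_of_sq x y e : 0 < e -> x ^ 2 + y ^ 2 < e ^ 2 -> Rabs x < e.
Proof.
  intros He H; apply Rnot_le_lt; intros Hx.
  assert (e ^ 2 <= Rabs x ^ 2) by (apply pow_incr; lra).
  rewrite pow2_abs in *; pose proof (pow2_ge_0 y); lra.
Qed.

Lemma sq_abs_sum_le q p : (Rabs q + Rabs p) ^ 2 <= 2 * (q ^ 2 + p ^ 2).
Proof.
  rewrite <- (pow2_abs q), <- (pow2_abs p); pose proof (pow2_ge_0 (Rabs q - Rabs p)); nra.
Qed.

Lemma linear_approx f j t eps :
  smooth4 f -> f j t 0 0 = 0 -> 0 < eps -> exists delta, 0 < delta /\
    forall q p, Rabs q < delta -> Rabs p < delta ->
      Rabs (f j t q p - (dq (f j t) 0 0 * q + dp (f j t) 0 0 * p)) <= eps * (Rabs q + Rabs p).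
Proof.
  intros Hf H0 He.
  destruct (C1_differentiable 4 _ (point4 j t 0 0) eps (Hf 1%nat) He) as [d [Hd Hd']].
  exists d; split; [exact Hd|]; intros q p Hq Hp.
  specialize (Hd' (point4 j t q p)); unfold rsum in Hd'; simpl in Hd'.
  rewrite H0, !Rminus_0_r in Hd'; unfold partial_n, upd in Hd'; simpl in Hd'.
  unfold Rminus in Hd'; rewrite !Rplus_opp_r, Rabs_R0 in Hd'.
  unfold dq, dp.
  match type of Hd' with ?A -> _ => assert (HA : A) end.
  { intros [|[|[|[|i]]]] Hi; simpl; rewrite ?Rplus_opp_r, ?Rabs_R0, ?Ropp_0, ?Rplus_0_r;
      try assumption; lia. }
  specialize (Hd' HA).
  match goal with |- Rabs ?a <= ?b =>
    match type of Hd' with Rabs ?c <= ?d =>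
      replace a with c by ring; replace b with d by ring; exact Hd' end end.
Qed.

Lemma energy_conserved f j t gam T s :
  smooth4 f -> is_solution (f j t) gam T -> Rabs s < T ->
  f j t (fst (gam s)) (snd (gam s)) = f j t (fst (gam 0)) (snd (gam 0)).
Proof.
  intros Hf Hg Hs.
  assert (H : Rabs (f j t (fst (gam s)) (snd (gam s)) - f j t (fst (gam 0)) (snd (gam 0)))
            <= 0 * Rabs (s - 0)).
  { apply (MVT_bound (fun u => f j t (fst (gam u)) (snd (gam u))) (fun _ => 0)).
    - intros z Hz; apply between_abs in Hz; destruct (Hg z ltac:(lra)) as [H1 H2].
      evar_last; [apply (chain_rule2 f j t (fun u => fst (gam u)) (fun u => snd (gam u)) z _ _ Hf H1 H2)|].
      simpl; ring.
    - intros; rewrite Rabs_R0; lra. }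
  rewrite Rmult_0_l in H.
  destruct (Req_dec (f j t (fst (gam s)) (snd (gam s)) - f j t (fst (gam 0)) (snd (gam 0))) 0) as [|E]; [lra|].
  apply Rabs_pos_lt in E; lra.
Qed.

(** Each of [al * Q] and [ga * Q] is a square plus the determinant times the square of one
    coordinate. Adding the two gives a bound that covers positive and negative definite forms at
    once. *)
Lemma definite_form_bound al be ga q p :
  0 < al * ga - be ^ 2 ->
  (al * ga - be ^ 2) * (q ^ 2 + p ^ 2)
  <= (Rabs al + Rabs ga) * Rabs (al * q ^ 2 + 2 * be * q * p + ga * p ^ 2).
Proof.
  intros HD; set (Q := al * q ^ 2 + 2 * be * q * p + ga * p ^ 2).
  assert (E1 : al * Q = (al * q + be * p) ^ 2 + (al * ga - be ^ 2) * p ^ 2) by (unfold Q; ring).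
  assert (E2 : ga * Q = (be * q + ga * p) ^ 2 + (al * ga - be ^ 2) * q ^ 2) by (unfold Q; ring).
  pose proof (pow2_ge_0 (al * q + be * p)); pose proof (pow2_ge_0 (be * q + ga * p)).
  pose proof (Rle_abs (al * Q)); pose proof (Rle_abs (ga * Q)); rewrite Rabs_mult in *.
  lra.
Qed.

(** Integrates the first-order errors [e1], [e2] of the gradient along the segment from the origin:
    [f(th q, th p) - th^2 Q / 2] has derivative [e1 q + e2 p] in [th]. *)
Lemma energy_quadratic f j t eps :
  smooth4 f -> dq (f j t) 0 0 = 0 -> dp (f j t) 0 0 = 0 -> 0 < eps ->
  exists delta, 0 < delta /\ forall q p, Rabs q < delta -> Rabs p < delta ->
    Rabs (f j t q p - f j t 0 0
      - (dq (dq (f j t)) 0 0 * q ^ 2 + 2 * dp (dq (f j t)) 0 0 * q * p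
         + dp (dp (f j t)) 0 0 * p ^ 2) / 2) <= eps * (q ^ 2 + p ^ 2).
Proof.
  intros Hf Hq0 Hp0 He.
  destruct (linear_approx (fun j t => dq (f j t)) j t (eps / 2) (smooth4_dq f Hf) Hq0) as [d1 [H1 H1']]; [lra|].
  destruct (linear_approx (fun j t => dp (f j t)) j t (eps / 2) (smooth4_dp f Hf) Hp0) as [d2 [H2 H2']]; [lra|].
  pose proof (Rmin_l d1 d2); pose proof (Rmin_r d1 d2).
  exists (Rmin d1 d2); split; [apply Rmin_glb_lt; lra|]; intros q p Hq Hp.
  rewrite (dq_dp_comm f j t 0 0 Hf) in H2'.
  set (al := dq (dq (f j t)) 0 0) in *; set (be := dp (dq (f j t)) 0 0) in *.
  set (ga := dp (dp (f j t)) 0 0) in *.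
  set (Q := al * q ^ 2 + 2 * be * q * p + ga * p ^ 2).
  assert (HM : Rabs ((f j t (1 * q) (1 * p) - 1 ^ 2 * (Q / 2)) - (f j t (0 * q) (0 * p) - 0 ^ 2 * (Q / 2)))
            <= eps * (q ^ 2 + p ^ 2) * Rabs (1 - 0)).
  { apply (MVT_bound (fun th => f j t (th * q) (th * p) - th ^ 2 * (Q / 2))
      (fun th => dq (f j t) (th * q) (th * p) * q + dp (f j t) (th * q) (th * p) * p - th * Q)).
    - intros z _; evar_last.
      + apply @is_derive_minus.
        * apply (chain_rule2 f j t (fun th => th * q) (fun th => th * p) z q p Hf);
            auto_derive; (exact I || ring).
        * instantiate (1 := z * Q); auto_derive; [exact I | field].
      + reflexivity.
    - intros z Hz; rewrite Rmin_left, Rmax_right in Hz by lra.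
      assert (Az : Rabs z <= 1) by (rewrite Rabs_pos_eq; lra).
      pose proof (Rabs_pos q); pose proof (Rabs_pos p); pose proof (Rabs_pos z).
      assert (Bq : Rabs (z * q) <= Rabs q) by (rewrite Rabs_mult; nra).
      assert (Bp : Rabs (z * p) <= Rabs p) by (rewrite Rabs_mult; nra).
      specialize (H1' (z * q) (z * p) ltac:(lra) ltac:(lra)).
      specialize (H2' (z * q) (z * p) ltac:(lra) ltac:(lra)).
      set (e1 := dq (f j t) (z * q) (z * p) - (al * (z * q) + be * (z * p))) in *.
      set (e2 := dp (f j t) (z * q) (z * p) - (be * (z * q) + ga * (z * p))) in *.
      replace (dq (f j t) (z * q) (z * p) * q + dp (f j t) (z * q) (z * p) * p - z * Q)
        with (e1 * q + e2 * p) by (unfold e1, e2, Q; ring).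
      eapply Rle_trans; [apply Rabs_triang|]; rewrite !Rabs_mult.
      assert (F1 : Rabs e1 <= eps / 2 * (Rabs q + Rabs p)) by nra.
      assert (F2 : Rabs e2 <= eps / 2 * (Rabs q + Rabs p)) by nra.
      pose proof (sq_abs_sum_le q p).
      apply Rle_trans with (eps / 2 * (Rabs q + Rabs p) ^ 2); nra. }
  rewrite !Rmult_1_l, !Rmult_0_l, Rminus_0_r, Rabs_R1, Rmult_1_r in HM.
  match goal with |- Rabs ?a <= _ =>
    match type of HM with Rabs ?c <= _ => replace a with c by (unfold Q; field); exact HM end end.
Qed.

(** The absolute energy difference lies between [c / 4] and [M] times the squared radius. An orbit
    leaving the disc of radius [e] meets its circle, where the lower bound contradicts conservation
    of the small initial energy. *)
Lemma stable_of_det_pos f j t :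
  smooth4 f -> dq (f j t) 0 0 = 0 -> dp (f j t) 0 0 = 0 ->
  0 < dq (dq (f j t)) 0 0 * dp (dp (f j t)) 0 0 - dp (dq (f j t)) 0 0 ^ 2 ->
  stable (f j t) origin.
Proof.
  intros Hf Hq0 Hp0 HD.
  set (al := dq (dq (f j t)) 0 0) in *; set (be := dp (dq (f j t)) 0 0) in *.
  set (ga := dp (dp (f j t)) 0 0) in *; set (D := al * ga - be ^ 2) in *.
  set (A := Rabs al + Rabs ga).
  assert (HA : 0 < A).
  { unfold A; pose proof (Rabs_pos al); pose proof (Rabs_pos ga).
    destruct (Req_dec al 0) as [E|E].
    - exfalso; unfold D in HD; rewrite E in HD; pose proof (pow2_ge_0 be); lra.
    - apply Rabs_pos_lt in E; lra. }
  set (c := D / A).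
  assert (Hc : 0 < c) by (apply Rdiv_lt_0_compat; assumption).
  destruct (energy_quadratic f j t (c / 4) Hf Hq0 Hp0) as [d [Hd Hd']]; [lra|].
  fold al be ga in Hd'.
  set (M := Rabs al + 2 * Rabs be + Rabs ga + c).
  assert (HM : 0 < M).
  { unfold M; pose proof (Rabs_pos al); pose proof (Rabs_pos be); pose proof (Rabs_pos ga); lra. }
  assert (Hbounds : forall q p, Rabs q < d -> Rabs p < d ->
    c / 4 * (q ^ 2 + p ^ 2) <= Rabs (f j t q p - f j t 0 0) <= M * (q ^ 2 + p ^ 2)).
  { intros q p Hq Hp; specialize (Hd' q p Hq Hp).
    pose proof (definite_form_bound al be ga q p HD) as HQ.
    assert (HQu : Rabs (al * q ^ 2 + 2 * be * q * p + ga * p ^ 2)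
       <= (Rabs al + 2 * Rabs be + Rabs ga) * (q ^ 2 + p ^ 2)).
    { eapply Rle_trans; [apply Rabs_triang|].
      pose proof (Rabs_triang (al * q ^ 2) (2 * be * q * p)) as T.
      rewrite !Rabs_mult, (Rabs_pos_eq 2), !(Rabs_pos_eq (_ ^ 2)) in * by (lra || apply pow2_ge_0).
      pose proof (Rabs_pos al); pose proof (Rabs_pos be); pose proof (Rabs_pos ga).
      pose proof (pow2_ge_0 q); pose proof (pow2_ge_0 p).
      assert (Rabs q * Rabs p <= q ^ 2 + p ^ 2).
      { pose proof (pow2_ge_0 (Rabs q - Rabs p)); pose proof (pow2_abs q); pose proof (pow2_abs p); nra. }
      assert (2 * Rabs be * Rabs q * Rabs p <= 2 * Rabs be * (q ^ 2 + p ^ 2)) by nra.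
      nra. }
    set (Q := al * q ^ 2 + 2 * be * q * p + ga * p ^ 2) in *.
    assert (HQl : c * (q ^ 2 + p ^ 2) <= Rabs Q).
    { apply Rmult_le_reg_l with A; [exact HA|]; unfold c.
      replace (A * (D / A * (q ^ 2 + p ^ 2))) with (D * (q ^ 2 + p ^ 2)) by (field; lra).
      exact HQ. }
    set (N := q ^ 2 + p ^ 2) in *; set (w := f j t q p - f j t 0 0) in *.
    assert (0 <= N) by (unfold N; pose proof (pow2_ge_0 q); pose proof (pow2_ge_0 p); lra).
    assert (T1 : Rabs (Q / 2) = Rabs Q / 2) by (unfold Rdiv; rewrite Rabs_mult, (Rabs_pos_eq (/ 2)); lra).
    pose proof (Rabs_triang_inv w (Q / 2)); pose proof (Rabs_triang_inv (Q / 2) w).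
    rewrite (Rabs_minus_sym (Q / 2) w) in *; rewrite T1 in *.
    pose proof (Rabs_pos Q); unfold M; split; nra. }
  intros eps Heps.
  set (e := Rmin eps (d / 2)).
  assert (He : 0 < e) by (apply Rmin_glb_lt; lra).
  assert (He1 : e <= eps) by apply Rmin_l.
  assert (He2 : e <= d / 2) by apply Rmin_r.
  assert (HK : 0 < c / (8 * M)) by (apply Rdiv_lt_0_compat; lra).
  (* With [m = min 1 (c / (8 M))], the inequality [m^2 <= m] yields [M dl^2 <= c/8 e^2] without any
     square root. *)
  set (dl := Rmin e (Rmin 1 (c / (8 * M)) * e)).
  assert (Hm1 : 0 < Rmin 1 (c / (8 * M))) by (apply Rmin_glb_lt; lra).
  assert (Hdl : 0 < dl) by (apply Rmin_glb_lt; nra).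
  assert (Hdl' : M * dl ^ 2 < c / 4 * e ^ 2).
  { set (m := Rmin 1 (c / (8 * M))) in *.
    assert (m <= 1) by apply Rmin_l; assert (m <= c / (8 * M)) by apply Rmin_r.
    assert (dl <= m * e) by apply Rmin_r.
    assert (dl ^ 2 <= (m * e) ^ 2) by (apply pow_incr; lra).
    assert (M * m <= c / 8).
    { apply Rle_trans with (M * (c / (8 * M))); [apply Rmult_le_compat_l; lra | right; field; lra]. }
    assert (0 < e ^ 2) by (apply pow_lt; lra).
    apply Rle_lt_trans with (M * (m * e) ^ 2); [apply Rmult_le_compat_l; lra|].
    replace (M * (m * e) ^ 2) with ((M * m) * (m * e ^ 2)) by ring.
    apply Rle_lt_trans with (c / 8 * e ^ 2); [|nra].
    apply Rmult_le_compat; nra. }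
  exists dl; split; [exact Hdl|]; intros gam T Hg H0 s Hs.
  apply Rnot_le_lt; intros Hout.
  set (N := fun u => fst (gam u) ^ 2 + snd (gam u) ^ 2).
  assert (HNs : e ^ 2 <= N s).
  { apply Rnot_lt_le; intros Hlt; apply (proj2 (dist2_origin_lt (gam s) e He)) in Hlt; lra. }
  apply (dist2_origin_lt _ _ Hdl) in H0; fold (N 0) in H0.
  assert (Hde : dl <= e) by apply Rmin_l.
  assert (HNe : dl ^ 2 <= e ^ 2) by (apply pow_incr; lra).
  assert (Hex : exists s', Rabs s' < T /\ N s' = e ^ 2).
  { destruct HNs as [HNs|HNs]; [|exists s; split; [exact Hs | symmetry; exact HNs]].
    (* Rescaling time by [s] makes the interval [[0, 1]] for both signs of [s]. *)
    destruct (Ranalysis5.IVT_interv (fun u => N (u * s) - e ^ 2) 0 1) as [z [Hz Hz']].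
    - intros u Hu; apply continuity_pt_filterlim.
      assert (Hus : Rabs (u * s) < T).
      { rewrite Rabs_mult, (Rabs_pos_eq u) by lra; pose proof (Rabs_pos s); nra. }
      destruct (Hg (u * s) Hus) as [D1 D2].
      apply (ex_derive_continuous (fun u => N (u * s) - e ^ 2)).
      assert (EN : ex_derive N (u * s)).
      { eexists; apply @is_derive_plus; apply is_derive_pow; eassumption. }
      apply @ex_derive_minus; [|apply @ex_derive_const].
      apply (ex_derive_comp N (fun u => u * s)); [exact EN | auto_derive; exact I].
    - lra.
    - rewrite Rmult_0_l; lra.
    - rewrite Rmult_1_l; lra.
    - exists (z * s); split; [|lra].
      rewrite Rabs_mult, (Rabs_pos_eq z) by lra; pose proof (Rabs_pos s); nra. }
  destruct Hex as [s' [Hs' HN']].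
  assert (HE := energy_conserved f j t gam T s' Hf Hg Hs').
  assert (B1 : c / 4 * N s' <= Rabs (f j t (fst (gam s')) (snd (gam s')) - f j t 0 0)).
  { apply Hbounds; [apply (abs_lt_of_sq _ (snd (gam s'))) | apply (abs_lt_of_sq _ (fst (gam s')))];
      try lra; unfold N in HN'; assert (e ^ 2 < d ^ 2) by (apply Rlt_le_trans with ((d/2)^2 + (d/2)^2);
       [assert (e ^ 2 <= (d / 2) ^ 2) by (apply pow_incr; lra); nra | nra]); lra. }
  assert (B2 : Rabs (f j t (fst (gam 0)) (snd (gam 0)) - f j t 0 0) <= M * N 0).
  { assert (dl ^ 2 <= d ^ 2) by (apply pow_incr; lra).
    apply Hbounds; [apply (abs_lt_of_sq _ (snd (gam 0))) | apply (abs_lt_of_sq _ (fst (gam 0)))];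
      try lra; unfold N in H0; lra. }
  rewrite HE, HN' in B1.
  assert (M * N 0 <= M * dl ^ 2) by (apply Rmult_le_compat_l; lra).
  lra.
Qed.

(** * Instability when the Hessian determinant is negative *)

Definition clamp (r x : R) : R := Rmax (- r) (Rmin r x).

Lemma clamp_lipschitz r x y : Rabs (clamp r x - clamp r y) <= Rabs (x - y).
Proof.
  unfold clamp, Rmax, Rmin; repeat destruct Rle_dec; unfold Rabs; repeat destruct Rcase_abs; lra.
Qed.

Lemma clamp_bound r x : 0 <= r -> Rabs (clamp r x) <= r.
Proof.
  intros; unfold clamp, Rmax, Rmin; repeat destruct Rle_dec; unfold Rabs; repeat destruct Rcase_abs; lra.
Qed.

Lemma clamp_id r x : Rabs x <= r -> clamp r x = x.
Proof.
  intros H; apply Rabs_le_between in H; unfold clamp, Rmax, Rmin; repeat destruct Rle_dec; lra.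
Qed.

Lemma between_bound x y z r :
  Rabs x <= r -> Rabs y <= r -> Rmin x y <= z <= Rmax x y -> Rabs z <= r.
Proof.
  intros Hx Hy; apply Rabs_le_between in Hx, Hy; unfold Rmin, Rmax; destruct (Rle_dec x y);
    intros; apply Rabs_le; lra.
Qed.

Lemma box_lipschitz f j t C r q p q' p' :
  smooth4 f ->
  (forall q p, Rabs q <= r -> Rabs p <= r ->
     Rabs (dq (f j t) q p) <= C /\ Rabs (dp (f j t) q p) <= C) ->
  Rabs q <= r -> Rabs p <= r -> Rabs q' <= r -> Rabs p' <= r ->
  Rabs (f j t q p - f j t q' p') <= C * (Rabs (q - q') + Rabs (p - p')).
Proof.
  intros Hf Hb Hq Hp Hq' Hp'.
  assert (B1 : Rabs (f j t q p - f j t q' p) <= C * Rabs (q - q')).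
  { apply (MVT_bound (fun x => f j t x p) (fun x => dq (f j t) x p)); intros z Hz;
      [apply is_derive_dq, Hf | apply Hb; [|assumption]].
    apply (between_bound q' q); assumption. }
  assert (B2 : Rabs (f j t q' p - f j t q' p') <= C * Rabs (p - p')).
  { apply (MVT_bound (fun y => f j t q' y) (fun y => dp (f j t) q' y)); intros z Hz;
      [apply is_derive_dp, Hf | apply Hb; [assumption|]].
    apply (between_bound p' p); assumption. }
  replace (f j t q p - f j t q' p') with ((f j t q p - f j t q' p) + (f j t q' p - f j t q' p')) by ring.
  eapply Rle_trans; [apply Rabs_triang|]; lra.
Qed.

(** Clamping maps the plane into the box without increasing distances, so derivative bounds on the
    box suffice for a global Lipschitz constant. Inside the box the clamped field is the original
    one. *)
Lemma clamped_lipschitz f j t C r :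
  smooth4 f -> 0 < r ->
  (forall q p, Rabs q <= r -> Rabs p <= r ->
     Rabs (dq (f j t) q p) <= C /\ Rabs (dp (f j t) q p) <= C) ->
  lipschitz2 (fun q p => f j t (clamp r q) (clamp r p)) C.
Proof.
  intros Hf Hr Hb q p q' p'.
  assert (C0 : 0 <= C).
  { destruct (Hb 0 0) as [H _]; rewrite ?Rabs_R0; try lra; pose proof (Rabs_pos (dq (f j t) 0 0)); lra. }
  eapply Rle_trans; [apply (box_lipschitz f j t C r); try assumption; apply clamp_bound; lra|].
  apply Rmult_le_compat_l; [exact C0|].
  apply Rplus_le_compat; apply clamp_lipschitz.
Qed.

Lemma lipschitz2_opp X L : lipschitz2 X L -> lipschitz2 (fun q p => - X q p) L.
Proof.
  intros H q p q' p'; replace (- X q p - - X q' p') with (- (X q p - X q' p')) by ring.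
  rewrite Rabs_Ropp; apply H.
Qed.

(* With A the symplectic matrix times the Hessian, A^2 = - det(Hessian), so V(x) = <x, A x>
   satisfies V' = |A x|^2 - det(Hessian) |x|^2 along the linearised flow: a Chetaev function. *)
Lemma chetaev_derivative al be ga D q p X Y e :
  D = be ^ 2 - al * ga -> 0 < D -> 0 <= e ->
  e * (8 * (2 * Rabs be + Rabs (ga - al))) <= D ->
  Rabs (X - (be * q + ga * p)) <= e * (Rabs q + Rabs p) ->
  Rabs (Y - (al * q + be * p)) <= e * (Rabs q + Rabs p) ->
  D / 2 * (q ^ 2 + p ^ 2)
  <= (2 * be * q + (ga - al) * p) * X - ((ga - al) * q - 2 * be * p) * Y.
Proof.
  intros HD HDp He HeD HX HY.
  set (M := 2 * Rabs be + Rabs (ga - al)) in *.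
  set (x := X - (be * q + ga * p)) in *; set (y := Y - (al * q + be * p)) in *.
  set (r := Rabs q + Rabs p) in *.
  assert (Hr : 0 <= r) by (unfold r; pose proof (Rabs_pos q); pose proof (Rabs_pos p); lra).
  assert (E : (2 * be * q + (ga - al) * p) * X - ((ga - al) * q - 2 * be * p) * Y
    = (be * q + ga * p) ^ 2 + (al * q + be * p) ^ 2 + D * (q ^ 2 + p ^ 2)
      + ((2 * be * q + (ga - al) * p) * x - ((ga - al) * q - 2 * be * p) * y)).
  { rewrite HD; unfold x, y; ring. }
  rewrite E.
  assert (L1 : Rabs (2 * be * q + (ga - al) * p) <= M * r).
  { eapply Rle_trans; [apply Rabs_triang|]; rewrite !Rabs_mult, (Rabs_pos_eq 2) by lra.
    unfold M, r; pose proof (Rabs_pos q); pose proof (Rabs_pos p);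
      pose proof (Rabs_pos be); pose proof (Rabs_pos (ga - al)); nra. }
  assert (L2 : Rabs ((ga - al) * q - 2 * be * p) <= M * r).
  { unfold Rminus at 1; eapply Rle_trans; [apply Rabs_triang|].
    rewrite Rabs_Ropp, !Rabs_mult, (Rabs_pos_eq 2) by lra.
    unfold M, r; pose proof (Rabs_pos q); pose proof (Rabs_pos p);
      pose proof (Rabs_pos be); pose proof (Rabs_pos (ga - al)); nra. }
  assert (P1 : Rabs ((2 * be * q + (ga - al) * p) * x) <= M * r * (e * r)).
  { rewrite Rabs_mult; apply Rmult_le_compat; try apply Rabs_pos; assumption. }
  assert (P2 : Rabs (((ga - al) * q - 2 * be * p) * y) <= M * r * (e * r)).
  { rewrite Rabs_mult; apply Rmult_le_compat; try apply Rabs_pos; assumption. }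
  apply Rabs_le_between in P1, P2.
  pose proof (sq_abs_sum_le q p) as Hr2; fold r in Hr2.
  pose proof (pow2_ge_0 (be * q + ga * p)); pose proof (pow2_ge_0 (al * q + be * p)).
  pose proof (pow2_ge_0 r).
  (* The two error terms cost twice this, and [r^2 <= 2 (q^2 + p^2)]: half of the main term
     [D (q^2 + p^2)] is left. This explains the 8 in the hypothesis on [e]. *)
  assert (e * M * r ^ 2 <= D / 8 * r ^ 2) by (apply Rmult_le_compat_r; lra).
  assert (D / 8 * r ^ 2 <= D / 8 * (2 * (q ^ 2 + p ^ 2))) by (apply Rmult_le_compat_l; lra).
  lra.
Qed.

Lemma is_derive_quadratic (u v : R -> R) b c s du dv :
  is_derive u s du -> is_derive v s dv ->
  is_derive (fun s => b * u s ^ 2 + c * u s * v s - b * v s ^ 2) s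
    (2 * b * u s * du + c * (du * v s + u s * dv) - 2 * b * v s * dv).
Proof.
  intros Hu Hv; auto_derive.
  - repeat split; (exists du; exact Hu) || (exists dv; exact Hv).
  - assert (Eu : Derive (fun x : R => u x) s = du) by (apply is_derive_unique; exact Hu).
    assert (Ev : Derive (fun x : R => v x) s = dv) by (apply is_derive_unique; exact Hv).
    rewrite Eu, Ev; ring.
Qed.

(** A continuation argument. While the curve stays in the disc of radius [r] it solves the true
    system, so stability confines it to radius [r / 2]; this gap lets continuity carry it past any
    supposed supremum [T] of the trapped times. *)
Lemma trapped_of_stable (h : R -> R -> R) (u v : R -> R) (r dl : R) :
  0 < r ->
  (forall s, continuous u s) -> (forall s, continuous v s) ->
  (forall T, (forall s, Rabs s < T -> u s ^ 2 + v s ^ 2 < r ^ 2) ->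
     is_solution h (fun s => (u s, v s)) T) ->
  (forall gam T, is_solution h gam T -> dist2 (gam 0) origin < dl ->
     forall s, Rabs s < T -> dist2 (gam s) origin < r / 2) ->
  dist2 (u 0, v 0) origin < dl -> u 0 ^ 2 + v 0 ^ 2 < r ^ 2 ->
  forall s, u s ^ 2 + v s ^ 2 < r ^ 2.
Proof.
  intros Hr Cu Cv Hsol Hst H0 H0'.
  set (N := fun s => u s ^ 2 + v s ^ 2).
  assert (CN : forall s, continuous N s).
  { assert (Csq : forall w : R -> R, (forall s, continuous w s) -> forall s, continuous (fun s => w s ^ 2) s).
    { intros w Hw s; apply (continuous_comp w (fun x => x ^ 2)); [apply Hw|].
      apply (ex_derive_continuous (fun x => x ^ 2)); auto_derive; exact I. }
    intros s; apply (continuous_plus (fun s => u s ^ 2) (fun s => v s ^ 2)); apply Csq; assumption. }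
  set (E := fun T => 0 <= T /\ forall s, Rabs s <= T -> N s < r ^ 2).
  destruct (classic (bound E)) as [HB|HB].
  - exfalso; destruct (completeness E HB) as [T [HT1 HT2]].
    { exists 0; split; [lra|]; intros s Hs.
      assert (s = 0) by (destruct (Req_dec s 0) as [|Hn]; [assumption | apply Rabs_pos_lt in Hn; lra]).
      subst; exact H0'. }
    assert (T0 : 0 <= T).
    { apply HT1; split; [lra|]; intros s Hs.
      assert (s = 0) by (destruct (Req_dec s 0) as [|Hn]; [assumption | apply Rabs_pos_lt in Hn; lra]).
      subst; exact H0'. }
    assert (Hin : forall s, Rabs s < T -> N s < r ^ 2).
    { intros s Hs; destruct (classic (exists T', E T' /\ Rabs s < T')) as [[T' [[_ HE] HsT]]|Hn].
      - apply HE; lra.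
      - exfalso; apply (Rlt_irrefl T), Rle_lt_trans with (Rabs s); [|exact Hs].
        apply HT2; intros T' HT'; apply Rnot_lt_le; intros Hlt; apply Hn; exists T'; split; assumption. }
    assert (Hsm : forall s, Rabs s < T -> N s < (r / 2) ^ 2).
    { intros s Hs; specialize (Hst _ _ (Hsol T Hin) H0 s Hs).
      apply dist2_origin_lt in Hst; [exact Hst | lra]. }
    (* [is_solution] speaks of the open interval only. At an end time the bound [r^2 / 4] is
       transported by continuity from [(1 - th) * s], and the tolerance [r^2 / 2] still leaves [N s]
       below [r^2]. *)
    assert (Hend : forall s, Rabs s = T -> N s < r ^ 2).
    { intros s Hs; destruct (Req_dec T 0) as [E0|E0].
      - assert (s = 0) by (destruct (Req_dec s 0) as [|Hn]; [assumption | apply Rabs_pos_lt in Hn; lra]).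
        subst s; exact H0'.
      - destruct (proj1 (continuous_eps N s) (CN s) (r ^ 2 / 2)) as [d [Hd Hd']].
        { assert (0 < r ^ 2) by (apply pow_lt; lra); lra. }
        set (th := Rmin (1 / 2) (d / (2 * T))).
        assert (Hth : 0 < th) by (apply Rmin_glb_lt; [lra | apply Rdiv_lt_0_compat; lra]).
        assert (th <= 1 / 2) by apply Rmin_l.
        assert (Htd : th * T <= d / 2).
        { apply Rle_trans with (d / (2 * T) * T); [apply Rmult_le_compat_r; [lra | apply Rmin_r] | right; field; lra]. }
        specialize (Hd' ((1 - th) * s)).
        assert (Ha : Rabs ((1 - th) * s - s) < d).
        { replace ((1 - th) * s - s) with (- (th * s)) by ring.
          rewrite Rabs_Ropp, Rabs_mult, Hs, (Rabs_pos_eq th) by lra; lra. }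
        assert (Hb : Rabs ((1 - th) * s) < T).
        { rewrite Rabs_mult, Hs, (Rabs_pos_eq (1 - th)) by lra; nra. }
        specialize (Hd' Ha); specialize (Hsm _ Hb); apply Rabs_def2 in Hd'.
        assert (0 < r ^ 2) by (apply pow_lt; lra).
        replace ((r / 2) ^ 2) with (r ^ 2 / 4) in Hsm by field; lra. }
    assert (Hext : forall s, Rabs s = T -> exists d, 0 < d /\ forall y, Rabs (y - s) < d -> N y < r ^ 2).
    { intros s Hs; specialize (Hend s Hs).
      destruct (proj1 (continuous_eps N s) (CN s) (r ^ 2 - N s)) as [d [Hd Hd']]; [lra|].
      exists d; split; [exact Hd|]; intros y Hy; specialize (Hd' y Hy); apply Rabs_def2 in Hd'; lra. }
    destruct (Hext T (Rabs_pos_eq T T0)) as [d1 [Hd1 Hd1']].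
    destruct (Hext (- T)) as [d2 [Hd2 Hd2']]; [rewrite Rabs_Ropp; apply Rabs_pos_eq, T0|].
    set (d := Rmin d1 d2 / 2).
    pose proof (Rmin_l d1 d2); pose proof (Rmin_r d1 d2).
    assert (Hd : 0 < d) by (unfold d; assert (0 < Rmin d1 d2) by (apply Rmin_glb_lt; lra); lra).
    assert (HE : E (T + d)).
    { split; [lra|]; intros s Hs.
      destruct (Rlt_or_le (Rabs s) T) as [Hlt|Hge]; [apply Hin, Hlt|].
      destruct (Rle_or_lt 0 s) as [Hp|Hn].
      - rewrite Rabs_pos_eq in * by lra; apply Hd1'; rewrite Rabs_pos_eq by lra; unfold d in *; lra.
      - rewrite Rabs_left in * by lra; apply Hd2'; unfold d in *; apply Rabs_def1; lra. }
    specialize (HT1 _ HE); lra.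
  - intros s; destruct (classic (N s < r ^ 2)) as [|Hn]; [assumption|exfalso].
    apply HB; exists (Rabs s); intros T [_ HT].
    apply Rnot_lt_le; intros Hlt; apply Hn, HT; lra.
Qed.

(** Were the origin stable, a clamped solution starting close to it at a point with [V > 0] would
    stay in the disc for ever and solve the true system. Its [V] then grows at least linearly,
    although [V] is at most [M r^2] on the disc. *)
Lemma unstable_of_det_neg f j t :
  smooth4 f -> dq (f j t) 0 0 = 0 -> dp (f j t) 0 0 = 0 ->
  dq (dq (f j t)) 0 0 * dp (dp (f j t)) 0 0 - dp (dq (f j t)) 0 0 ^ 2 < 0 ->
  ~ stable (f j t) origin.
Proof.
  intros Hf Hq0 Hp0 HD Hst.
  assert (Hcomm := dq_dp_comm f j t 0 0 Hf).
  set (al := dq (dq (f j t)) 0 0) in *; set (be := dp (dq (f j t)) 0 0) in *.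
  set (ga := dp (dp (f j t)) 0 0) in *; set (D := be ^ 2 - al * ga).
  assert (HDp : 0 < D) by (unfold D; lra).
  set (M := 2 * Rabs be + Rabs (ga - al)).
  assert (HM : 0 < M).
  { unfold M; pose proof (Rabs_pos be); pose proof (Rabs_pos (ga - al)).
    destruct (Req_dec be 0) as [E|E]; [|apply Rabs_pos_lt in E; lra].
    destruct (Req_dec (ga - al) 0) as [E'|E']; [|apply Rabs_pos_lt in E'; lra].
    exfalso; unfold D in HDp; rewrite E in HDp; replace ga with al in HDp by lra.
    pose proof (pow2_ge_0 al); lra. }
  set (e := D / (8 * M)).
  assert (He : 0 < e) by (apply Rdiv_lt_0_compat; lra).
  destruct (linear_approx (fun j t => dq (f j t)) j t e (smooth4_dq f Hf) Hq0 He) as [d1 [Hd1 L1]].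
  destruct (linear_approx (fun j t => dp (f j t)) j t e (smooth4_dp f Hf) Hp0 He) as [d2 [Hd2 L2]].
  fold al be in L1; fold ga in L2; rewrite Hcomm in L2.
  destruct (near_bound _ j t (smooth4_dq _ (smooth4_dq f Hf))) as [C1 [HC1 N1]].
  destruct (near_bound _ j t (smooth4_dp _ (smooth4_dq f Hf))) as [C2 [HC2 N2]].
  destruct (near_bound _ j t (smooth4_dq _ (smooth4_dp f Hf))) as [C3 [HC3 N3]].
  destruct (near_bound _ j t (smooth4_dp _ (smooth4_dp f Hf))) as [C4 [HC4 N4]].
  destruct (near_and _ _ _ (near_and _ _ _ N1 N2) (near_and _ _ _ N3 N4)) as [d3 [Hd3 HN]].
  set (L := C1 + C2 + C3 + C4).
  set (r := Rmin (Rmin d1 d2) d3 / 2).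
  assert (Hr0 : 0 < Rmin (Rmin d1 d2) d3) by (repeat apply Rmin_glb_lt; lra).
  assert (Hr : 0 < r) by (unfold r; lra).
  assert (Hr1 : r < d1 /\ r < d2 /\ r < d3).
  { pose proof (Rmin_l (Rmin d1 d2) d3); pose proof (Rmin_r (Rmin d1 d2) d3).
    pose proof (Rmin_l d1 d2); pose proof (Rmin_r d1 d2); unfold r; lra. }
  assert (Hjj : Rabs (j - j) < d3) by (apply Rabs_self_lt, Hd3).
  assert (LX : lipschitz2 (fun q p => dp (f j t) (clamp r q) (clamp r p)) L).
  { apply (clamped_lipschitz (fun j t => dp (f j t)));
      [apply smooth4_dp, Hf | exact Hr |]; intros q p Hq Hp.
    destruct (HN j q p Hjj ltac:(lra) ltac:(lra)) as [[A1 A2] [A3 A4]]; unfold L; split; lra. }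
  assert (LY : lipschitz2 (fun q p => - dq (f j t) (clamp r q) (clamp r p)) L).
  { apply lipschitz2_opp, (clamped_lipschitz (fun j t => dq (f j t)));
      [apply smooth4_dq, Hf | exact Hr |]; intros q p Hq Hp.
    destruct (HN j q p Hjj ltac:(lra) ltac:(lra)) as [[A1 A2] [A3 A4]]; unfold L; split; lra. }
  destruct (Hst (r / 2)) as [dl [Hdl Hst']]; [lra|].
  set (V := fun q p => be * q ^ 2 + (ga - al) * q * p - be * p ^ 2).
  (* [V] is a nonzero quadratic form of trace zero, hence indefinite: it is positive on an axis, or
     on a diagonal when [be = 0]. *)
  assert (Hdir : exists x y, Rabs x <= 1 /\ Rabs y <= 1 /\ 0 < V x y).
  { assert (R1 : Rabs 1 <= 1) by (rewrite Rabs_R1; lra).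
    assert (R0 : Rabs 0 <= 1) by (rewrite Rabs_R0; lra).
    assert (Rm : Rabs (-1) <= 1) by (apply Rabs_le; lra).
    unfold V; destruct (Rtotal_order be 0) as [Hb|[Hb|Hb]].
    - exists 0, 1; repeat split; try assumption; lra.
    - destruct (Rtotal_order (ga - al) 0) as [Hg|[Hg|Hg]].
      + exists 1, (-1); repeat split; try assumption; rewrite Hb; lra.
      + exfalso; unfold M in HM; rewrite Hb, Hg, Rabs_R0 in HM; lra.
      + exists 1, 1; repeat split; try assumption; rewrite Hb; lra.
    - exists 1, 0; repeat split; try assumption; lra. }
  destruct Hdir as [x [y [Hx [Hy HV]]]].
  set (lm := Rmin dl r / 2).
  pose proof (Rmin_l dl r); pose proof (Rmin_r dl r).
  assert (Hlm : 0 < lm) by (unfold lm; assert (0 < Rmin dl r) by (apply Rmin_glb_lt; lra); lra).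
  assert (Hstart : forall w, Rmin dl r <= w -> (lm * x) ^ 2 + (lm * y) ^ 2 < w ^ 2).
  { intros w Hw; assert (x ^ 2 <= 1 ^ 2) by (rewrite <- (pow2_abs x); apply pow_incr; pose proof (Rabs_pos x); lra).
    assert (y ^ 2 <= 1 ^ 2) by (rewrite <- (pow2_abs y); apply pow_incr; pose proof (Rabs_pos y); lra).
    assert (0 < lm ^ 2) by (apply pow_lt, Hlm).
    assert ((2 * lm) ^ 2 <= w ^ 2) by (apply pow_incr; unfold lm in *; lra).
    nra. }
  destruct (picard _ _ L (lm * x) (lm * y) ltac:(unfold L; lra) LX LY) as [u [v [U0 [V0 Huv]]]].
  assert (Cu : forall s, continuous u s)
    by (intros s; apply (ex_derive_continuous u); eexists; exact (proj1 (Huv s))).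
  assert (Cv : forall s, continuous v s)
    by (intros s; apply (ex_derive_continuous v); eexists; exact (proj2 (Huv s))).
  assert (Hbox : forall s, u s ^ 2 + v s ^ 2 < r ^ 2 -> Rabs (u s) < r /\ Rabs (v s) < r).
  { intros s Hs; split; [apply (abs_lt_of_sq _ (v s)) | apply (abs_lt_of_sq _ (u s))]; lra. }
  assert (Hin : forall s, u s ^ 2 + v s ^ 2 < r ^ 2).
  { apply (trapped_of_stable (f j t) u v r dl); try assumption.
    - intros T HT s Hs; destruct (Hbox s (HT s Hs)) as [Bu Bv]; destruct (Huv s) as [E1 E2].
      rewrite !clamp_id in E1, E2 by lra; simpl; split; assumption.
    - apply dist2_origin_lt; [exact Hdl|]; simpl fst; simpl snd; rewrite U0, V0; apply Hstart; lra.
    - rewrite U0, V0; apply Hstart; lra. }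
  set (W := fun s => V (u s) (v s)).
  set (dW := fun s => (2 * be * u s + (ga - al) * v s) * dp (f j t) (u s) (v s)
                      - ((ga - al) * u s - 2 * be * v s) * dq (f j t) (u s) (v s)).
  assert (HW : forall s, is_derive W s (dW s)).
  { intros s; destruct (Hbox s (Hin s)) as [Bu Bv]; destruct (Huv s) as [E1 E2].
    rewrite !clamp_id in E1, E2 by lra.
    unfold W, V; evar_last; [exact (is_derive_quadratic u v be (ga - al) s _ _ E1 E2)|].
    unfold dW; ring. }
  assert (HdW : forall s, D / 2 * (u s ^ 2 + v s ^ 2) <= dW s).
  { intros s; destruct (Hbox s (Hin s)) as [Bu Bv]; unfold dW.
    apply chetaev_derivative with e; try lra; try reflexivity.
    - right; unfold e; fold M; field; lra.
    - apply L2; lra.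
    - apply L1; lra. }
  assert (HVN : forall q p, V q p <= M * (q ^ 2 + p ^ 2)).
  { intros q p; unfold V, M.
    pose proof (Rle_abs be); pose proof (Rle_abs (ga - al)).
    pose proof (Rabs_pos be); pose proof (Rabs_pos (ga - al)).
    pose proof (pow2_ge_0 q); pose proof (pow2_ge_0 p).
    assert (- Rabs be <= be) by (pose proof (Rabs_le_between be (Rabs be)); lra).
    assert ((ga - al) * q * p <= Rabs (ga - al) * (q ^ 2 + p ^ 2)).
    { eapply Rle_trans; [apply Rle_abs|]; rewrite Rmult_assoc, Rabs_mult.
      apply Rmult_le_compat_l; [assumption|]; rewrite Rabs_mult.
      pose proof (pow2_ge_0 (Rabs q - Rabs p)); pose proof (pow2_abs q); pose proof (pow2_abs p); nra. }
    nra. }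
  assert (W0 : 0 < W 0).
  { unfold W; rewrite U0, V0; replace (V (lm * x) (lm * y)) with (lm ^ 2 * V x y) by (unfold V; ring).
    apply Rmult_lt_0_compat; [apply pow_lt, Hlm | exact HV]. }
  assert (HMVT : forall s, exists c, Rmin 0 s <= c <= Rmax 0 s /\ W s - W 0 = dW c * (s - 0)).
  { intros s; apply MVT_gen; intros z _; [apply HW|].
    apply continuity_pt_filterlim, (ex_derive_continuous W); eexists; apply HW. }
  assert (Wmon : forall s, 0 <= s -> W 0 <= W s).
  { intros s Hs; destruct (HMVT s) as [c [_ Hc]]; specialize (HdW c).
    pose proof (pow2_ge_0 (u c)); pose proof (pow2_ge_0 (v c)).
    assert (0 <= dW c) by nra; nra. }
  (* [W' >= D/2 (u^2 + v^2) >= D/(2 M) W >= D/(2 M) W 0], the last step because [W] is nondecreasing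
     for positive times. *)
  set (k := D / (2 * M) * W 0).
  assert (Hk : 0 < k) by (apply Rmult_lt_0_compat; [apply Rdiv_lt_0_compat; lra | exact W0]).
  assert (Wgrow : forall s, 0 <= s -> k * s <= W s).
  { intros s Hs; destruct (HMVT s) as [c [Hc1 Hc]]; rewrite Rmin_left in Hc1 by lra.
    assert (k <= dW c).
    { eapply Rle_trans; [|apply HdW]; specialize (Wmon c ltac:(lra)).
      specialize (HVN (u c) (v c)); fold (W c) in HVN; unfold k.
      replace (D / (2 * M) * W 0) with (D / 2 * (W 0 / M)) by (field; lra).
      apply Rmult_le_compat_l; [lra|]; apply Rmult_le_reg_l with M; [exact HM|].
      replace (M * (W 0 / M)) with (W 0) by (field; lra); lra. }
    rewrite Rminus_0_r in Hc; nra. }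
  (* The time at which the linear lower bound reaches the upper bound of [V] on the disc. *)
  set (s := M * r ^ 2 / k).
  assert (Hs : 0 <= s).
  { apply Rdiv_le_0_compat; [|exact Hk]; apply Rmult_le_pos; [lra | apply pow2_ge_0]. }
  specialize (Wgrow s Hs); replace (k * s) with (M * r ^ 2) in Wgrow by (unfold s; field; lra).
  specialize (HVN (u s) (v s)); fold (W s) in HVN; specialize (Hin s).
  assert (M * (u s ^ 2 + v s ^ 2) < M * r ^ 2) by (apply Rmult_lt_compat_l; lra).
  lra.
Qed.

(** * Change of coordinates *)

Definition hess_det (h : R -> R -> R) (q p : R) : R :=
  dq (dq h) q p * dp (dp h) q p - dp (dq h) q p ^ 2.

(** By symmetry of the second derivatives the linearisation has trace zero, so its characteristic
    equation is [lam^2 = - hess_det], here split into real and imaginary part. *)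
Lemma lin_eigenvalue_sq f j t q p (lam : C) :
  smooth4 f -> lin_eigenvalue (f j t) (q, p) lam ->
  fst lam ^ 2 - snd lam ^ 2 = - hess_det (f j t) q p /\ fst lam * snd lam = 0.
Proof.
  intros Hf; unfold lin_eigenvalue, lin11, lin12, lin21, lin22, hess_det; simpl fst; simpl snd.
  rewrite (dq_dp_comm f j t q p Hf); destruct lam as [x y].
  unfold Cminus, Cmult, Cplus, Copp, RtoC; simpl; intros H; injection H as H1 H2.
  split; nra.
Qed.

Lemma centre_of_det_pos f j t q p :
  smooth4 f -> dq (f j t) q p = 0 -> dp (f j t) q p = 0 -> 0 < hess_det (f j t) q p ->
  centre (f j t) (q, p).
Proof.
  intros Hf Hq Hp HD; split; [split; assumption|]; intros lam Hl.
  apply lin_eigenvalue_sq in Hl; [|exact Hf]; destruct lam as [x y]; simpl in *; destruct Hl as [H1 H2].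
  apply Rmult_integral in H2; destruct H2 as [H2|H2]; subst.
  - split; [|reflexivity]; intros E; injection E as E; subst; lra.
  - exfalso; pose proof (pow2_ge_0 x); simpl in *; lra.
Qed.

Lemma saddle_of_det_neg f j t q p :
  smooth4 f -> dq (f j t) q p = 0 -> dp (f j t) q p = 0 -> hess_det (f j t) q p < 0 ->
  saddle (f j t) (q, p).
Proof.
  intros Hf Hq Hp HD; split; [split; assumption|]; intros lam Hl.
  apply lin_eigenvalue_sq in Hl; [|exact Hf]; destruct lam as [x y]; simpl in *; destruct Hl as [H1 H2].
  intros ->; pose proof (pow2_ge_0 y); simpl in *; lra.
Qed.

Section CoordinateChange.

Variables (f A B : R -> R -> R -> R -> R).
Hypotheses (Hf : smooth4 f) (HA : smooth4 A) (HB : smooth4 B).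

Definition pullback (j t q p : R) : R := f j t (A j t q p) (B j t q p).
Definition jac (j t q p : R) : R :=
  dq (A j t) q p * dp (B j t) q p - dp (A j t) q p * dq (B j t) q p.

Lemma smooth4_pullback : smooth4 pullback.
Proof. exact (smooth4_comp f _ _ A B Hf smooth4_j smooth4_t HA HB). Qed.

Lemma smooth4_jac : smooth4 jac.
Proof.
  apply (smooth4_minus (fun j t q p => dq (A j t) q p * dp (B j t) q p)
    (fun j t q p => dp (A j t) q p * dq (B j t) q p));
  apply smooth4_mult; (apply smooth4_dq || apply smooth4_dp); assumption.
Qed.

Lemma dq_pullback j t :
  dq (pullback j t) = fun q p =>
    dq (f j t) (A j t q p) (B j t q p) * dq (A j t) q p
    + dp (f j t) (A j t q p) (B j t q p) * dq (B j t) q p.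
Proof. do 2 (apply functional_extensionality; intro); apply dq_comp; assumption. Qed.

Lemma dp_pullback j t :
  dp (pullback j t) = fun q p =>
    dq (f j t) (A j t q p) (B j t q p) * dp (A j t) q p
    + dp (f j t) (A j t q p) (B j t q p) * dp (B j t) q p.
Proof. do 2 (apply functional_extensionality; intro); apply dp_comp; assumption. Qed.

(** Cramer's rule for the transposed Jacobian matrix. *)
Lemma pullback_critical j t q p :
  jac j t q p <> 0 -> dq (pullback j t) q p = 0 -> dp (pullback j t) q p = 0 ->
  dq (f j t) (A j t q p) (B j t q p) = 0 /\ dp (f j t) (A j t q p) (B j t q p) = 0.
Proof.
  rewrite dq_pullback, dp_pullback; unfold jac; intros HJ H1 H2.
  set (X := dq (f j t) (A j t q p) (B j t q p)) in *.
  set (Y := dp (f j t) (A j t q p) (B j t q p)) in *.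
  set (a := dq (A j t) q p) in *; set (b := dq (B j t) q p) in *.
  set (c := dp (A j t) q p) in *; set (d := dp (B j t) q p) in *.
  split; apply Rmult_eq_reg_r with (a * d - c * b); try exact HJ; rewrite Rmult_0_l.
  - replace (X * (a * d - c * b)) with ((X * a + Y * b) * d - (X * c + Y * d) * b) by ring.
    rewrite H1, H2; ring.
  - replace (Y * (a * d - c * b)) with ((X * c + Y * d) * a - (X * a + Y * b) * c) by ring.
    rewrite H1, H2; ring.
Qed.

Lemma critical_pullback j t q p :
  dq (f j t) (A j t q p) (B j t q p) = 0 -> dp (f j t) (A j t q p) (B j t q p) = 0 ->
  dq (pullback j t) q p = 0 /\ dp (pullback j t) q p = 0.
Proof. rewrite dq_pullback, dp_pullback; intros H1 H2; rewrite H1, H2; split; ring. Qed.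

(** At a critical point of [f] every second derivative of [A] or [B] is multiplied by a vanishing
    first derivative of [f], so the Hessian transforms by congruence, as a quadratic form does. *)
Lemma hess_det_pullback j t q p :
  dq (f j t) (A j t q p) (B j t q p) = 0 -> dp (f j t) (A j t q p) (B j t q p) = 0 ->
  hess_det (pullback j t) q p
  = jac j t q p ^ 2 * hess_det (f j t) (A j t q p) (B j t q p).
Proof.
  intros H1 H2; unfold hess_det; rewrite dq_pullback, dp_pullback.
  assert (Sq := smooth4_dq f Hf); assert (Sp := smooth4_dp f Hf).
  assert (Cq : smooth4 (fun j t q p => dq (f j t) (A j t q p) (B j t q p))).
  { exact (smooth4_comp _ _ _ A B Sq smooth4_j smooth4_t HA HB). }
  assert (Cp : smooth4 (fun j t q p => dp (f j t) (A j t q p) (B j t q p))).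
  { exact (smooth4_comp _ _ _ A B Sp smooth4_j smooth4_t HA HB). }
  assert (Aq := smooth4_dq A HA); assert (Ap := smooth4_dp A HA).
  assert (Bq := smooth4_dq B HB); assert (Bp := smooth4_dp B HB).
  rewrite (dq_plus (fun j t q p => dq (f j t) (A j t q p) (B j t q p) * dq (A j t) q p)
    (fun j t q p => dp (f j t) (A j t q p) (B j t q p) * dq (B j t) q p)) by (apply smooth4_mult; assumption).
  rewrite (dp_plus (fun j t q p => dq (f j t) (A j t q p) (B j t q p) * dq (A j t) q p)
    (fun j t q p => dp (f j t) (A j t q p) (B j t q p) * dq (B j t) q p)) by (apply smooth4_mult; assumption).
  rewrite (dp_plus (fun j t q p => dq (f j t) (A j t q p) (B j t q p) * dp (A j t) q p)
    (fun j t q p => dp (f j t) (A j t q p) (B j t q p) * dp (B j t) q p)) by (apply smooth4_mult; assumption).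
  rewrite (dq_mult _ _ j t q p Cq Aq), (dq_mult _ _ j t q p Cp Bq).
  rewrite (dp_mult _ _ j t q p Cq Aq), (dp_mult _ _ j t q p Cp Bq).
  rewrite (dp_mult _ _ j t q p Cq Ap), (dp_mult _ _ j t q p Cp Bp).
  rewrite (dq_comp _ A B j t q p Sq HA HB), (dq_comp _ A B j t q p Sp HA HB).
  rewrite (dp_comp _ A B j t q p Sq HA HB), (dp_comp _ A B j t q p Sp HA HB).
  rewrite H1, H2, (dq_dp_comm f j t _ _ Hf); unfold jac; ring.
Qed.

End CoordinateChange.

(** * A local inverse uniform in the parameter *)

Lemma contraction2 (T1 T2 : R -> R -> R) (d : R) :
  0 < d ->
  (forall T, T = T1 \/ T = T2 -> Rabs (T 0 0) <= d / 2 /\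
     forall q p q' p', Rabs q <= d -> Rabs p <= d -> Rabs q' <= d -> Rabs p' <= d ->
       Rabs (T q p - T q' p') <= / 4 * (Rabs (q - q') + Rabs (p - p'))) ->
  exists q p, Rabs q <= d /\ Rabs p <= d /\ T1 q p = q /\ T2 q p = p.
Proof.
  intros Hd HT.
  assert (Z0 : Rabs 0 <= d) by (rewrite Rabs_R0; lra).
  assert (Hbox : forall T, T = T1 \/ T = T2 -> forall q p, Rabs q <= d -> Rabs p <= d -> Rabs (T q p) <= d).
  { intros T E q p Hq Hp; destruct (HT T E) as [H0 HL].
    specialize (HL q p 0 0 Hq Hp Z0 Z0); rewrite !Rminus_0_r in HL.
    replace (T q p) with ((T q p - T 0 0) + T 0 0) by ring.
    eapply Rle_trans; [apply Rabs_triang|]; lra. }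
  set (z := fix z n := match n with O => (0, 0) | S n => (T1 (fst (z n)) (snd (z n)), T2 (fst (z n)) (snd (z n))) end).
  assert (Hz : forall n, Rabs (fst (z n)) <= d /\ Rabs (snd (z n)) <= d).
  { induction n as [|n [IH1 IH2]]; [split; exact Z0|].
    split; [apply (Hbox T1) | apply (Hbox T2)]; auto. }
  (* Two components with factor 1/4 contract the sum of the increments by 1/2, the ratio in
     [geometric_limit]. *)
  assert (Hs : forall n, Rabs (fst (z (S n)) - fst (z n)) + Rabs (snd (z (S n)) - snd (z n)) <= d * (1 / 2) ^ n).
  { induction n as [|n IH].
    - simpl; rewrite !Rminus_0_r.
      pose proof (proj1 (HT T1 (or_introl eq_refl))); pose proof (proj1 (HT T2 (or_intror eq_refl))); lra.
    - destruct (Hz n), (Hz (S n)).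
      pose proof (proj2 (HT T1 (or_introl eq_refl)) (fst (z (S n))) (snd (z (S n))) (fst (z n)) (snd (z n))
        ltac:(assumption) ltac:(assumption) ltac:(assumption) ltac:(assumption)) as L1.
      pose proof (proj2 (HT T2 (or_intror eq_refl)) (fst (z (S n))) (snd (z (S n))) (fst (z n)) (snd (z n))
        ltac:(assumption) ltac:(assumption) ltac:(assumption) ltac:(assumption)) as L2.
      change (fst (z (S (S n)))) with (T1 (fst (z (S n))) (snd (z (S n)))).
      change (snd (z (S (S n)))) with (T2 (fst (z (S n))) (snd (z (S n)))).
      change (T1 (fst (z n)) (snd (z n))) with (fst (z (S n))) in *.
      change (T2 (fst (z n)) (snd (z n))) with (snd (z (S n))) in *.
      simpl pow; lra. }
  destruct (geometric_limit (fun n => fst (z n)) d) as [q Hq].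
  { intros n; specialize (Hs n); pose proof (Rabs_pos (snd (z (S n)) - snd (z n))); lra. }
  destruct (geometric_limit (fun n => snd (z n)) d) as [p Hp].
  { intros n; specialize (Hs n); pose proof (Rabs_pos (fst (z (S n)) - fst (z n))); lra. }
  assert (Bq : Rabs q <= d).
  { assert (Rabs q - d <= 0); [|lra]; apply le_geometric_zero with (2 * d); intros n.
    specialize (Hq n); destruct (Hz n); rewrite Rabs_minus_sym in Hq.
    pose proof (Rabs_triang_inv q (fst (z n))); lra. }
  assert (Bp : Rabs p <= d).
  { assert (Rabs p - d <= 0); [|lra]; apply le_geometric_zero with (2 * d); intros n.
    specialize (Hp n); destruct (Hz n); rewrite Rabs_minus_sym in Hp.
    pose proof (Rabs_triang_inv p (snd (z n))); lra. }
  assert (Hfix : forall T x (w : nat -> R), T = T1 \/ T = T2 ->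
    (forall n, w (S n) = T (fst (z n)) (snd (z n))) ->
    (forall n, Rabs (w n - x) <= 2 * d * (1 / 2) ^ n) -> T q p = x).
  { intros T x w E Hw Hx; destruct (HT T E) as [_ HL].
    assert (H0 : Rabs (T q p - x) <= 0).
    { apply le_geometric_zero with (2 * d); intros n.
      destruct (Hz n) as [Z1 Z2]; specialize (HL q p _ _ Bq Bp Z1 Z2); rewrite <- Hw in HL.
      specialize (Hq n); specialize (Hp n); rewrite Rabs_minus_sym in Hq, Hp.
      specialize (Hx (S n)); simpl in Hx.
      replace (T q p - x) with ((T q p - w (S n)) + (w (S n) - x)) by ring.
      eapply Rle_trans; [apply Rabs_triang|]; lra. }
    destruct (Req_dec (T q p - x) 0) as [|Hn]; [lra|].
    apply Rabs_pos_lt in Hn; lra. }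
  exists q, p; repeat split; try assumption.
  - apply (Hfix T1 q (fun n => fst (z n))); auto.
  - apply (Hfix T2 p (fun n => snd (z n))); auto.
Qed.

(* Newton's map with frozen derivative, x - DPhi(0)^{-1} (Phi(x) - y), is a contraction
   near the origin, uniformly in the parameter. *)
Lemma local_inverse A B j0 tau :
  smooth4 A -> smooth4 B -> jac A B j0 tau 0 0 <> 0 ->
  near j0 (fun j _ _ => A j tau 0 0 = 0 /\ B j tau 0 0 = 0) ->
  exists d0, 0 < d0 /\
  (forall j q p, Rabs (j - j0) < d0 -> Rabs q < d0 -> Rabs p < d0 ->
     A j tau q p = 0 -> B j tau q p = 0 -> q = 0 /\ p = 0) /\
  (forall d, 0 < d < d0 -> exists r, 0 < r /\ forall j y1 y2,
     Rabs (j - j0) < d0 -> Rabs y1 < r -> Rabs y2 < r ->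
     exists q p, Rabs q <= d /\ Rabs p <= d /\ A j tau q p = y1 /\ B j tau q p = y2).
Proof.
  intros HA HB HJ H0.
  set (Dl := jac A B j0 tau 0 0) in *.
  set (Aq := dq (A j0 tau) 0 0); set (Ap := dp (A j0 tau) 0 0).
  set (Bq := dq (B j0 tau) 0 0); set (Bp := dp (B j0 tau) 0 0).
  assert (EDl : Dl = Aq * Bp - Ap * Bq) by reflexivity.
  set (Psi := fun c1 c2 (x : R -> R -> R -> R -> R) j t q p =>
     x j t q p - (c1 * A j t q p + c2 * B j t q p)).
  assert (SPsi : forall c1 c2 x, smooth4 x -> smooth4 (Psi c1 c2 x)).
  { intros c1 c2 x Hx; apply (smooth4_minus x (fun j t q p => c1 * A j t q p + c2 * B j t q p) Hx).
    apply (smooth4_plus (fun j t q p => c1 * A j t q p) (fun j t q p => c2 * B j t q p));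
      (apply (smooth4_mult (fun _ _ _ _ => _)); [apply smooth4_const | assumption]). }
  assert (DqPsi : forall c1 c2 x, smooth4 x ->
    dq (Psi c1 c2 x j0 tau) 0 0 = dq (x j0 tau) 0 0 - (c1 * Aq + c2 * Bq)).
  { intros c1 c2 x Hx; apply is_derive_unique.
    apply (is_derive_minus (fun z => x j0 tau z 0)); [apply is_derive_dq, Hx|].
    apply (is_derive_plus (fun z => c1 * A j0 tau z 0)); apply is_derive_scal;
      apply is_derive_dq; assumption. }
  assert (DpPsi : forall c1 c2 x, smooth4 x ->
    dp (Psi c1 c2 x j0 tau) 0 0 = dp (x j0 tau) 0 0 - (c1 * Ap + c2 * Bp)).
  { intros c1 c2 x Hx; apply is_derive_unique.
    apply (is_derive_minus (fun z => x j0 tau 0 z)); [apply is_derive_dp, Hx|].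
    apply (is_derive_plus (fun z => c1 * A j0 tau 0 z)); apply is_derive_scal;
      apply is_derive_dp; assumption. }
  (* The coefficients are the rows of the inverse Jacobian matrix at the origin, so [P1] and [P2]
     have zero derivative there. *)
  set (P1 := Psi (Bp / Dl) (- Ap / Dl) (fun _ _ q _ => q)).
  set (P2 := Psi (- Bq / Dl) (Aq / Dl) (fun _ _ _ p => p)).
  assert (S1 : smooth4 P1) by apply SPsi, smooth4_q.
  assert (S2 : smooth4 P2) by apply SPsi, smooth4_p.
  assert (HF : Aq * Bp - Ap * Bq <> 0) by (rewrite <- EDl; exact HJ).
  assert (Z : forall P, P = P1 \/ P = P2 -> dq (P j0 tau) 0 0 = 0 /\ dp (P j0 tau) 0 0 = 0).
  { assert (I1 : forall x, dq (fun q _ : R => q) x 0 = 1) by (intros; apply Derive_id).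
    assert (I2 : forall x, dp (fun _ p : R => p) 0 x = 1) by (intros; apply Derive_id).
    assert (I3 : forall x, dp (fun q _ : R => q) 0 x = 0) by (intros; unfold dp; apply Derive_const).
    assert (I4 : forall x, dq (fun _ p : R => p) x 0 = 0) by (intros; unfold dq; apply Derive_const).
    intros P [->| ->]; unfold P1, P2; rewrite DqPsi, DpPsi by (apply smooth4_q || apply smooth4_p);
      rewrite ?I1, ?I2, ?I3, ?I4, EDl; split; field; exact HF. }
  assert (Hnear : forall P, P = P1 \/ P = P2 ->
    near j0 (fun j q p => Rabs (dq (P j tau) q p) <= / 4 /\ Rabs (dp (P j tau) q p) <= / 4)).
  { intros P E; assert (SP : smooth4 P) by (destruct E as [->| ->]; assumption).
    destruct (Z P E) as [Z1 Z2].
    pose proof (near_cont _ j0 tau (/ 4) (smooth4_dq P SP) ltac:(lra)) as N1.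
    pose proof (near_cont _ j0 tau (/ 4) (smooth4_dp P SP) ltac:(lra)) as N2.
    eapply near_imp; [|exact (near_and _ _ _ N1 N2)].
    intros j q p [E1 E2]; cbv beta in *; rewrite Z1, Rminus_0_r in E1; rewrite Z2, Rminus_0_r in E2; lra. }
  destruct (near_and _ _ _ H0 (near_and _ _ _ (Hnear P1 (or_introl eq_refl)) (Hnear P2 (or_intror eq_refl))))
    as [d0 [Hd0 HN]].
  assert (HL : forall P, P = P1 \/ P = P2 -> forall j d q p q' p', Rabs (j - j0) < d0 -> d < d0 ->
    Rabs q <= d -> Rabs p <= d -> Rabs q' <= d -> Rabs p' <= d ->
    Rabs (P j tau q p - P j tau q' p') <= / 4 * (Rabs (q - q') + Rabs (p - p'))).
  { intros P E j d q p q' p' Hj Hd Hq Hp Hq' Hp'.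
    apply (box_lipschitz P j tau (/ 4) d); try assumption.
    - destruct E as [->| ->]; assumption.
    - intros x y Hx Hy; destruct (HN j x y Hj ltac:(lra) ltac:(lra)) as [_ [K1 K2]].
      destruct E as [->| ->]; assumption. }
  assert (P0 : forall j P, P = P1 \/ P = P2 -> Rabs (j - j0) < d0 -> P j tau 0 0 = 0).
  { intros j P E Hj; destruct (HN j 0 0 Hj) as [[E1 E2] _]; rewrite ?Rabs_R0; try lra.
    destruct E as [->| ->]; unfold P1, P2, Psi; rewrite E1, E2; ring. }
  exists d0; split; [exact Hd0|]; split.
  - intros j q p Hj Hq Hp E1 E2.
    (* A common zero of [A] and [B] is a fixed point of [(P1, P2)], and so is the origin; the
       Lipschitz bound on the box of this size makes them coincide. *)
    set (d := Rmax (Rabs q) (Rabs p)).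
    assert (Hd : d < d0) by (unfold d, Rmax; destruct Rle_dec; lra).
    assert (Q1 : Rabs q <= d) by apply Rmax_l; assert (Q2 : Rabs p <= d) by apply Rmax_r.
    assert (Zd : Rabs 0 <= d) by (rewrite Rabs_R0; pose proof (Rabs_pos q); lra).
    pose proof (HL P1 (or_introl eq_refl) j d q p 0 0 Hj Hd Q1 Q2 Zd Zd) as K1.
    pose proof (HL P2 (or_intror eq_refl) j d q p 0 0 Hj Hd Q1 Q2 Zd Zd) as K2.
    rewrite (P0 j P1) in K1 by auto; rewrite (P0 j P2) in K2 by auto.
    unfold P1, Psi in K1; unfold P2, Psi in K2; rewrite E1, E2 in K1, K2.
    rewrite !Rmult_0_r, Rplus_0_r, !Rminus_0_r in K1, K2.
    pose proof (Rabs_pos q); pose proof (Rabs_pos p).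
    split; [destruct (Req_dec q 0) as [|Hn] | destruct (Req_dec p 0) as [|Hn]]; try assumption;
      apply Rabs_pos_lt in Hn; lra.
  - intros d Hd.
    (* [K] dominates the entries of the inverse matrix, so a target of size [d / (2 K)] shifts the
       map by at most [d / 2], as [contraction2] requires. *)
    set (K := Rabs (Bp / Dl) + Rabs (- Ap / Dl) + Rabs (- Bq / Dl) + Rabs (Aq / Dl) + 1).
    assert (HK : 1 <= K).
    { unfold K; pose proof (Rabs_pos (Bp / Dl)); pose proof (Rabs_pos (- Ap / Dl));
      pose proof (Rabs_pos (- Bq / Dl)); pose proof (Rabs_pos (Aq / Dl)); lra. }
    exists (d / (2 * K)); split; [apply Rdiv_lt_0_compat; lra|]; intros j y1 y2 Hj Hy1 Hy2.
    assert (HdK : K * (d / (2 * K)) = d / 2) by (field; lra).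
    set (r := d / (2 * K)) in *.
    destruct (contraction2 (fun q p => P1 j tau q p + (Bp / Dl * y1 + - Ap / Dl * y2))
      (fun q p => P2 j tau q p + (- Bq / Dl * y1 + Aq / Dl * y2)) d) as [q [p [Bq' [Bp' [E1 E2]]]]].
    + lra.
    + pose proof (Rabs_pos (Bp / Dl)); pose proof (Rabs_pos (- Ap / Dl));
      pose proof (Rabs_pos (- Bq / Dl)); pose proof (Rabs_pos (Aq / Dl)).
      pose proof (Rabs_pos y1); pose proof (Rabs_pos y2).
      intros T [->| ->]; split.
      * rewrite (P0 j P1) by auto; rewrite Rplus_0_l.
        eapply Rle_trans; [apply Rabs_triang|]; rewrite !Rabs_mult; rewrite <- HdK; unfold K; nra.
      * intros q p q' p' Hq Hp Hq' Hp'; eapply Rle_trans; [|apply (HL P1 (or_introl eq_refl) j d q p q' p'); tauto].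
        right; f_equal; ring.
      * rewrite (P0 j P2) by auto; rewrite Rplus_0_l.
        eapply Rle_trans; [apply Rabs_triang|]; rewrite !Rabs_mult; rewrite <- HdK; unfold K; nra.
      * intros q p q' p' Hq Hp Hq' Hp'; eapply Rle_trans; [|apply (HL P2 (or_intror eq_refl) j d q p q' p'); tauto].
        right; f_equal; ring.
    + unfold P1, P2, Psi in E1, E2.
      set (u := A j tau q p - y1); set (v := B j tau q p - y2).
      assert (F1 : Bp / Dl * u + - Ap / Dl * v = 0) by (unfold u, v; lra).
      assert (F2 : - Bq / Dl * u + Aq / Dl * v = 0) by (unfold u, v; lra).
      assert (Eu : u = 0).
      { replace u with (Aq * (Bp / Dl * u + - Ap / Dl * v) + Ap * (- Bq / Dl * u + Aq / Dl * v))
          by (rewrite EDl; field; exact HF).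
        rewrite F1, F2; ring. }
      assert (Ev : v = 0).
      { replace v with (Bq * (Bp / Dl * u + - Ap / Dl * v) + Bp * (- Bq / Dl * u + Aq / Dl * v))
          by (rewrite EDl; field; exact HF).
        rewrite F1, F2; ring. }
      exists q, p; unfold u in Eu; unfold v in Ev; repeat split; try assumption; lra.
Qed.

(** * Critical points of the normal form *)

Lemma pow_le_pow x m n : 0 <= x <= 1 -> (m <= n)%nat -> x ^ n <= x ^ m.
Proof.
  intros Hx H; replace n with (m + (n - m))%nat by lia; rewrite pow_add.
  assert (0 <= x ^ m) by (apply pow_le; lra).
  assert (x ^ (n - m) <= 1).
  { rewrite <- (pow1 (n - m)); apply pow_incr; lra. }
  nra.
Qed.

Section NormalForm.

Variables (g : R -> R -> R -> R -> R) (j0 tau a d C : R) (n1 : R -> R) (k : nat).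
Hypotheses (Hg : smooth4 g) (Ha : a <> 0) (Hd : d <> 0) (HC : 0 < C).
Hypothesis Hk : k = 2%nat \/ k = 4%nat.

(** One form for both values of [k]. The terms with [|n1|] absorb the drift of [nu2] away from its
    value at the crossing; the pure powers of [|q|] absorb the sextic part of the Hamiltonian when
    the quartic one leads; the powers of [|q| + |p|] are the Taylor remainders beyond the 6-jet. *)
Definition normal_form_at (j q p : R) : Prop :=
  Rabs (dp (g j tau) q p - a * p) <= C * (Rabs q + Rabs p) ^ 6 /\
  Rabs (dq (g j tau) q p - q * (n1 j + d * q ^ k))
    <= C * (Rabs (n1 j) * Rabs q ^ 3 + Rabs q ^ (k + 2) + (Rabs q + Rabs p) ^ 6) /\
  Rabs (dq (dq (g j tau)) q p - (n1 j + INR (k + 1) * d * q ^ k))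
    <= C * (Rabs (n1 j) * q ^ 2 + Rabs q ^ (k + 1) + (Rabs q + Rabs p) ^ 5) /\
  Rabs (dp (dq (g j tau)) q p) <= C * (Rabs q + Rabs p) ^ 5 /\
  Rabs (dp (dp (g j tau)) q p - a) <= C * (Rabs q + Rabs p) ^ 5.

Hypothesis HN : near j0 normal_form_at.

(** The generous 1000 covers every numerical factor met below, such as [2^6] and 65. *)
Definition small_radius (rho : R) : Prop :=
  0 < rho <= 1 /\ 1000 * C * rho <= 1 /\ 1000 * C * rho <= Rabs a /\ 1000 * C * rho <= Rabs d.

Lemma small_radius_exists r : 0 < r -> exists rho, small_radius rho /\ rho <= r.
Proof.
  intros Hr.
  assert (Pa := Rabs_pos_lt a Ha); assert (Pd := Rabs_pos_lt d Hd).
  set (m := Rmin 1 (Rmin (Rabs a) (Rabs d))).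
  assert (Hm : 0 < m) by (repeat apply Rmin_glb_lt; lra).
  assert (m <= 1) by apply Rmin_l.
  assert (m <= Rabs a) by (eapply Rle_trans; [apply Rmin_r | apply Rmin_l]).
  assert (m <= Rabs d) by (eapply Rle_trans; [apply Rmin_r | apply Rmin_r]).
  set (rho := Rmin (Rmin 1 r) (m / (1000 * C))).
  assert (rho <= m / (1000 * C)) by apply Rmin_r.
  assert (rho <= 1) by (eapply Rle_trans; [apply Rmin_l | apply Rmin_l]).
  assert (rho <= r) by (eapply Rle_trans; [apply Rmin_l | apply Rmin_r]).
  assert (0 < rho) by (repeat apply Rmin_glb_lt; try lra; apply Rdiv_lt_0_compat; lra).
  assert (1000 * C * rho <= m).
  { apply Rle_trans with (1000 * C * (m / (1000 * C))); [apply Rmult_le_compat_l; lra | right; field; lra]. }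
  exists rho; unfold small_radius; repeat split; lra.
Qed.

Lemma even_pow_abs q : q ^ k = Rabs q ^ k.
Proof.
  destruct Hk as [-> | ->]; rewrite RPow_abs, Rabs_pos_eq; try reflexivity.
  - apply pow2_ge_0.
  - replace (q ^ 4) with ((q ^ 2) ^ 2) by ring; apply pow2_ge_0.
Qed.

Lemma cone_pow_bound q p n :
  Rabs p <= Rabs q -> (Rabs q + Rabs p) ^ n <= 2 ^ n * Rabs q ^ n.
Proof.
  intros H; rewrite <- Rpow_mult_distr; apply pow_incr.
  pose proof (Rabs_pos q); pose proof (Rabs_pos p); lra.
Qed.

(** [dp = 0] gives [|a| |p| <= C (|q| + |p|)^6], which is at most [|a|/2 (|q| + |p|)] on the small
    box. Inside the cone, powers of [|q| + |p|] are controlled by powers of [|q|]. *)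
Lemma critical_cone rho j q p :
  small_radius rho -> normal_form_at j q p -> Rabs q <= rho -> Rabs p <= rho ->
  dp (g j tau) q p = 0 -> Rabs p <= Rabs q.
Proof.
  intros [Hr [Hr1 [Hra Hrd]]] [H1 _] Hq Hp E.
  rewrite E, Rminus_0_l, Rabs_Ropp, Rabs_mult in H1.
  pose proof (Rabs_pos q); pose proof (Rabs_pos p); pose proof (Rabs_pos_lt a Ha).
  set (x := Rabs q) in *; set (y := Rabs p) in *.
  assert (B : (x + y) ^ 5 <= 32 * rho).
  { apply Rle_trans with ((2 * rho) ^ 5); [apply pow_incr; lra|].
    assert (rho ^ 5 <= rho ^ 1) by (apply pow_le_pow; [lra | lia]); nra. }
  assert (C * (x + y) ^ 6 <= Rabs a / 2 * (x + y)).
  { replace (C * (x + y) ^ 6) with (C * (x + y) ^ 5 * (x + y)) by ring.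
    apply Rmult_le_compat_r; [lra|].
    assert (C * (x + y) ^ 5 <= C * (32 * rho)) by (apply Rmult_le_compat_l; lra). lra. }
  nra.
Qed.

(** In the cone the Taylor remainder is at most [64 |q|^6]; with the term [|q|^(k + 2)] this makes
    65. The factor [|q|] is kept in front so that it can be cancelled at a nonzero critical
    point. *)
Lemma reduced_equation rho j q p :
  small_radius rho -> normal_form_at j q p -> Rabs q <= rho -> Rabs p <= Rabs q ->
  Rabs (dq (g j tau) q p - q * (n1 j + d * Rabs q ^ k))
    <= Rabs q * (C * (Rabs (n1 j) * Rabs q ^ 2 + 65 * (Rabs q ^ k * Rabs q))).
Proof.
  intros [Hr _] [_ [H2 _]] Hq Hp; rewrite even_pow_abs in H2; eapply Rle_trans; [exact H2|].
  pose proof (cone_pow_bound q p 6 Hp); pose proof (Rabs_pos q).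
  set (x := Rabs q) in *.
  assert (x ^ 6 <= x ^ (k + 2)) by (apply pow_le_pow; [lra | lia]).
  replace (x * (C * (Rabs (n1 j) * x ^ 2 + 65 * (x ^ k * x))))
    with (C * (Rabs (n1 j) * x ^ 3 + 65 * (x ^ k * (x * x)))) by ring.
  replace (x ^ (k + 2)) with (x ^ k * (x * x)) in * by (rewrite pow_add; ring).
  apply Rmult_le_compat_l; lra.
Qed.

(** When [n1] and [d] have the same sign nothing cancels: [|n1 + d q^k| = |n1| + |d| |q|^k], while
    the error is at most [|n1| / 2 + |d| |q|^k]. So [q = 0], and the cone gives [p = 0]. *)
Lemma no_critical_point :
  exists rho, 0 < rho /\ forall j q p,
    Rabs (j - j0) < rho -> Rabs q < rho -> Rabs p < rho ->
    0 < n1 j * d -> dq (g j tau) q p = 0 -> dp (g j tau) q p = 0 -> q = 0 /\ p = 0.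
Proof.
  destruct HN as [dl [Hdl HN']].
  destruct (small_radius_exists dl Hdl) as [rho [Hrho Hrd]].
  assert (R0 := Hrho); destruct R0 as [Hr [Hr1 [Hra Hrdd]]].
  exists rho; split; [lra|]; intros j q p Hj Hq Hp Hs Eq Ep.
  assert (NF := HN' j q p ltac:(lra) ltac:(lra) ltac:(lra)).
  assert (Hc := critical_cone rho j q p Hrho NF ltac:(lra) ltac:(lra) Ep).
  assert (HE := reduced_equation rho j q p Hrho NF ltac:(lra) Hc).
  destruct (Req_dec q 0) as [->|Hn].
  { split; [reflexivity|]; rewrite Rabs_R0 in Hc; destruct (Req_dec p 0) as [|Hn]; [assumption|].
    apply Rabs_pos_lt in Hn; lra. }
  exfalso; apply Rabs_pos_lt in Hn; rewrite Eq, Rminus_0_l, Rabs_Ropp, Rabs_mult in HE.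
  set (x := Rabs q) in *.
  apply Rmult_le_reg_l in HE; [|exact Hn].
  assert (Hxk : 0 < x ^ k) by (apply pow_lt; exact Hn).
  assert (Hn1 : 0 < Rabs (n1 j)) by (apply Rabs_pos_lt; intros E; rewrite E in Hs; lra).
  assert (Hd1 := Rabs_pos_lt d Hd).
  assert (Es : Rabs (n1 j + d * x ^ k) = Rabs (n1 j) + Rabs d * x ^ k).
  { destruct (Rlt_or_le 0 d) as [Hd0|Hd0].
    - assert (0 < n1 j) by nra; rewrite !Rabs_pos_eq; try lra; nra.
    - assert (n1 j < 0) by nra; rewrite (Rabs_left (n1 j)), (Rabs_left d) by lra.
      rewrite Rabs_left; nra. }
  rewrite Es in HE.
  assert (C * x ^ 2 <= 1 / 2).
  { assert (x ^ 2 <= x ^ 1) by (apply pow_le_pow; [lra | lia]); nra. }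
  assert (C * x <= Rabs d / 1000) by nra.
  assert (C * (65 * (x ^ k * x)) <= Rabs d * x ^ k) by nra.
  nra.
Qed.

Hypothesis Hn1 : forall e, 0 < e -> exists dl, 0 < dl /\ forall j, Rabs (j - j0) < dl -> Rabs (n1 j) < e.

(** At such a point the reduced equation makes [n1] close to [- d q^k], so of [n1 + (k + 1) d q^k]
    there remains [k d q^k], up to half of [|d| q^k]. The second [p]-derivative is close to [a], and
    the square of the mixed one is small against [|a d| q^k]. *)
Lemma hess_det_sign rho j q p :
  small_radius rho -> normal_form_at j q p -> 0 < q <= rho -> Rabs p <= q ->
  dq (g j tau) q p = 0 -> 0 < a * d * hess_det (g j tau) q p.
Proof.
  intros Hrho NF Hq Hp Eq.
  assert (Aq : Rabs q = q) by (apply Rabs_pos_eq; lra).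
  assert (HE := reduced_equation rho j q p Hrho NF ltac:(lra) ltac:(lra)).
  destruct Hrho as [Hr [Hr1 [Hra Hrd]]].
  destruct NF as [_ [_ [H3 [H4 H5]]]].
  assert (B5 : (Rabs q + Rabs p) ^ 5 <= 32 * q ^ 5).
  { eapply Rle_trans; [apply cone_pow_bound; lra|]; rewrite Aq; lra. }
  rewrite even_pow_abs in H3; rewrite Aq in *.
  assert (Hd1 := Rabs_pos_lt d Hd); assert (Ha1 := Rabs_pos_lt a Ha).
  rewrite Eq, Rminus_0_l, Rabs_Ropp, Rabs_mult, Aq in HE.
  apply Rmult_le_reg_l in HE; [|lra].
  set (y := q ^ k) in *.
  assert (Hy : 0 < y) by (apply pow_lt; lra).
  assert (Hy1 : q ^ 4 <= y) by (apply pow_le_pow; [lra | lia]).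
  assert (Cq : 1000 * (C * q) <= 1000 * C * rho) by nra.
  assert (Cq2 : C * q ^ 2 <= C * q) by (apply Rmult_le_compat_l; [lra|]; simpl; nra).
  set (N := Rabs (n1 j)) in *.
  assert (HN0 : 0 <= N) by apply Rabs_pos.
  assert (T : N <= Rabs (n1 j + d * y) + Rabs d * y).
  { unfold N; replace (n1 j) with ((n1 j + d * y) + - (d * y)) at 1 by ring.
    eapply Rle_trans; [apply Rabs_triang|]; rewrite Rabs_Ropp, Rabs_mult, (Rabs_pos_eq y); lra. }
  assert (F1 : C * (N * q ^ 2) <= N / 2) by nra.
  assert (F2 : C * (65 * (y * q)) <= Rabs d * y / 10) by nra.
  assert (NB : N <= 4 * (Rabs d * y)) by lra.
  assert (F3 : C * (N * q ^ 2) <= Rabs d * y / 10).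
  { assert (C * (N * q ^ 2) <= C * q * N) by nra.
    assert (C * q * N <= 1 / 1000 * N) by (apply Rmult_le_compat_r; lra). nra. }
  assert (B5' : (Rabs q + Rabs p) ^ 5 <= 32 * (y * q)).
  { rewrite Aq; eapply Rle_trans; [exact B5|]; replace (q ^ 5) with (q ^ 4 * q) by ring; nra. }
  assert (Cyq : C * (y * q) <= Rabs d * y / 1000) by nra.
  assert (Q1 : Rabs (dq (dq (g j tau)) q p - INR k * d * y) <= Rabs d * y / 2).
  { replace (q ^ (k + 1)) with (y * q) in H3 by (unfold y; rewrite pow_add; ring).
    rewrite plus_INR in H3; simpl (INR 1) in H3.
    replace (dq (dq (g j tau)) q p - INR k * d * y)
      with ((dq (dq (g j tau)) q p - (n1 j + (INR k + 1) * d * y)) + (n1 j + d * y)) by ring.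
    eapply Rle_trans; [apply Rabs_triang|].
    assert (C * (N * q ^ 2 + y * q + (q + Rabs p) ^ 5) <= C * (N * q ^ 2) + 33 * (C * (y * q))).
    { rewrite Aq in B5'.
      assert (C * (q + Rabs p) ^ 5 <= C * (32 * (y * q))) by (apply Rmult_le_compat_l; lra). lra. }
    nra. }
  assert (HIk : 2 <= INR k) by (destruct Hk as [-> | ->]; simpl; lra).
  rewrite Aq in *.
  assert (Q2 : d * dq (dq (g j tau)) q p >= d ^ 2 * y).
  { set (G := dq (dq (g j tau)) q p) in *.
    assert (Z : Rabs (d * (G - INR k * d * y)) <= d ^ 2 * y / 2).
    { rewrite Rabs_mult; rewrite <- (pow2_abs d); nra. }
    apply Rabs_le_between in Z.
    assert (0 <= d ^ 2 * y) by (apply Rmult_le_pos; [apply pow2_ge_0 | lra]). nra. }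
  assert (S5 : 32 * (C * (y * q)) <= 32 * (C * q)).
  { assert (y <= 1) by (unfold y; replace 1 with (1 ^ k) by apply pow1; apply pow_incr; lra).
    apply Rmult_le_compat_l; [lra|]; apply Rmult_le_compat_l; [lra|].
    rewrite <- (Rmult_1_l q) at 2; apply Rmult_le_compat_r; lra. }
  assert (S6 : C * (q + Rabs p) ^ 5 <= 32 * (C * (y * q))).
  { replace (32 * (C * (y * q))) with (C * (32 * (y * q))) by ring.
    apply Rmult_le_compat_l; lra. }
  assert (Q3 : a * dp (dp (g j tau)) q p >= a ^ 2 / 2).
  { set (G := dp (dp (g j tau)) q p) in *.
    assert (Z : Rabs (a * (G - a)) <= a ^ 2 / 2).
    { rewrite Rabs_mult; rewrite <- (pow2_abs a).
      assert (C * (q + Rabs p) ^ 5 <= Rabs a / 2) by lra. nra. }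
    apply Rabs_le_between in Z; nra. }
  assert (Q4 : Rabs (a * d) * dp (dq (g j tau)) q p ^ 2 <= a ^ 2 * d ^ 2 * y / 4).
  { set (G := dp (dq (g j tau)) q p) in *.
    assert (Gb : Rabs G <= 32 * (C * (y * q))) by lra.
    rewrite <- (pow2_abs G), <- (pow2_abs a), <- (pow2_abs d), Rabs_mult.
    set (A := Rabs a) in *; set (D := Rabs d) in *; set (H := Rabs G) in *.
    assert (0 <= H) by apply Rabs_pos.
    (* Of the two factors in the square, one is compared with [a] and the other with [d y]. *)
    assert (G1 : H <= A / 2) by lra.
    assert (G2 : H <= D * y / 2) by lra.
    assert (H * H <= A / 2 * (D * y / 2)) by (apply Rmult_le_compat; lra).
    assert (0 < A * D) by (apply Rmult_lt_0_compat; lra). simpl; nra. }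
  unfold hess_det.
  set (X := dq (dq (g j tau)) q p) in *; set (Y := dp (dp (g j tau)) q p) in *.
  set (Z := dp (dq (g j tau)) q p) in *.
  assert (P : d * X * (a * Y) >= d ^ 2 * y * (a ^ 2 / 2)).
  { assert (0 <= d ^ 2 * y) by (apply Rmult_le_pos; [apply pow2_ge_0 | lra]).
    apply Rle_ge, Rmult_le_compat; try lra; pose proof (pow2_ge_0 a); lra. }
  assert (0 < d ^ 2) by (rewrite <- (pow2_abs d); apply pow_lt; lra).
  assert (0 < a ^ 2) by (rewrite <- (pow2_abs a); apply pow_lt; lra).
  assert (0 < a ^ 2 * d ^ 2 * y)
    by (apply Rmult_lt_0_compat; [apply Rmult_lt_0_compat|]; assumption).
  assert (a * d * Z ^ 2 <= Rabs (a * d) * Z ^ 2)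
    by (apply Rmult_le_compat_r; [apply pow2_ge_0 | apply Rle_abs]).
  lra.
Qed.

(** [a] times the [p]-derivative has opposite signs at [p = - q] and [p = q], so the intermediate
    value theorem provides [P q]. The mixed derivative is at most [|a| / 2] and the second
    [p]-derivative at least [|a| / 2], so any such choice is 1-Lipschitz, which gives the continuity
    usually drawn from the implicit function theorem. *)
Lemma critical_graph rho dl :
  small_radius rho -> 2 * rho <= dl ->
  forall j, (forall q p, Rabs q < dl -> Rabs p < dl -> normal_form_at j q p) ->
  exists P : R -> R,
    (forall q, 0 < q <= rho -> Rabs (P q) <= q /\ dp (g j tau) q (P q) = 0) /\
    (forall q q', 0 < q <= rho -> 0 < q' <= rho -> Rabs (P q - P q') <= Rabs (q - q')).
Proof.
  intros Hrho Hdl j NF; assert (R0 := Hrho); destruct R0 as [Hr [Hr1 [Hra Hrd]]].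
  assert (Ha1 := Rabs_pos_lt a Ha); assert (Hsp := smooth4_dp g Hg).
  (* The condition on [q] stands under the existential, with the default 0 elsewhere, so that choice
     yields a total function. *)
  assert (Hex : forall q, exists p, 0 < q <= rho -> Rabs p <= q /\ dp (g j tau) q p = 0).
  { intros q; destruct (Rlt_dec 0 q) as [Hq|Hq]; [|exists 0; intros; lra].
    destruct (Rle_dec q rho) as [Hq'|Hq']; [|exists 0; intros; lra].
    assert (Hend : forall p, Rabs p = q -> Rabs (a * dp (g j tau) q p - a ^ 2 * p) <= a ^ 2 * q / 2).
    { intros p Hp; destruct (NF q p) as [H1 _]; [rewrite Rabs_pos_eq; lra | lra|].
      replace (a * dp (g j tau) q p - a ^ 2 * p) with (a * (dp (g j tau) q p - a * p)) by ring.
      rewrite Rabs_mult; rewrite Hp, (Rabs_pos_eq q) in H1 by lra.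
      assert ((q + q) ^ 6 <= 64 * (q * q)).
      { replace ((q + q) ^ 6) with (64 * q ^ 6) by ring.
        assert (q ^ 6 <= q ^ 2) by (apply pow_le_pow; [lra | lia]); nra. }
      assert (C * (q + q) ^ 6 <= 64 * (C * rho) * q).
      { apply Rle_trans with (C * (64 * (q * q))); [apply Rmult_le_compat_l; lra|].
        assert (C * q <= C * rho) by (apply Rmult_le_compat_l; lra). nra. }
      rewrite <- (pow2_abs a).
      apply Rle_trans with (Rabs a * (64 * (C * rho) * q)); [apply Rmult_le_compat_l; lra|].
      assert (64 * (C * rho) <= Rabs a / 2) by lra.
      assert (64 * (C * rho) * q <= Rabs a / 2 * q) by (apply Rmult_le_compat_r; lra).
      simpl; nra. }
    assert (0 < a ^ 2) by (rewrite <- (pow2_abs a); apply pow_lt; lra).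
    assert (0 < a ^ 2 * q) by (apply Rmult_lt_0_compat; lra).
    pose proof (Hend q (Rabs_pos_eq q ltac:(lra))) as E1.
    pose proof (Hend (- q) ltac:(rewrite Rabs_Ropp; apply Rabs_pos_eq; lra)) as E2.
    apply Rabs_le_between in E1, E2.
    destruct (Ranalysis5.IVT_interv (fun p => a * dp (g j tau) q p) (- q) q) as [z [Hz Hz']]; try lra.
    - intros p _; apply continuity_pt_filterlim, (ex_derive_continuous (fun p => a * dp (g j tau) q p)).
      eexists; apply is_derive_scal, (is_derive_dp (fun j t => dp (g j t))), Hsp.
    - exists z; intros _; split; [apply Rabs_le; lra|].
      apply Rmult_integral in Hz'; destruct Hz'; [contradiction | assumption]. }
  set (P := fun q => proj1_sig (constructive_indefinite_description _ (Hex q))).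
  assert (HP : forall q, 0 < q <= rho -> Rabs (P q) <= q /\ dp (g j tau) q (P q) = 0).
  { intros q; apply (proj2_sig (constructive_indefinite_description _ (Hex q))). }
  assert (B5 : forall q p, Rabs q <= rho -> Rabs p <= rho -> C * (Rabs q + Rabs p) ^ 5 <= Rabs a / 2).
  { intros q p Hq Hp.
    assert ((Rabs q + Rabs p) ^ 5 <= 32 * rho).
    { apply Rle_trans with ((2 * rho) ^ 5);
        [apply pow_incr; pose proof (Rabs_pos q); pose proof (Rabs_pos p); lra|].
      assert (rho ^ 5 <= rho ^ 1) by (apply pow_le_pow; [lra | lia]); nra. }
    apply Rle_trans with (C * (32 * rho)); [apply Rmult_le_compat_l; lra | lra]. }
  exists P; split; [exact HP|]; intros q q' Hq Hq'.
  destruct (HP q Hq) as [P1 P2]; destruct (HP q' Hq') as [P3 P4].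
  assert (M1 : Rabs (dp (g j tau) q (P q') - dp (g j tau) q' (P q')) <= Rabs a / 2 * Rabs (q - q')).
  { apply (MVT_bound (fun x => dp (g j tau) x (P q')) (fun x => dq (dp (g j tau)) x (P q')));
      intros z Hz; [apply (is_derive_dq (fun j t => dp (g j t))), Hsp|].
    assert (Rabs z <= rho) by (apply (between_bound q' q); try exact Hz; rewrite Rabs_pos_eq; lra).
    rewrite (dq_dp_comm g j tau _ _ Hg); destruct (NF z (P q') ltac:(lra) ltac:(lra)) as [_ [_ [_ [H4 _]]]].
    eapply Rle_trans; [exact H4 | apply B5; lra]. }
  assert (M2 : exists c, Rabs c <= rho /\ dp (g j tau) q (P q') - dp (g j tau) q (P q)
                 = dp (dp (g j tau)) q c * (P q' - P q)).
  { destruct (MVT_gen (fun y => dp (g j tau) q y) (P q) (P q') (fun y => dp (dp (g j tau)) q y)) as [c [Hc E]].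
    - intros z _; apply (is_derive_dp (fun j t => dp (g j t))), Hsp.
    - intros z _; apply continuity_pt_filterlim, (ex_derive_continuous (fun y => dp (g j tau) q y)).
      eexists; apply (is_derive_dp (fun j t => dp (g j t))), Hsp.
    - exists c; split; [|exact E]; apply (between_bound (P q) (P q')); try exact Hc; lra. }
  destruct M2 as [c [Hc E]]; rewrite P2, Rminus_0_r in E; rewrite P4, Rminus_0_r in M1.
  rewrite E, Rabs_mult in M1.
  assert (Aq : Rabs q <= rho) by (rewrite Rabs_pos_eq; lra).
  destruct (NF q c ltac:(lra) ltac:(lra)) as [_ [_ [_ [_ H5]]]].
  specialize (B5 q c Aq Hc).
  assert (L : Rabs a / 2 <= Rabs (dp (dp (g j tau)) q c)).
  { pose proof (Rabs_triang_inv a (a - dp (dp (g j tau)) q c)) as T.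
    replace (a - (a - dp (dp (g j tau)) q c)) with (dp (dp (g j tau)) q c) in T by ring.
    rewrite Rabs_minus_sym in H5; lra. }
  rewrite (Rabs_minus_sym (P q)).
  apply Rmult_le_reg_l with (Rabs a / 2); [lra|].
  eapply Rle_trans; [|exact M1]; apply Rmult_le_compat_r; [apply Rabs_pos | exact L].
Qed.

(** Along the graph, [d] times the [q]-derivative is about [q (- |d| |n1| + d^2 q^k)]: negative at a
    small [q1] depending on [j], positive at a fixed [qb] once [n1] is small. A zero in between is
    the new critical point. *)
Lemma critical_point_exists eps :
  0 < eps -> exists dl, 0 < dl /\ forall j, Rabs (j - j0) < dl -> n1 j * d < 0 ->
    exists q p, Rabs q < eps /\ Rabs p < eps /\ q <> 0 /\
      dq (g j tau) q p = 0 /\ dp (g j tau) q p = 0 /\ 0 < a * d * hess_det (g j tau) q p.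
Proof.
  intros Heps; destruct HN as [dl [Hdl HN']].
  destruct (small_radius_exists (dl / 2) ltac:(lra)) as [rho [Hrho Hrd]].
  assert (R0 := Hrho); destruct R0 as [Hr [Hr1 [Hra Hrdd]]].
  assert (Hd1 := Rabs_pos_lt d Hd).
  set (qb := Rmin (rho / 2) (eps / 2)).
  assert (Hqb : 0 < qb) by (apply Rmin_glb_lt; lra).
  assert (qb <= rho / 2) by apply Rmin_l; assert (qb <= eps / 2) by apply Rmin_r.
  assert (Hqbk : 0 < qb ^ k) by (apply pow_lt; lra).
  (* Below this threshold [|n1|] with its error [C |n1|] takes at most a quarter of [|d| qb^k], and
     the remaining error another quarter, so the leading term decides the sign at [qb]. *)
  assert (He : 0 < Rabs d * qb ^ k / (4 * (1 + C))) by (apply Rdiv_lt_0_compat; nra).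
  destruct (Hn1 _ He) as [d1 [Hd1' Hn1']].
  pose proof (Rmin_l dl d1); pose proof (Rmin_r dl d1).
  exists (Rmin dl d1); split; [apply Rmin_glb_lt; lra|]; intros j Hj Hs.
  assert (Nj := Hn1' j ltac:(lra)).
  assert (NF : forall q p, Rabs q < dl -> Rabs p < dl -> normal_form_at j q p)
    by (intros; apply HN'; lra).
  destruct (critical_graph rho dl Hrho ltac:(lra) j NF) as [P [HP1 HP2]].
  set (N := Rabs (n1 j)) in *.
  assert (HN0 : 0 < N) by (apply Rabs_pos_lt; intros E; rewrite E in Hs; lra).
  assert (Enr : d * n1 j = - (Rabs d * N)).
  { unfold N; rewrite <- Rabs_mult, Rabs_left by lra; ring. }
  assert (Nb : (1 + C) * N <= Rabs d * qb ^ k / 4).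
  { apply Rle_trans with ((1 + C) * (Rabs d * qb ^ k / (4 * (1 + C))));
      [apply Rmult_le_compat_l; lra | right; field; lra]. }
  assert (HG : forall q, 0 < q <= rho ->
    Rabs (d * dq (g j tau) q (P q) - q * (- (Rabs d * N) + d ^ 2 * q ^ k))
      <= q * (Rabs d * (C * (N * q ^ 2 + 65 * (q ^ k * q))))).
  { intros q Hq; destruct (HP1 q Hq) as [A1 A2].
    assert (Aq : Rabs q = q) by (apply Rabs_pos_eq; lra).
    assert (HE := reduced_equation rho j q (P q) Hrho (NF q (P q) ltac:(lra) ltac:(lra)) ltac:(lra) ltac:(lra)).
    rewrite Aq in HE; fold N in HE.
    replace (d * dq (g j tau) q (P q) - q * (- (Rabs d * N) + d ^ 2 * q ^ k))
      with (d * (dq (g j tau) q (P q) - q * (n1 j + d * q ^ k))) by (rewrite <- Enr; ring).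
    rewrite Rabs_mult.
    replace (q * (Rabs d * (C * (N * q ^ 2 + 65 * (q ^ k * q)))))
      with (Rabs d * (q * (C * (N * q ^ 2 + 65 * (q ^ k * q))))) by ring.
    apply Rmult_le_compat_l; lra. }
  (* Since [q1^k <= q1], the leading term [|d| q1^k] is at most [N / 4] here and [n1] decides the
     sign. *)
  set (q1 := Rmin (qb / 2) (N / (4 * Rabs d))).
  assert (Hq1 : 0 < q1) by (apply Rmin_glb_lt; [lra | apply Rdiv_lt_0_compat; lra]).
  assert (Hq1b : q1 <= qb / 2) by apply Rmin_l.
  assert (Hq1N : Rabs d * q1 <= N / 4).
  { apply Rle_trans with (Rabs d * (N / (4 * Rabs d))); [apply Rmult_le_compat_l; [lra | apply Rmin_r] | right; field; lra]. }
  assert (Ed : d ^ 2 = Rabs d * Rabs d) by (rewrite <- (pow2_abs d); ring).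
  assert (Low : d * dq (g j tau) q1 (P q1) < 0).
  { specialize (HG q1 ltac:(lra)); apply Rabs_le_between in HG.
    assert (q1 ^ k <= q1 ^ 1) by (apply pow_le_pow; [lra | lia]).
    assert (Hyk : Rabs d * q1 ^ k <= N / 4) by nra.
    assert (0 < q1 ^ k) by (apply pow_lt; lra).
    assert (Cq : C * q1 <= C * rho) by (apply Rmult_le_compat_l; lra).
    assert (C * (N * q1 ^ 2) <= N / 4).
    { assert (C * q1 ^ 2 <= C * q1) by (apply Rmult_le_compat_l; [lra|]; simpl; nra). nra. }
    assert (C * (65 * (q1 ^ k * q1)) <= N / 4).
    { apply Rle_trans with (Rabs d * q1 ^ k); [|exact Hyk].
      replace (C * (65 * (q1 ^ k * q1))) with (65 * (C * q1) * q1 ^ k) by ring.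
      apply Rmult_le_compat_r; lra. }
    assert (- (Rabs d * N) + d ^ 2 * q1 ^ k + Rabs d * (C * (N * q1 ^ 2 + 65 * (q1 ^ k * q1))) < 0).
    { rewrite Ed.
      replace (- (Rabs d * N) + Rabs d * Rabs d * q1 ^ k + Rabs d * (C * (N * q1 ^ 2 + 65 * (q1 ^ k * q1))))
        with (- (Rabs d * (N - Rabs d * q1 ^ k - C * (N * q1 ^ 2) - C * (65 * (q1 ^ k * q1))))) by ring.
      assert (0 < Rabs d * (N - Rabs d * q1 ^ k - C * (N * q1 ^ 2) - C * (65 * (q1 ^ k * q1))))
        by (apply Rmult_lt_0_compat; lra). lra. }
    nra. }
  assert (High : 0 < d * dq (g j tau) qb (P qb)).
  { specialize (HG qb ltac:(lra)); apply Rabs_le_between in HG.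
    assert (Cq : C * qb <= C * rho) by (apply Rmult_le_compat_l; lra).
    assert (C * (N * qb ^ 2) <= C * N).
    { apply Rmult_le_compat_l; [lra|].
      assert (qb ^ 2 <= qb ^ 0) by (apply pow_le_pow; [lra | lia]); simpl (qb ^ 0) in *; nra. }
    assert (C * (65 * (qb ^ k * qb)) <= Rabs d * qb ^ k / 4).
    { replace (C * (65 * (qb ^ k * qb))) with (65 * (C * qb) * qb ^ k) by ring.
      replace (Rabs d * qb ^ k / 4) with (Rabs d / 4 * qb ^ k) by field.
      apply Rmult_le_compat_r; lra. }
    assert (0 < - (Rabs d * N) + d ^ 2 * qb ^ k - Rabs d * (C * (N * qb ^ 2 + 65 * (qb ^ k * qb)))).
    { rewrite Ed.
      replace (- (Rabs d * N) + Rabs d * Rabs d * qb ^ k - Rabs d * (C * (N * qb ^ 2 + 65 * (qb ^ k * qb))))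
        with (Rabs d * (Rabs d * qb ^ k - N - C * (N * qb ^ 2) - C * (65 * (qb ^ k * qb)))) by ring.
      assert (0 < Rabs d * qb ^ k) by (apply Rmult_lt_0_compat; lra).
      apply Rmult_lt_0_compat; lra. }
    nra. }
  destruct (Ranalysis5.IVT_interv (fun q => d * dq (g j tau) q (P q)) q1 qb) as [q [Hq Eq]]; try lra.
  { intros x Hx; apply continuity_pt_filterlim.
    apply (continuous_eps (fun q => d * dq (g j tau) q (P q))); intros e He'.
    destruct (smooth4_cont (fun j t => dq (g j t)) j tau x (P x) (e / Rabs d) (smooth4_dq g Hg)) as [d2 [Hd2 Hd2']].
    { apply Rdiv_lt_0_compat; lra. }
    set (d3 := Rmin d2 (Rmin q1 (rho / 2))).
    assert (d3 <= d2) by apply Rmin_l.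
    assert (d3 <= q1) by (eapply Rle_trans; [apply Rmin_r | apply Rmin_l]).
    assert (d3 <= rho / 2) by (eapply Rle_trans; [apply Rmin_r | apply Rmin_r]).
    exists d3; split; [apply Rmin_glb_lt; [lra | apply Rmin_glb_lt; lra]|]; intros y Hy.
    assert (Hy' := Rabs_def2 _ _ Hy).
    assert (HPy := HP2 y x ltac:(lra) ltac:(lra)).
    replace (d * dq (g j tau) y (P y) - d * dq (g j tau) x (P x))
      with (d * (dq (g j tau) y (P y) - dq (g j tau) x (P x))) by ring.
    rewrite Rabs_mult.
    apply Rlt_le_trans with (Rabs d * (e / Rabs d)); [|right; field; lra].
    apply Rmult_lt_compat_l; [lra|].
    apply Hd2'; try lra; apply Rabs_self_lt, Hd2. }
  apply Rmult_integral in Eq; destruct Eq as [Eq|Eq]; [contradiction|].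
  destruct (HP1 q ltac:(lra)) as [A1 A2].
  exists q, (P q); repeat split; try assumption; try lra.
  - rewrite Rabs_pos_eq; lra.
  - apply hess_det_sign with rho; try assumption; try lra.
    apply NF; [rewrite Rabs_pos_eq; lra | lra].
Qed.

End NormalForm.

(** * The zero set of nu1 *)

Section ZeroSet.

Variables (nu dnu : R -> R -> R) (e0 : R).
Hypothesis He0 : 0 < e0.
Hypothesis Hder : forall j t, Rabs j <= e0 -> Rabs t <= e0 -> is_derive (fun x => nu x t) j (dnu j t).
Hypothesis Hinc : forall j j' t, Rabs j <= e0 -> Rabs j' <= e0 -> Rabs t <= e0 ->
  j < j' -> dnu j t < dnu j' t.
Hypothesis Htime : forall j t t', Rabs j <= e0 -> Rabs t <= e0 -> Rabs t' <= e0 ->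
  t < t' -> nu j t < nu j t'.
Hypothesis Hcont : forall j e, Rabs j <= e0 -> 0 < e -> exists d, 0 < d /\
  forall t, Rabs t < d -> Rabs (nu j t - nu j 0) < e.
Hypothesis H00 : nu 0 0 = 0.
Hypothesis Hd00 : dnu 0 0 = 0.

Lemma zero_in_box : Rabs 0 <= e0.
Proof. rewrite Rabs_R0; lra. Qed.

Lemma MVT_box x y t : Rabs x <= e0 -> Rabs y <= e0 -> Rabs t <= e0 -> x <= y ->
  exists c, x <= c <= y /\ Rabs c <= e0 /\ nu y t - nu x t = dnu c t * (y - x).
Proof.
  intros Hx Hy Ht Hxy.
  assert (Hb : forall z, x <= z <= y -> Rabs z <= e0).
  { intros z Hz; apply Rabs_le_between in Hx, Hy; apply Rabs_le; lra. }
  destruct (MVT_gen (fun x => nu x t) x y (fun x => dnu x t)) as [c [Hc E]].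
  - rewrite Rmin_left, Rmax_right by lra; intros z Hz; apply Hder; [apply Hb; lra | exact Ht].
  - rewrite Rmin_left, Rmax_right by lra; intros z Hz.
    apply continuity_pt_filterlim, (ex_derive_continuous (fun x => nu x t)).
    eexists; apply Hder; [apply Hb; lra | exact Ht].
  - rewrite Rmin_left, Rmax_right in Hc by lra.
    exists c; repeat split; try lra; apply Hb; lra.
Qed.

Lemma dnu_mono c c' t : Rabs c <= e0 -> Rabs c' <= e0 -> Rabs t <= e0 -> c <= c' -> dnu c t <= dnu c' t.
Proof. intros Hc Hc' Ht [H| ->]; [left; apply Hinc; assumption | right; reflexivity]. Qed.

Lemma nu_convex x y z t : Rabs x <= e0 -> Rabs z <= e0 -> Rabs t <= e0 -> x <= y <= z ->
  (z - x) * nu y t <= (z - y) * nu x t + (y - x) * nu z t.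
Proof.
  intros Hx Hz Ht Hxyz.
  assert (Hy : Rabs y <= e0) by (apply Rabs_le_between in Hx, Hz; apply Rabs_le; lra).
  destruct (MVT_box x y t Hx Hy Ht ltac:(lra)) as [c1 [K1 [B1 E1]]].
  destruct (MVT_box y z t Hy Hz Ht ltac:(lra)) as [c2 [K2 [B2 E2]]].
  assert (M := dnu_mono c1 c2 t B1 B2 Ht ltac:(lra)).
  assert (0 <= (dnu c2 t - dnu c1 t) * ((y - x) * (z - y))) by (apply Rmult_le_pos; nra).
  replace (nu z t) with (nu y t + dnu c2 t * (z - y)) by lra.
  replace (nu x t) with (nu y t - dnu c1 t * (y - x)) by lra.
  nra.
Qed.

Lemma nu_above_tangent j x t : Rabs j <= e0 -> Rabs x <= e0 -> Rabs t <= e0 ->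
  dnu j t = 0 -> nu j t <= nu x t.
Proof.
  intros Hj Hx Ht E; destruct (Rle_or_lt j x) as [H|H].
  - destruct (MVT_box j x t Hj Hx Ht H) as [c [K [B E1]]].
    assert (M := dnu_mono j c t Hj B Ht ltac:(lra)); nra.
  - destruct (MVT_box x j t Hx Hj Ht ltac:(lra)) as [c [K [B E1]]].
    assert (M := dnu_mono c j t B Hj Ht ltac:(lra)); nra.
Qed.

Lemma nu_pos j t : Rabs j <= e0 -> Rabs t <= e0 -> 0 < t -> 0 < nu j t.
Proof.
  intros Hj Ht H.
  pose proof (nu_above_tangent 0 j 0 zero_in_box Hj zero_in_box Hd00).
  pose proof (Htime j 0 t Hj zero_in_box Ht H); lra.
Qed.

(** At a non-transversal zero convexity makes [nu] nonnegative for all [j] at that [t], which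
    [nu 0 t < 0] excludes for negative [t]; positive [t] has no zeros; at [t = 0] strict
    monotonicity of [dnu] leaves only [j = 0]. *)
Lemma zero_transversal j t : Rabs j <= e0 -> Rabs t <= e0 ->
  nu j t = 0 -> dnu j t = 0 -> j = 0 /\ t = 0.
Proof.
  intros Hj Ht E E'.
  assert (Et : t = 0).
  { destruct (Rtotal_order t 0) as [H|[H|H]]; [|exact H|].
    - pose proof (nu_above_tangent j 0 t Hj zero_in_box Ht E').
      pose proof (Htime 0 t 0 zero_in_box Ht zero_in_box H); lra.
    - pose proof (nu_pos j t Hj Ht H); lra. }
  subst t; split; [|reflexivity].
  destruct (Rtotal_order j 0) as [H|[H|H]]; [|exact H|].
  - pose proof (Hinc j 0 0 Hj zero_in_box zero_in_box H); lra.
  - pose proof (Hinc 0 j 0 zero_in_box Hj zero_in_box H); lra.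
Qed.

Lemma nu_pos_at_0 j : Rabs j <= e0 -> j <> 0 -> 0 < nu j 0.
Proof.
  intros Hj Hn; assert (H := nu_above_tangent 0 j 0 zero_in_box Hj zero_in_box Hd00).
  destruct (Req_dec (nu j 0) 0) as [E|E]; [exfalso|lra].
  (* by convexity [nu] would vanish between 0 and [j], hence [dnu] at a point away from 0 *)
  assert (Hh : Rabs (j / 2) <= e0).
  { unfold Rdiv; rewrite Rabs_mult, (Rabs_pos_eq (/ 2)) by lra; pose proof (Rabs_pos j); lra. }
  assert (Eh : nu (j / 2) 0 = 0).
  { pose proof (nu_above_tangent 0 (j / 2) 0 zero_in_box Hh zero_in_box Hd00).
    destruct (Rle_or_lt 0 j) as [Hp|Hp].
    - pose proof (nu_convex 0 (j / 2) j 0 zero_in_box Hj zero_in_box ltac:(lra)); nra.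
    - pose proof (nu_convex j (j / 2) 0 0 Hj zero_in_box zero_in_box ltac:(lra)); nra. }
  destruct (Rle_or_lt 0 j) as [Hp|Hp].
  - destruct (MVT_box (j / 2) j 0 Hh Hj zero_in_box ltac:(lra)) as [c [K [B E1]]].
    pose proof (Hinc 0 c 0 zero_in_box B zero_in_box ltac:(lra)); nra.
  - destruct (MVT_box j (j / 2) 0 Hj Hh zero_in_box ltac:(lra)) as [c [K [B E1]]].
    pose proof (Hinc c 0 0 B zero_in_box zero_in_box ltac:(lra)); nra.
Qed.

(** [nu] is negative at [j = 0] and, for small [t], still positive at [e] and [- e], which gives a
    zero on each side. By convexity [nu] is negative between 0 and any zero, so each side has only
    one. The zeros lie within [e] but are unique up to [e0]; this difference later yields their
    convergence to 0. *)
Lemma two_zeros e : 0 < e <= e0 -> exists eta, 0 < eta <= e0 /\ forall t, - eta < t < 0 ->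
  exists jm jp, jm <> jp /\ Rabs jm < e /\ Rabs jp < e /\
    forall j, Rabs j <= e0 -> (nu j t = 0 <-> j = jm \/ j = jp).
Proof.
  intros He.
  assert (Be : Rabs e <= e0) by (rewrite Rabs_pos_eq; lra).
  assert (Bm : Rabs (- e) <= e0) by (rewrite Rabs_Ropp; exact Be).
  assert (P1 := nu_pos_at_0 e Be ltac:(lra)); assert (P2 := nu_pos_at_0 (- e) Bm ltac:(lra)).
  destruct (Hcont e (nu e 0) Be P1) as [d1 [D1 C1]].
  destruct (Hcont (- e) (nu (- e) 0) Bm P2) as [d2 [D2 C2]].
  set (eta := Rmin e0 (Rmin d1 d2)).
  assert (eta <= e0) by apply Rmin_l.
  assert (eta <= d1) by (eapply Rle_trans; [apply Rmin_r | apply Rmin_l]).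
  assert (eta <= d2) by (eapply Rle_trans; [apply Rmin_r | apply Rmin_r]).
  exists eta; split; [split; [repeat apply Rmin_glb_lt; lra | assumption]|].
  intros t Ht.
  assert (Bt : Rabs t <= e0) by (apply Rabs_le; lra).
  assert (At : Rabs t < eta) by (apply Rabs_def1; lra).
  assert (V1 : 0 < nu e t) by (specialize (C1 t ltac:(lra)); apply Rabs_def2 in C1; lra).
  assert (V2 : 0 < nu (- e) t) by (specialize (C2 t ltac:(lra)); apply Rabs_def2 in C2; lra).
  assert (V0 : nu 0 t < 0).
  { pose proof (Htime 0 t 0 zero_in_box Bt zero_in_box ltac:(lra)); lra. }
  assert (Cts : forall x, Rabs x <= e0 -> continuity_pt (fun x => nu x t) x).
  { intros x Hx; apply continuity_pt_filterlim, (ex_derive_continuous (fun x => nu x t)).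
    eexists; apply Hder; assumption. }
  destruct (Ranalysis5.IVT_interv (fun x => nu x t) 0 e) as [jp [Kp Ep]]; try lra.
  { intros x Hx; apply Cts, Rabs_le; lra. }
  destruct (Ranalysis5.IVT_interv (fun x => - nu x t) (- e) 0) as [jm [Km Em]]; try lra.
  { intros x Hx; apply (continuity_pt_opp (fun x => nu x t)), Cts, Rabs_le; lra. }
  assert (jp <> 0) by (intros ->; lra).
  assert (jm <> 0) by (intros ->; lra).
  assert (jp <> e) by (intros ->; lra).
  assert (jm <> - e) by (intros ->; lra).
  assert (Upos : forall x y, 0 < x -> x < y -> Rabs y <= e0 -> nu y t = 0 -> nu x t < 0).
  { intros x y Hx Hxy Hy E.
    pose proof (nu_convex 0 x y t zero_in_box Hy Bt ltac:(lra)); nra. }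
  assert (Uneg : forall x y, x < 0 -> y < x -> Rabs y <= e0 -> nu y t = 0 -> nu x t < 0).
  { intros x y Hx Hxy Hy E.
    pose proof (nu_convex y x 0 t Hy zero_in_box Bt ltac:(lra)); nra. }
  assert (Bp : Rabs jp <= e0) by (apply Rabs_le; lra).
  assert (Bjm : Rabs jm <= e0) by (apply Rabs_le; lra).
  exists jm, jp; repeat split; try lra; try (apply Rabs_def1; lra).
  - intros E; destruct (Rtotal_order j 0) as [Hj|[Hj|Hj]].
    + left; destruct (Rtotal_order j jm) as [Hl|[Hl|Hl]]; [|exact Hl|].
      * pose proof (Uneg jm j ltac:(lra) Hl ltac:(assumption) E); lra.
      * pose proof (Uneg j jm Hj Hl Bjm ltac:(lra)); lra.
    + subst j; lra.
    + right; destruct (Rtotal_order j jp) as [Hl|[Hl|Hl]]; [|exact Hl|].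
      * pose proof (Upos j jp Hj Hl Bp Ep); lra.
      * pose proof (Upos jp j ltac:(lra) Hl ltac:(assumption) E); lra.
  - intros [->| ->]; lra.
Qed.

End ZeroSet.

(** The arguments of [nu] go into the slots of [q] and [p], so that [dq] and [dp] become its two
    partial derivatives. *)
Lemma smooth2_smooth4 nu : smooth2 nu -> smooth4 (fun _ _ => nu).
Proof. intros H; exact (smooth2_comp nu _ _ H smooth4_q smooth4_p). Qed.

Lemma sign_exists x : x <> 0 -> exists s, (s = 1 \/ s = -1) /\ 0 < s * x.
Proof.
  intros H; destruct (Rlt_or_le 0 x); [exists 1 | exists (-1)]; split; auto; lra.
Qed.

(** [s] is the product of the signs of the second [j]-derivative and the [t]-derivative at the
    origin: for [s t > 0] the parabola in [j] has moved off the axis. *)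
Lemma fold_zero_set nu :
  smooth2 nu -> nu 0 0 = 0 ->
  Derive (fun j => nu j 0) 0 = 0 ->
  Derive (fun j => Derive (fun j' => nu j' 0) j) 0 <> 0 ->
  Derive (fun t => nu 0 t) 0 <> 0 ->
  exists s e0, (s = 1 \/ s = -1) /\ 0 < e0 /\
    (forall j t, Rabs j <= e0 -> Rabs t <= e0 -> 0 < s * t -> nu j t <> 0) /\
    (forall j t, Rabs j <= e0 -> Rabs t <= e0 -> nu j t = 0 ->
       Derive (fun x => nu x t) j = 0 -> j = 0 /\ t = 0) /\
    (forall e, 0 < e <= e0 -> exists eta, 0 < eta <= e0 /\ forall t, 0 < - s * t < eta ->
       exists jm jp, jm <> jp /\ Rabs jm < e /\ Rabs jp < e /\
         forall j, Rabs j <= e0 -> (nu j t = 0 <-> j = jm \/ j = jp)).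
Proof.
  intros Hnu H00 Hj0 Hjj Ht0.
  assert (S := smooth2_smooth4 nu Hnu).
  assert (Sj := smooth4_dq _ S); assert (Sjj := smooth4_dq _ Sj); assert (St := smooth4_dp _ S).
  change (dq (dq nu) 0 0 <> 0) in Hjj; change (dp nu 0 0 <> 0) in Ht0.
  destruct (sign_exists _ Hjj) as [s1 [Hs1 P1]]; destruct (sign_exists _ Ht0) as [s2 [Hs2 P2]].
  destruct (smooth4_cont (fun _ _ => dq (dq nu)) 0 0 0 0 _ Sjj P1) as [d1 [D1 C1]].
  destruct (smooth4_cont (fun _ _ => dp nu) 0 0 0 0 _ St P2) as [d2 [D2 C2]].
  set (e0 := Rmin d1 d2 / 2).
  pose proof (Rmin_l d1 d2); pose proof (Rmin_r d1 d2).
  assert (He0 : 0 < e0) by (unfold e0; assert (0 < Rmin d1 d2) by (apply Rmin_glb_lt; lra); lra).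
  assert (Z0 : Rabs (0 - 0) = 0) by (rewrite Rminus_0_r; apply Rabs_R0).
  assert (B1 : forall j t, Rabs j <= e0 -> Rabs t <= e0 -> 0 < s1 * dq (dq nu) j t).
  { intros j t Hj Ht; specialize (C1 0 0 j t); rewrite Z0, !Rminus_0_r in C1; cbv beta in C1.
    specialize (C1 D1 D1 ltac:(unfold e0 in *; lra) ltac:(unfold e0 in *; lra)).
    apply Rabs_def2 in C1; destruct Hs1; subst s1; lra. }
  assert (B2 : forall j t, Rabs j <= e0 -> Rabs t <= e0 -> 0 < s2 * dp nu j t).
  { intros j t Hj Ht; specialize (C2 0 0 j t); rewrite Z0, !Rminus_0_r in C2; cbv beta in C2.
    specialize (C2 D2 D2 ltac:(unfold e0 in *; lra) ltac:(unfold e0 in *; lra)).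
    apply Rabs_def2 in C2; destruct Hs2; subst s2; lra. }
  set (s := s1 * s2).
  assert (Hs : s = 1 \/ s = -1) by (unfold s; destruct Hs1, Hs2; subst; lra).
  assert (Es : s1 * s = s2) by (unfold s; destruct Hs1; subst; ring).
  clearbody s.
  assert (Hs10 : s1 <> 0) by (destruct Hs1; subst; lra).
  assert (Ast : forall t, Rabs (s * t) = Rabs t).
  { intros t; rewrite Rabs_mult; destruct Hs as [E1|E1]; rewrite E1, ?Rabs_R1; [ring|].
    rewrite Rabs_left by lra; ring. }
  assert (Bw : forall x y z, Rabs x <= e0 -> Rabs y <= e0 -> Rmin x y <= z <= Rmax x y -> Rabs z <= e0)
    by (intros x y z Hx Hy; exact (between_bound x y z e0 Hx Hy)).
  (* reflecting value and time turns [nu] into a family that is convex in [j] and increasing in [t] *)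
  set (w := fun j t => s1 * nu j (s * t)); set (dw := fun j t => s1 * dq nu j (s * t)).
  assert (A1 : forall j t, Rabs j <= e0 -> Rabs t <= e0 -> is_derive (fun x => w x t) j (dw j t)).
  { intros j t _ _; unfold w, dw; apply is_derive_scal.
    exact (is_derive_dq (fun _ _ => nu) 0 0 j (s * t) S). }
  assert (A2 : forall j j' t, Rabs j <= e0 -> Rabs j' <= e0 -> Rabs t <= e0 -> j < j' -> dw j t < dw j' t).
  { intros j j' t Hj Hj' Ht Hlt; unfold dw.
    destruct (MVT_gen (fun x => dq nu x (s * t)) j j' (fun x => dq (dq nu) x (s * t))) as [c [Hc E]].
    - intros x _; exact (is_derive_dq (fun _ _ => dq nu) 0 0 x (s * t) Sj).
    - intros x _; apply continuity_pt_filterlim, (ex_derive_continuous (fun x => dq nu x (s * t))).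
      eexists; exact (is_derive_dq (fun _ _ => dq nu) 0 0 x (s * t) Sj).
    - pose proof (B1 c (s * t) (Bw _ _ _ Hj Hj' Hc) ltac:(rewrite Ast; assumption)) as P.
      assert (0 < s1 * dq (dq nu) c (s * t) * (j' - j)) by (apply Rmult_lt_0_compat; lra).
      rewrite Rmult_assoc, <- E in *; lra. }
  assert (A3 : forall j t t', Rabs j <= e0 -> Rabs t <= e0 -> Rabs t' <= e0 -> t < t' -> w j t < w j t').
  { intros j t t' Hj Ht Ht' Hlt; unfold w.
    destruct (MVT_gen (fun y => nu j y) (s * t) (s * t') (fun y => dp nu j y)) as [c [Hc E]].
    - intros x _; exact (is_derive_dp (fun _ _ => nu) 0 0 j x S).
    - intros x _; apply continuity_pt_filterlim, (ex_derive_continuous (fun y => nu j y)).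
      eexists; exact (is_derive_dp (fun _ _ => nu) 0 0 j x S).
    - assert (Bc : Rabs c <= e0) by (eapply Bw; [| |exact Hc]; rewrite Ast; assumption).
      pose proof (B2 j c Hj Bc) as P.
      assert (K : 0 < s2 * dp nu j c * (t' - t)) by (apply Rmult_lt_0_compat; lra).
      rewrite <- Es in K.
      replace (s1 * s * dp nu j c * (t' - t)) with (s1 * (dp nu j c * (s * t' - s * t))) in K by ring.
      rewrite <- E in K; lra. }
  assert (A4 : forall j e, Rabs j <= e0 -> 0 < e -> exists d, 0 < d /\
     forall t, Rabs t < d -> Rabs (w j t - w j 0) < e).
  { intros j e _ He; destruct (smooth4_cont (fun _ _ => nu) 0 0 j 0 e S He) as [d [Hd Cd]].
    exists d; split; [exact Hd|]; intros t Ht; unfold w; rewrite Rmult_0_r.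
    specialize (Cd 0 0 j (s * t)); cbv beta in Cd.
    replace (s1 * nu j (s * t) - s1 * nu j 0) with (s1 * (nu j (s * t) - nu j 0)) by ring.
    rewrite Rabs_mult; replace (Rabs s1) with 1
      by (destruct Hs1 as [E1|E1]; rewrite E1; [rewrite Rabs_R1 | rewrite Rabs_left]; lra).
    rewrite Rmult_1_l; apply Cd; rewrite ?Z0, ?Rminus_0_r, ?Ast; try assumption.
    apply Rabs_self_lt, Hd. }
  assert (W00 : w 0 0 = 0) by (unfold w; rewrite Rmult_0_r, H00; ring).
  assert (D00 : dw 0 0 = 0).
  { unfold dw; rewrite Rmult_0_r; unfold dq; rewrite Hj0; ring. }
  assert (Ess : forall t, s * (s * t) = t) by (intros t; destruct Hs as [E1|E1]; rewrite E1; ring).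
  assert (Wz : forall j t, w j (s * t) = 0 <-> nu j t = 0).
  { intros j t; unfold w; rewrite Ess; split; intros E; [|rewrite E; ring].
    apply Rmult_integral in E; destruct E; [contradiction | assumption]. }
  exists s, e0; split; [exact Hs|]; split; [exact He0|]; split; [|split].
  - intros j t Hj Ht Hst E; apply Wz in E.
    pose proof (nu_pos w dw e0 He0 A1 A2 A3 W00 D00 j (s * t) Hj ltac:(rewrite Ast; assumption) Hst); lra.
  - intros j t Hj Ht E E'; apply Wz in E.
    destruct (zero_transversal w dw e0 He0 A1 A2 A3 W00 D00 j (s * t) Hj ltac:(rewrite Ast; assumption) E)
      as [K1 K2].
    + unfold dw, dq; rewrite Ess, E'; ring.
    + split; [exact K1|]; rewrite <- (Ess t), K2; ring.
  - intros e He; destruct (two_zeros w dw e0 He0 A1 A2 A3 A4 W00 D00 e He) as [eta [Heta K]].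
    exists eta; split; [exact Heta|]; intros t Ht.
    destruct (K (s * t)) as [jm [jp [K1 [K2 [K3 K4]]]]]; [lra|].
    exists jm, jp; repeat split; try assumption.
    + intros E; apply (K4 j); [assumption | apply Wz, E].
    + intros E; apply Wz, (K4 j); assumption.
Qed.

(** * The flip bifurcations *)

Lemma neg_of_mul_neg x y : x * y < 0 -> 0 < x -> y < 0.
Proof. intros; nra. Qed.

Lemma pos_of_mul_neg x y : x * y < 0 -> x < 0 -> 0 < y.
Proof. intros; nra. Qed.

Section Flip.

Variables (a b : R) (nu1 nu2 : R -> R -> R) (f A B : R -> R -> R -> R -> R) (rho : R).
Hypotheses (ha : a <> 0) (hb : b <> 0) (hnu1 : smooth2 nu1) (hnu2 : smooth2 nu2).
Hypotheses (hf : smooth4 f) (hA : smooth4 A) (hB : smooth4 B).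
Hypothesis hcoord : forall j t, Rabs j < rho -> Rabs t < rho ->
  A j t 0 0 = 0 /\ B j t 0 0 = 0 /\ jac A B j t 0 0 <> 0 /\
  same_6jet (pullback f A B j t) (Hnf a b nu1 nu2 j t).

Lemma smooth4_Hnf : smooth4 (Hnf a b nu1 nu2).
Proof.
  assert (S1 := smooth2_comp nu1 _ _ hnu1 smooth4_j smooth4_t).
  assert (S2 := smooth2_comp nu2 _ _ hnu2 smooth4_j smooth4_t).
  apply (smooth4_plus (fun j t q p => a / 2 * p ^ 2 + b / 6 * q ^ 6 + nu1 j t / 2 * q ^ 2)
    (fun j t q p => nu2 j t / 4 * q ^ 4)).
  - apply (smooth4_plus (fun j t q p => a / 2 * p ^ 2 + b / 6 * q ^ 6)
      (fun j t q p => nu1 j t / 2 * q ^ 2)).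
    + apply (smooth4_plus (fun j t q p => a / 2 * p ^ 2) (fun j t q p => b / 6 * q ^ 6)).
      * apply (smooth4_mult (fun _ _ _ _ => a / 2) (fun _ _ _ p => p ^ 2));
          [apply smooth4_const | exact (smooth4_pow _ 2 smooth4_p)].
      * apply (smooth4_mult (fun _ _ _ _ => b / 6) (fun _ _ q _ => q ^ 6));
          [apply smooth4_const | exact (smooth4_pow _ 6 smooth4_q)].
    + apply (smooth4_mult (fun j t _ _ => nu1 j t / 2) (fun _ _ q _ => q ^ 2));
        [exact (smooth4_mult _ _ S1 (smooth4_const (/ 2))) | exact (smooth4_pow _ 2 smooth4_q)].
  - apply (smooth4_mult (fun j t _ _ => nu2 j t / 4) (fun _ _ q _ => q ^ 4));
      [exact (smooth4_mult _ _ S2 (smooth4_const (/ 4))) | exact (smooth4_pow _ 4 smooth4_q)].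
Qed.

Lemma dq_Hnf j t :
  dq (Hnf a b nu1 nu2 j t) = fun q p => b * q ^ 5 + nu1 j t * q + nu2 j t * q ^ 3.
Proof.
  do 2 (apply functional_extensionality; intro); apply is_derive_unique; unfold Hnf.
  auto_derive; [exact I | field].
Qed.

Lemma dp_Hnf j t : dp (Hnf a b nu1 nu2 j t) = fun q p => a * p.
Proof.
  do 2 (apply functional_extensionality; intro); apply is_derive_unique; unfold Hnf.
  auto_derive; [exact I | field].
Qed.

Lemma dqq_Hnf j t :
  dq (dq (Hnf a b nu1 nu2 j t)) = fun q p => 5 * b * q ^ 4 + nu1 j t + 3 * nu2 j t * q ^ 2.
Proof.
  rewrite dq_Hnf; do 2 (apply functional_extensionality; intro); apply is_derive_unique.
  auto_derive; [exact I | ring].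
Qed.

Lemma dpq_Hnf j t : dp (dq (Hnf a b nu1 nu2 j t)) = fun q p => 0.
Proof.
  rewrite dq_Hnf; do 2 (apply functional_extensionality; intro); apply is_derive_unique.
  auto_derive; [exact I | ring].
Qed.

Lemma dpp_Hnf j t : dp (dp (Hnf a b nu1 nu2 j t)) = fun q p => a.
Proof.
  rewrite dp_Hnf; do 2 (apply functional_extensionality; intro); apply is_derive_unique.
  auto_derive; [exact I | ring].
Qed.

Lemma origin_hessian j t : Rabs j < rho -> Rabs t < rho ->
  dq (f j t) 0 0 = 0 /\ dp (f j t) 0 0 = 0 /\
  exists c, 0 < c /\ c * hess_det (f j t) 0 0 = a * nu1 j t.
Proof.
  intros Hj Ht; destruct (hcoord j t Hj Ht) as [E1 [E2 [HJ H6]]].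
  assert (SG := smooth4_pullback f A B hf hA hB).
  assert (Gq : dq (pullback f A B j t) 0 0 = 0).
  { etransitivity; [exact (H6 1%nat 0%nat ltac:(lia))|].
    change (dq (Hnf a b nu1 nu2 j t) 0 0 = 0); rewrite dq_Hnf; ring. }
  assert (Gp : dp (pullback f A B j t) 0 0 = 0).
  { etransitivity; [exact (H6 0%nat 1%nat ltac:(lia))|].
    change (dp (Hnf a b nu1 nu2 j t) 0 0 = 0); rewrite dp_Hnf; ring. }
  assert (Gqq : dq (dq (pullback f A B j t)) 0 0 = nu1 j t).
  { etransitivity; [exact (H6 2%nat 0%nat ltac:(lia))|].
    change (dq (dq (Hnf a b nu1 nu2 j t)) 0 0 = nu1 j t); rewrite dqq_Hnf; ring. }
  assert (Gpp : dp (dp (pullback f A B j t)) 0 0 = a).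
  { etransitivity; [exact (H6 0%nat 2%nat ltac:(lia))|].
    change (dp (dp (Hnf a b nu1 nu2 j t)) 0 0 = a); rewrite dpp_Hnf; ring. }
  assert (Gpq : dp (dq (pullback f A B j t)) 0 0 = 0).
  { rewrite <- (dq_dp_comm _ j t 0 0 SG).
    etransitivity; [exact (H6 1%nat 1%nat ltac:(lia))|].
    change (dq (dp (Hnf a b nu1 nu2 j t)) 0 0 = 0).
    rewrite (dq_dp_comm _ j t 0 0 smooth4_Hnf), dpq_Hnf; reflexivity. }
  destruct (pullback_critical f A B hf hA hB j t 0 0 HJ Gq Gp) as [Fq Fp].
  assert (HD := hess_det_pullback f A B hf hA hB j t 0 0 Fq Fp).
  unfold hess_det at 1 in HD; rewrite Gqq, Gpp, Gpq in HD.
  rewrite E1, E2 in *; split; [exact Fq|]; split; [exact Fp|].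
  exists (jac A B j t 0 0 ^ 2); split.
  - rewrite <- pow2_abs; apply pow_lt, Rabs_pos_lt, HJ.
  - rewrite <- HD; ring.
Qed.

Lemma origin_stable j t : Rabs j < rho -> Rabs t < rho -> 0 < a * nu1 j t -> stable (f j t) origin.
Proof.
  intros Hj Ht H; destruct (origin_hessian j t Hj Ht) as [Fq [Fp [c [Hc E]]]].
  apply stable_of_det_pos; try assumption; fold (hess_det (f j t) 0 0); nra.
Qed.

Lemma origin_unstable j t : Rabs j < rho -> Rabs t < rho -> a * nu1 j t < 0 -> ~ stable (f j t) origin.
Proof.
  intros Hj Ht H; destruct (origin_hessian j t Hj Ht) as [Fq [Fp [c [Hc E]]]].
  apply unstable_of_det_neg; try assumption; fold (hess_det (f j t) 0 0); nra.
Qed.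

(** * Reduction to the normal form at a transversal zero of nu1 *)

Lemma near_param (j0 d : R) (P : R -> Prop) :
  0 < d -> (forall j, Rabs (j - j0) < d -> P j) -> near j0 (fun j _ _ => P j).
Proof. intros Hd H; exists d; split; [exact Hd|]; intros; apply H; assumption. Qed.

(** A derivative of order [i] of the difference has a vanishing jet of order [6 - i], so
    [flat_bound] gives the power [7 - i]. In [Flat] the numbers [k] and [l] count the derivatives
    taken in [q] and in [p]. *)
Lemma remainder_bounds j0 tau : Rabs j0 < rho -> Rabs tau < rho ->
  exists C, 0 < C /\ near j0 (fun j q p =>
    Rabs (dq (pullback f A B j tau) q p - dq (Hnf a b nu1 nu2 j tau) q p)
      <= C * (Rabs q + Rabs p) ^ 6 /\
    Rabs (dp (pullback f A B j tau) q p - dp (Hnf a b nu1 nu2 j tau) q p)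
      <= C * (Rabs q + Rabs p) ^ 6 /\
    Rabs (dq (dq (pullback f A B j tau)) q p - dq (dq (Hnf a b nu1 nu2 j tau)) q p)
      <= C * (Rabs q + Rabs p) ^ 5 /\
    Rabs (dp (dq (pullback f A B j tau)) q p - dp (dq (Hnf a b nu1 nu2 j tau)) q p)
      <= C * (Rabs q + Rabs p) ^ 5 /\
    Rabs (dp (dp (pullback f A B j tau)) q p - dp (dp (Hnf a b nu1 nu2 j tau)) q p)
      <= C * (Rabs q + Rabs p) ^ 5).
Proof.
  intros Hj0 Ht.
  assert (SG := smooth4_pullback f A B hf hA hB); assert (SH := smooth4_Hnf).
  set (G := pullback f A B) in *; set (H := Hnf a b nu1 nu2) in *.
  assert (Flat : forall (K L : R -> R -> R -> R -> R) k l (N : nat), smooth4 K -> smooth4 L ->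
    (forall m n j, Dqn m (Dpn n (K j tau)) = Dqn (m + k) (Dpn (n + l) (G j tau))) ->
    (forall m n j, Dqn m (Dpn n (L j tau)) = Dqn (m + k) (Dpn (n + l) (H j tau))) ->
    (N + k + l <= 6)%nat ->
    exists C, 0 < C /\ near j0 (fun j q p =>
      Rabs (K j tau q p - L j tau q p) <= C * (Rabs q + Rabs p) ^ S N)).
  { intros K L k l N SK SL EK EL HN.
    apply (flat_bound N (fun j t q p => K j t q p - L j t q p)).
    - apply smooth4_minus; assumption.
    - apply (near_param j0 (rho - Rabs j0)); [lra|]; intros j Hj m n Hmn.
      assert (Hj' : Rabs j < rho).
      { pose proof (Rabs_triang_inv j j0); lra. }
      destruct (hcoord j tau Hj' Ht) as [_ [_ [_ H6]]].
      rewrite (Dpn_minus n K L j tau SK SL).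
      rewrite (Dqn_minus m (fun j t => Dpn n (K j t)) (fun j t => Dpn n (L j t)) j tau
        (smooth4_Dpn n K SK) (smooth4_Dpn n L SL)).
      rewrite EK, EL, (H6 (m + k)%nat (n + l)%nat) by lia; ring. }
  assert (Eq : forall (K : R -> R -> R -> R -> R), smooth4 K -> forall m n j,
    Dqn m (Dpn n (dq (K j tau))) = Dqn (m + 1) (Dpn (n + 0) (K j tau))).
  { intros K SK m n j; rewrite (Dpn_dq n K j tau SK), Dqn_shift.
    rewrite Nat.add_0_r, Nat.add_1_r; reflexivity. }
  assert (Ep : forall (K : R -> R -> R -> R -> R), smooth4 K -> forall m n j,
    Dqn m (Dpn n (dp (K j tau))) = Dqn (m + 0) (Dpn (n + 1) (K j tau))).
  { intros K SK m n j; rewrite Dpn_shift, Nat.add_0_r, Nat.add_1_r; reflexivity. }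
  assert (Eqq : forall (K : R -> R -> R -> R -> R), smooth4 K -> forall m n j,
    Dqn m (Dpn n (dq (dq (K j tau)))) = Dqn (m + 2) (Dpn (n + 0) (K j tau))).
  { intros K SK m n j; rewrite (Eq (fun j t => dq (K j t)) (smooth4_dq K SK)), (Eq K SK).
    f_equal; [lia | f_equal; lia]. }
  assert (Epq : forall (K : R -> R -> R -> R -> R), smooth4 K -> forall m n j,
    Dqn m (Dpn n (dp (dq (K j tau)))) = Dqn (m + 1) (Dpn (n + 1) (K j tau))).
  { intros K SK m n j; rewrite (Ep (fun j t => dq (K j t)) (smooth4_dq K SK)), (Eq K SK).
    f_equal; [lia | f_equal; lia]. }
  assert (Epp : forall (K : R -> R -> R -> R -> R), smooth4 K -> forall m n j,
    Dqn m (Dpn n (dp (dp (K j tau)))) = Dqn (m + 0) (Dpn (n + 2) (K j tau))).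
  { intros K SK m n j; rewrite (Ep (fun j t => dp (K j t)) (smooth4_dp K SK)), (Ep K SK).
    f_equal; [lia | f_equal; lia]. }
  assert (Gq := smooth4_dq G SG); assert (Gp := smooth4_dp G SG).
  assert (Hq := smooth4_dq H SH); assert (Hp := smooth4_dp H SH).
  destruct (Flat (fun j t => dq (G j t)) (fun j t => dq (H j t)) 1%nat 0%nat 5%nat Gq Hq
    (Eq G SG) (Eq H SH) ltac:(lia)) as [C1 [HC1 N1]].
  destruct (Flat (fun j t => dp (G j t)) (fun j t => dp (H j t)) 0%nat 1%nat 5%nat Gp Hp
    (Ep G SG) (Ep H SH) ltac:(lia)) as [C2 [HC2 N2]].
  destruct (Flat (fun j t => dq (dq (G j t))) (fun j t => dq (dq (H j t))) 2%nat 0%nat 4%nat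
    (smooth4_dq _ Gq) (smooth4_dq _ Hq) (Eqq G SG) (Eqq H SH) ltac:(lia)) as [C3 [HC3 N3]].
  destruct (Flat (fun j t => dp (dq (G j t))) (fun j t => dp (dq (H j t))) 1%nat 1%nat 4%nat
    (smooth4_dp _ Gq) (smooth4_dp _ Hq) (Epq G SG) (Epq H SH) ltac:(lia)) as [C4 [HC4 N4]].
  destruct (Flat (fun j t => dp (dp (G j t))) (fun j t => dp (dp (H j t))) 0%nat 2%nat 4%nat
    (smooth4_dp _ Gp) (smooth4_dp _ Hp) (Epp G SG) (Epp H SH) ltac:(lia)) as [C5 [HC5 N5]].
  exists (C1 + C2 + C3 + C4 + C5); split; [lra|].
  eapply near_imp; [|exact (near_and _ _ _ N1 (near_and _ _ _ N2 (near_and _ _ _ N3 (near_and _ _ _ N4 N5))))].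
  intros j q p [K1 [K2 [K3 [K4 K5]]]]; cbv beta in *.
  assert (P6 : 0 <= (Rabs q + Rabs p) ^ 6)
    by (apply pow_le; pose proof (Rabs_pos q); pose proof (Rabs_pos p); lra).
  assert (P5 : 0 <= (Rabs q + Rabs p) ^ 5)
    by (apply pow_le; pose proof (Rabs_pos q); pose proof (Rabs_pos p); lra).
  assert (M : forall x c c' y, 0 <= y -> c <= c' -> x <= c * y -> x <= c' * y).
  { intros x c c' y Hy Hc Hx; eapply Rle_trans; [exact Hx|]; apply Rmult_le_compat_r; assumption. }
  repeat split; (eapply M; [| |eassumption]); lra.
Qed.

(* [d q^k] is the leading nonlinear term of the reduced equation: [nu2 q^2] at a zero of [nu1]
   where [nu2] does not vanish, and [b q^4] otherwise. In the second case [nu2 = O(nu1)]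
   because [nu1] crosses zero transversally, so the quartic term cannot interfere. *)
Definition leading_term (j0 tau d : R) (k : nat) : Prop :=
  (nu2 j0 tau <> 0 /\ d = nu2 j0 tau /\ k = 2%nat) \/ (nu2 j0 tau = 0 /\ d = b /\ k = 4%nat).

Lemma leading_term_exists j0 tau : exists d k, leading_term j0 tau d k.
Proof.
  destruct (Req_dec (nu2 j0 tau) 0) as [E|E]; [exists b, 4%nat; right | exists (nu2 j0 tau), 2%nat; left];
    auto.
Qed.

(** Allowing an error of half the slope keeps the sign of the linear part and half of its size. The
    lower bound on [|nu1|] is what converts a Lipschitz bound on [nu2] into a bound by [nu1]. *)
Lemma nu1_crossing j0 tau c :
  c = Derive (fun j => nu1 j tau) j0 -> c <> 0 -> nu1 j0 tau = 0 ->
  exists dl, 0 < dl /\ forall j, Rabs (j - j0) < dl ->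
    Rabs c / 2 * Rabs (j - j0) <= Rabs (nu1 j tau) /\
    (j <> j0 -> 0 < c * (j - j0) * nu1 j tau).
Proof.
  intros Ec Hc H0; assert (Pc := Rabs_pos_lt c Hc).
  assert (D : is_derive (fun j => nu1 j tau) j0 c).
  { rewrite Ec; exact (is_derive_dq (fun _ _ => nu1) 0 0 j0 tau (smooth2_smooth4 nu1 hnu1)). }
  destruct (proj1 (is_derive_eps _ _ _) D (Rabs c / 2) ltac:(lra)) as [dl [Hdl H]].
  exists dl; split; [exact Hdl|]; intros j Hj; specialize (H j Hj).
  rewrite H0, Rminus_0_r in H; split.
  - pose proof (Rabs_triang_inv (c * (j - j0)) (c * (j - j0) - nu1 j tau)) as T.
    replace (c * (j - j0) - (c * (j - j0) - nu1 j tau)) with (nu1 j tau) in T by ring.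
    rewrite (Rabs_minus_sym (c * (j - j0)) (nu1 j tau)) in T.
    rewrite Rabs_mult in T; lra.
  - intros Hne.
    assert (Px : 0 < Rabs (j - j0)) by (apply Rabs_pos_lt; lra).
    set (x := c * (j - j0)) in *.
    assert (Ex : Rabs x = Rabs c * Rabs (j - j0)) by apply Rabs_mult.
    assert (Hx : 0 < Rabs x) by (rewrite Ex; apply Rmult_lt_0_compat; assumption).
    assert (H' : Rabs (nu1 j tau - x) <= Rabs x / 2) by lra.
    clearbody x; revert H' Hx; unfold Rabs at 2 3; destruct (Rcase_abs x); intros H' Hx;
      apply Rabs_le_between in H'; nra.
Qed.

Lemma nu2_lipschitz j0 tau :
  exists L dl, 0 < L /\ 0 < dl /\ forall j, Rabs (j - j0) < dl ->
    Rabs (nu2 j tau - nu2 j0 tau) <= L * Rabs (j - j0).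
Proof.
  assert (D := is_derive_dq (fun _ _ => nu2) 0 0 j0 tau (smooth2_smooth4 nu2 hnu2)); cbv beta in D.
  set (l := dq nu2 j0 tau) in *.
  destruct (proj1 (is_derive_eps _ _ _) D 1 ltac:(lra)) as [dl [Hdl H]].
  exists (Rabs l + 1), dl; repeat split; [pose proof (Rabs_pos l); lra | exact Hdl |].
  intros j Hj; specialize (H j Hj).
  replace (nu2 j tau - nu2 j0 tau) with ((nu2 j tau - nu2 j0 tau - l * (j - j0)) + l * (j - j0)) by ring.
  eapply Rle_trans; [apply Rabs_triang|]; rewrite Rabs_mult; lra.
Qed.

Lemma normal_form_near j0 tau d k :
  Rabs j0 < rho -> Rabs tau < rho -> nu1 j0 tau = 0 ->
  Derive (fun j => nu1 j tau) j0 <> 0 -> leading_term j0 tau d k ->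
  exists C, 0 < C /\ near j0 (normal_form_at (pullback f A B) tau a d C (fun j => nu1 j tau) k).
Proof.
  intros Hj0 Ht H0 Hc HL.
  destruct (remainder_bounds j0 tau Hj0 Ht) as [C1 [HC1 N1]].
  set (c := Derive (fun j => nu1 j tau) j0) in *.
  destruct (nu1_crossing j0 tau c eq_refl Hc H0) as [d1 [Hd1 X1]].
  destruct (nu2_lipschitz j0 tau) as [L [d2 [HLp [Hd2 X2]]]].
  assert (Pc := Rabs_pos_lt c Hc).
  set (M := 2 * L / Rabs c).
  assert (HM : 0 < M) by (apply Rdiv_lt_0_compat; lra).
  assert (N2 : near j0 (fun j _ _ => Rabs (nu2 j tau - nu2 j0 tau) <= M * Rabs (nu1 j tau))).
  { pose proof (Rmin_l d1 d2); pose proof (Rmin_r d1 d2).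
    apply (near_param j0 (Rmin d1 d2)); [apply Rmin_glb_lt; lra|]; intros j Hj.
    destruct (X1 j ltac:(lra)) as [Y1 _]; specialize (X2 j ltac:(lra)).
    eapply Rle_trans; [exact X2|].
    replace (L * Rabs (j - j0)) with (M * (Rabs c / 2 * Rabs (j - j0))) by (unfold M; field; lra).
    apply Rmult_le_compat_l; lra. }
  (* The factors 3 and 5 appear on differentiating [m q^3] and [b q^5]. *)
  set (C := C1 + 3 * M + 5 * Rabs b).
  assert (HC : 0 < C) by (unfold C; pose proof (Rabs_pos b); lra).
  exists C; split; [exact HC|].
  assert (N3 : near j0 (fun _ q _ => Rabs q < 1)).
  { exists 1; split; [lra|]; intros; assumption. }
  eapply near_imp; [|exact (near_and _ _ _ N3 (near_and _ _ _ N1 N2))].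
  intros j q p [Hq1 [[K1 [K2 [K3 [K4 K5]]]] K6]]; cbv beta in K1, K2, K3, K4, K5, K6, Hq1.
  rewrite dq_Hnf in K1; rewrite dp_Hnf in K2; rewrite dqq_Hnf in K3; rewrite dpq_Hnf in K4.
  rewrite dpp_Hnf in K5; rewrite Rminus_0_r in K4.
  pose proof (Rabs_pos q); pose proof (Rabs_pos p); pose proof (Rabs_pos b).
  pose proof (Rabs_pos (nu1 j tau)) as Hn.
  set (r := Rabs q + Rabs p) in *.
  assert (P5 : 0 <= r ^ 5) by (apply pow_le; unfold r; lra).
  assert (P6 : 0 <= r ^ 6) by (apply pow_le; unfold r; lra).
  assert (C1C : C1 <= C) by (unfold C; lra).
  set (n := nu1 j tau) in *; set (n2 := nu2 j tau) in *.
  assert (Pk : forall i, 0 <= Rabs q ^ i) by (intros i; apply pow_le; assumption).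
  (* [m] is the drift of [nu2] from its value at the crossing; [u] is [b] when the quartic term
     leads, and 0 when the sextic term is itself the leading one. *)
  assert (Eq : exists m u, n2 * q ^ 3 + b * q ^ 5 = d * q ^ k * q + m * q ^ 3 + u * Rabs q ^ (k + 2) * q /\
     3 * n2 * q ^ 2 + 5 * b * q ^ 4 = INR (k + 1) * d * q ^ k + 3 * m * q ^ 2 + 5 * u * Rabs q ^ (k + 2) /\
     Rabs m <= M * Rabs n /\ Rabs u <= Rabs b).
  { exists (n2 - nu2 j0 tau); destruct HL as [[E1 [-> ->]]|[E1 [-> ->]]].
    - exists b; change (2 + 2)%nat with 4%nat; change (2 + 1)%nat with 3%nat.
      replace (Rabs q ^ 4) with (q ^ 4) by (rewrite RPow_abs, Rabs_pos_eq;
        [reflexivity | replace (q ^ 4) with ((q ^ 2) ^ 2) by ring; apply pow2_ge_0]).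
      simpl INR; repeat split; try ring; try assumption; lra.
    - exists 0; change (4 + 1)%nat with 5%nat; rewrite E1 in *; simpl INR.
      repeat split; try ring; try assumption; rewrite Rabs_R0; assumption. }
  destruct Eq as [m [u [Q1 [Q2 [Q3 Q4]]]]].
  unfold normal_form_at; fold r; fold n.
  split; [|split; [|split; [|split]]].
  - eapply Rle_trans; [exact K2|]; apply Rmult_le_compat_r; assumption.
  - replace (dq (pullback f A B j tau) q p - q * (n + d * q ^ k))
      with ((dq (pullback f A B j tau) q p - (b * q ^ 5 + n * q + n2 * q ^ 3))
        + (m * q ^ 3 + u * Rabs q ^ (k + 2) * q)) by lra.
    eapply Rle_trans; [apply Rabs_triang|].
    eapply Rle_trans; [apply Rplus_le_compat; [exact K1 | apply Rabs_triang]|].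
    rewrite !Rabs_mult, <- (RPow_abs q 3), (Rabs_pos_eq (Rabs q ^ (k + 2))) by apply Pk.
    assert (T1 : Rabs m * Rabs q ^ 3 <= M * (Rabs n * Rabs q ^ 3)).
    { rewrite <- Rmult_assoc; apply Rmult_le_compat_r; [apply Pk | exact Q3]. }
    assert (T2 : Rabs u * Rabs q ^ (k + 2) * Rabs q <= Rabs b * Rabs q ^ (k + 2)).
    { rewrite <- (Rmult_1_r (Rabs b * Rabs q ^ (k + 2))); apply Rmult_le_compat; try lra.
      - apply Rmult_le_pos; [apply Rabs_pos | apply Pk].
      - apply Rmult_le_compat_r; [apply Pk | exact Q4]. }
    assert (Z1 : 0 <= Rabs n * Rabs q ^ 3) by (apply Rmult_le_pos; [exact Hn | apply Pk]).
    pose proof (Pk (k + 2)%nat) as Z2.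
    set (X := Rabs n * Rabs q ^ 3) in *; set (Y := Rabs q ^ (k + 2)) in *.
    assert (C1 * r ^ 6 <= C * r ^ 6) by (apply Rmult_le_compat_r; lra).
    assert (M * X <= C * X) by (apply Rmult_le_compat_r; unfold C; lra).
    assert (Rabs b * Y <= C * Y) by (apply Rmult_le_compat_r; unfold C; lra).
    lra.
  - replace (dq (dq (pullback f A B j tau)) q p - (n + INR (k + 1) * d * q ^ k))
      with ((dq (dq (pullback f A B j tau)) q p - (5 * b * q ^ 4 + n + 3 * n2 * q ^ 2))
        + (3 * m * q ^ 2 + 5 * u * Rabs q ^ (k + 2))) by lra.
    eapply Rle_trans; [apply Rabs_triang|].
    eapply Rle_trans; [apply Rplus_le_compat; [exact K3 | apply Rabs_triang]|].
    rewrite !Rabs_mult, (Rabs_pos_eq (q ^ 2)), (Rabs_pos_eq (Rabs q ^ (k + 2))),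
      (Rabs_pos_eq 3), (Rabs_pos_eq 5) by (apply Pk || apply pow2_ge_0 || lra).
    pose proof (pow2_ge_0 q) as Pq2.
    assert (T1 : 3 * Rabs m * q ^ 2 <= 3 * M * (Rabs n * q ^ 2)).
    { replace (3 * M * (Rabs n * q ^ 2)) with (3 * (M * Rabs n) * q ^ 2) by ring.
      apply Rmult_le_compat_r; [exact Pq2 | lra]. }
    assert (T2 : 5 * Rabs u * Rabs q ^ (k + 2) <= 5 * Rabs b * Rabs q ^ (k + 1)).
    { apply Rmult_le_compat; try lra; [pose proof (Rabs_pos u); lra | apply Pk |].
      apply pow_le_pow; [lra | lia]. }
    assert (Z1 : 0 <= Rabs n * q ^ 2) by (apply Rmult_le_pos; [exact Hn | exact Pq2]).
    pose proof (Pk (k + 1)%nat) as Z2.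
    set (X := Rabs n * q ^ 2) in *; set (Y := Rabs q ^ (k + 1)) in *.
    assert (C1 * r ^ 5 <= C * r ^ 5) by (apply Rmult_le_compat_r; lra).
    assert (3 * M * X <= C * X) by (apply Rmult_le_compat_r; unfold C; lra).
    assert (5 * Rabs b * Y <= C * Y) by (apply Rmult_le_compat_r; unfold C; lra).
    lra.
  - eapply Rle_trans; [exact K4|]; apply Rmult_le_compat_r; assumption.
  - eapply Rle_trans; [exact K5|]; apply Rmult_le_compat_r; assumption.
Qed.

(** The common core of both kinds of flip, before the sign of [a d] enters. Local surjectivity of
    the coordinates carries the absence of critical points to a disc for [f]; their continuity, and
    the fact that only the origin goes to the origin, carry over the new critical point. *)
Lemma crossing_bifurcation j0 tau d k :
  Rabs j0 < rho -> Rabs tau < rho -> nu1 j0 tau = 0 ->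
  Derive (fun j => nu1 j tau) j0 <> 0 -> leading_term j0 tau d k ->
  exists s, (s = 1 \/ s = -1) /\ exists delta r, 0 < delta /\ 0 < r /\
    (forall j, 0 < s * (j0 - j) < delta -> 0 < nu1 j tau * d /\ Rabs j < rho /\
       forall x, 0 < dist2 x origin < r -> ~ singular (f j tau) x) /\
    (forall j, 0 < s * (j - j0) < delta -> nu1 j tau * d < 0 /\ Rabs j < rho) /\
    (forall eps, 0 < eps -> exists delta', 0 < delta' /\
       forall j, 0 < s * (j - j0) < delta' ->
         exists q p, 0 < dist2 (q, p) origin < eps /\
           dq (f j tau) q p = 0 /\ dp (f j tau) q p = 0 /\
           0 < a * d * hess_det (f j tau) q p).
Proof.
  intros Hj0 Ht H0 Hc HL.
  set (G := pullback f A B).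
  assert (SG : smooth4 G) by (apply smooth4_pullback; assumption).
  assert (Hd : d <> 0) by (destruct HL as [[E [-> _]]|[_ [-> _]]]; assumption).
  assert (Hk : k = 2%nat \/ k = 4%nat) by (destruct HL as [[_ [_ E]]|[_ [_ E]]]; auto).
  destruct (normal_form_near j0 tau d k Hj0 Ht H0 Hc HL) as [C [HC NF]].
  set (c := Derive (fun j => nu1 j tau) j0) in *.
  destruct (nu1_crossing j0 tau c eq_refl Hc H0) as [d1 [Hd1 X1]].
  destruct (hcoord j0 tau Hj0 Ht) as [_ [_ [HJ _]]].
  assert (N0 : near j0 (fun j _ _ => A j tau 0 0 = 0 /\ B j tau 0 0 = 0)).
  { apply (near_param j0 (rho - Rabs j0)); [lra|]; intros j Hj.
    destruct (hcoord j tau) as [E1 [E2 _]]; [|exact Ht|split; assumption].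
    pose proof (Rabs_triang_inv j j0); lra. }
  destruct (local_inverse A B j0 tau hA hB HJ N0) as [d0 [Hd0 [Inj Surj]]].
  destruct (no_critical_point G j0 tau a d C (fun j => nu1 j tau) k ha Hd HC Hk NF) as [d2 [Hd2 NoCrit]].
  assert (Hcd : c * d <> 0) by (apply Rmult_integral_contrapositive_currified; assumption).
  destruct (sign_exists _ Hcd) as [s' [Hs' Ps']].
  (* [nu1 d] has the sign of [c d (j - j0)], so this orientation puts [nu1 d > 0] before the
     crossing. *)
  set (s := - s').
  assert (Hs : s = 1 \/ s = -1) by (unfold s; destruct Hs'; subst; lra).
  assert (Ps : s * (c * d) < 0) by (unfold s; lra).
  clearbody s; clear s' Hs' Ps'.
  assert (As : forall x dl, 0 < s * x < dl -> Rabs x < dl /\ x <> 0).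
  { intros x dl Hx; split; [|intros ->; lra].
    destruct Hs as [->| ->]; apply Rabs_def1; lra. }
  assert (Sign : forall j, Rabs (j - j0) < d1 -> j <> j0 -> s * (j - j0) * (nu1 j tau * d) < 0).
  { intros j Hj Hne; destruct (X1 j Hj) as [_ Y]; specialize (Y Hne).
    assert (Pc : 0 < c ^ 2) by (rewrite <- pow2_abs; apply pow_lt, Rabs_pos_lt, Hc).
    apply Rmult_lt_reg_l with (c ^ 2); [exact Pc|].
    replace (c ^ 2 * (s * (j - j0) * (nu1 j tau * d)))
      with (s * (c * d) * (c * (j - j0) * nu1 j tau)) by ring.
    rewrite Rmult_0_r, <- (Rmult_0_l (c * (j - j0) * nu1 j tau)); apply Rmult_lt_compat_r; assumption. }
  destruct (Surj (Rmin d0 d2 / 2)) as [r [Hr Sr]].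
  { pose proof (Rmin_l d0 d2); assert (0 < Rmin d0 d2) by (apply Rmin_glb_lt; lra); lra. }
  pose proof (Rmin_l d0 d2) as Ml; pose proof (Rmin_r d0 d2) as Mr.
  assert (Mp : 0 < Rmin d0 d2) by (apply Rmin_glb_lt; lra).
  set (dl := Rmin (Rmin d0 d2) (Rmin d1 (rho - Rabs j0))).
  assert (L1 : dl <= Rmin d0 d2) by apply Rmin_l.
  assert (L2 : dl <= d1) by (eapply Rle_trans; [apply Rmin_r | apply Rmin_l]).
  assert (L3 : dl <= rho - Rabs j0) by (eapply Rle_trans; [apply Rmin_r | apply Rmin_r]).
  assert (Hdl : 0 < dl) by (apply Rmin_glb_lt; [lra | apply Rmin_glb_lt; lra]).
  assert (Jr : forall j, Rabs (j - j0) < dl -> Rabs j < rho).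
  { intros j Hj; pose proof (Rabs_triang_inv j j0); lra. }
  exists s; split; [exact Hs|]; exists dl, r; split; [exact Hdl|]; split; [exact Hr|].
  split; [|split].
  - intros j Hj; destruct (As _ _ Hj) as [Aj Nj]; rewrite Rabs_minus_sym in Aj.
    assert (Pn : 0 < nu1 j tau * d) by (apply pos_of_mul_neg with (s * (j - j0)); [apply Sign|]; lra).
    split; [exact Pn|]; split; [apply Jr, Aj|].
    intros x Hx [S1 S2].
    assert (Hx2 := proj1 (dist2_origin_lt x r Hr) (proj2 Hx)).
    destruct (Sr j (fst x) (snd x)) as [q [p [Bq [Bp [E1 E2]]]]]; [lra | | |].
    { apply (abs_lt_of_sq _ (snd x)); assumption. }
    { apply (abs_lt_of_sq _ (fst x)); lra. }
    rewrite <- E1, <- E2 in S1, S2.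
    destruct (critical_pullback f A B hf hA hB j tau q p S1 S2) as [G1 G2].
    destruct (NoCrit j q p) as [Zq Zp]; try assumption; try lra.
    destruct (hcoord j tau (Jr j Aj) Ht) as [Z1 [Z2 _]].
    subst q p; rewrite dist2_origin, <- E1, <- E2, Z1, Z2 in Hx.
    replace (0 ^ 2 + 0 ^ 2) with 0 in Hx by ring; rewrite sqrt_0 in Hx; lra.
  - intros j Hj; destruct (As _ _ Hj) as [Aj Nj].
    split; [|apply Jr, Aj].
    apply neg_of_mul_neg with (s * (j - j0)); [apply Sign|]; lra.
  - intros eps Heps.
    destruct (near_cont A j0 tau (eps / 2) hA ltac:(lra)) as [e1 [He1 V1]].
    destruct (near_cont B j0 tau (eps / 2) hB ltac:(lra)) as [e2 [He2 V2]].
    destruct (near_cont _ j0 tau _ (smooth4_jac A B hA hB) (Rabs_pos_lt _ HJ)) as [e3 [He3 V3]].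
    destruct (hcoord j0 tau Hj0 Ht) as [Z1 [Z2 _]]; rewrite Z1 in V1; rewrite Z2 in V2.
    set (e := Rmin (Rmin e1 e2) (Rmin e3 d0)).
    assert (e <= e1) by (eapply Rle_trans; [apply Rmin_l | apply Rmin_l]).
    assert (e <= e2) by (eapply Rle_trans; [apply Rmin_l | apply Rmin_r]).
    assert (e <= e3) by (eapply Rle_trans; [apply Rmin_r | apply Rmin_l]).
    assert (e <= d0) by (eapply Rle_trans; [apply Rmin_r | apply Rmin_r]).
    assert (He : 0 < e) by (apply Rmin_glb_lt; apply Rmin_glb_lt; lra).
    assert (Cn : forall e, 0 < e -> exists dl, 0 < dl /\ forall j, Rabs (j - j0) < dl -> Rabs (nu1 j tau) < e).
    { intros e' He'.
      destruct (smooth4_cont (fun _ _ => nu1) 0 0 j0 tau e' (smooth2_smooth4 nu1 hnu1) He') as [dd [Hdd K]].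
      exists dd; split; [exact Hdd|]; intros j Hj.
      assert (Z : forall x, Rabs (x - x) < dd)
        by (intros; apply Rabs_self_lt, Hdd).
      specialize (K 0 0 j tau (Z 0) (Z 0) Hj (Z tau)); rewrite H0, Rminus_0_r in K; exact K. }
    destruct (critical_point_exists G j0 tau a d C (fun j => nu1 j tau) k SG ha Hd HC Hk NF Cn e He)
      as [d3 [Hd3 Ex]].
    set (dl' := Rmin dl (Rmin d3 e)).
    assert (dl' <= dl) by apply Rmin_l.
    assert (dl' <= d3) by (eapply Rle_trans; [apply Rmin_r | apply Rmin_l]).
    assert (dl' <= e) by (eapply Rle_trans; [apply Rmin_r | apply Rmin_r]).
    exists dl'; split; [apply Rmin_glb_lt; [lra | apply Rmin_glb_lt; lra]|].
    intros j Hj; destruct (As _ _ Hj) as [Aj Nj].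
    assert (Neg : nu1 j tau * d < 0)
      by (apply neg_of_mul_neg with (s * (j - j0)); [apply Sign|]; lra).
    destruct (Ex j ltac:(lra) Neg) as [q [p [Bq [Bp [Nq [Cq [Cp Det]]]]]]].
    specialize (V1 j q p ltac:(lra) ltac:(lra) ltac:(lra)); rewrite Rminus_0_r in V1.
    specialize (V2 j q p ltac:(lra) ltac:(lra) ltac:(lra)); rewrite Rminus_0_r in V2.
    specialize (V3 j q p ltac:(lra) ltac:(lra) ltac:(lra)).
    assert (Jn : jac A B j tau q p <> 0).
    { intros E; rewrite E, Rminus_0_l, Rabs_Ropp in V3; lra. }
    destruct (pullback_critical f A B hf hA hB j tau q p Jn Cq Cp) as [F1 F2].
    exists (A j tau q p), (B j tau q p); split; [split|split; [exact F1 | split; [exact F2|]]].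
    + rewrite dist2_origin; simpl fst; simpl snd; apply sqrt_lt_R0.
      pose proof (pow2_ge_0 (A j tau q p)); pose proof (pow2_ge_0 (B j tau q p)).
      (* The image of the critical point must differ from the origin; if both components vanished,
         [Inj] would give [q = 0]. *)
      destruct (Req_dec (A j tau q p) 0) as [EA|EA].
      * destruct (Req_dec (B j tau q p) 0) as [EB|EB].
        -- destruct (Inj j q p ltac:(lra) ltac:(lra) ltac:(lra) EA EB); contradiction.
        -- assert (0 < B j tau q p ^ 2) by (rewrite <- pow2_abs; apply pow_lt, Rabs_pos_lt, EB); lra.
      * assert (0 < A j tau q p ^ 2) by (rewrite <- pow2_abs; apply pow_lt, Rabs_pos_lt, EA); lra.
    + apply dist2_origin_lt; [exact Heps|]; simpl fst; simpl snd.
      assert (A j tau q p ^ 2 <= (eps / 2) ^ 2)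
        by (rewrite <- pow2_abs; apply pow_incr; pose proof (Rabs_pos (A j tau q p)); lra).
      assert (B j tau q p ^ 2 <= (eps / 2) ^ 2)
        by (rewrite <- pow2_abs; apply pow_incr; pose proof (Rabs_pos (B j tau q p)); lra).
      assert (0 < eps ^ 2) by (apply pow_lt, Heps).
      replace ((eps / 2) ^ 2) with (eps ^ 2 / 4) in * by field; lra.
    + unfold G in Det; rewrite (hess_det_pullback f A B hf hA hB j tau q p F1 F2) in Det.
      assert (Pj : 0 < jac A B j tau q p ^ 2) by (rewrite <- pow2_abs; apply pow_lt, Rabs_pos_lt, Jn).
      apply Rmult_lt_reg_l with (jac A B j tau q p ^ 2); [exact Pj|]; rewrite Rmult_0_r; lra.
Qed.

(** * The two kinds of flip, and their absence where nu1 does not vanish *)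

Lemma mul_sign_pos x y z : 0 < x * y -> 0 < y * z -> 0 < x * z.
Proof. intros H1 H2; destruct (Rlt_or_le 0 y); nra. Qed.

Lemma mul_sign_neg x y z : 0 < x * y -> y * z < 0 -> x * z < 0.
Proof. intros H1 H2; assert (0 < x * - z) by (apply mul_sign_pos with y; lra); lra. Qed.

(** For [a d > 0] the products [nu1 d] and [a nu1] have the same sign: the origin is stable on the
    side without further critical points, and the determinant at the new point is positive. For
    [a d < 0] both signs reverse, which is the dual case. *)
Lemma ham_flip_at j0 tau d k :
  Rabs j0 < rho -> Rabs tau < rho -> nu1 j0 tau = 0 ->
  Derive (fun j => nu1 j tau) j0 <> 0 -> leading_term j0 tau d k ->
  0 < a * d -> ham_flip (fun j => f j tau) j0.
Proof.
  intros Hj0 Ht H0 Hc HL Had.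
  destruct (crossing_bifurcation j0 tau d k Hj0 Ht H0 Hc HL)
    as [s [Hs [dl [r [Hdl [Hr [H1 [H2 H3]]]]]]]].
  exists s; split; [exact Hs|]; exists dl, r; split; [exact Hdl|]; split; [exact Hr|].
  split; [|split].
  - intros j Hj; destruct (H1 j Hj) as [P [Bj Hx]]; split; [|exact Hx].
    apply origin_stable; try assumption; apply mul_sign_pos with d; lra.
  - intros j Hj; destruct (H2 j Hj) as [P Bj].
    apply origin_unstable; try assumption; apply mul_sign_neg with d; lra.
  - intros eps He; destruct (H3 eps He) as [dl' [Hdl' K]]; exists dl'; split; [exact Hdl'|].
    intros j Hj; destruct (K j Hj) as [q [p [D [Cq [Cp Det]]]]].
    exists (q, p); split; [exact D|]; apply centre_of_det_pos; try assumption.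
    apply Rmult_lt_reg_l with (a * d); lra.
Qed.

Lemma dual_ham_flip_at j0 tau d k :
  Rabs j0 < rho -> Rabs tau < rho -> nu1 j0 tau = 0 ->
  Derive (fun j => nu1 j tau) j0 <> 0 -> leading_term j0 tau d k ->
  a * d < 0 -> dual_ham_flip (fun j => f j tau) j0.
Proof.
  intros Hj0 Ht H0 Hc HL Had.
  destruct (crossing_bifurcation j0 tau d k Hj0 Ht H0 Hc HL)
    as [s [Hs [dl [r [Hdl [Hr [H1 [H2 H3]]]]]]]].
  exists s; split; [exact Hs|]; exists dl, r; split; [exact Hdl|]; split; [exact Hr|].
  assert (Had' : 0 < a * - d) by lra.
  split; [|split].
  - intros j Hj; destruct (H1 j Hj) as [P [Bj Hx]]; split; [|exact Hx].
    apply origin_unstable; try assumption; apply mul_sign_neg with (- d); lra.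
  - intros j Hj; destruct (H2 j Hj) as [P Bj].
    apply origin_stable; try assumption; apply mul_sign_pos with (- d); lra.
  - intros eps He; destruct (H3 eps He) as [dl' [Hdl' K]]; exists dl'; split; [exact Hdl'|].
    intros j Hj; destruct (K j Hj) as [q [p [D [Cq [Cp Det]]]]].
    exists (q, p); split; [exact D|]; apply saddle_of_det_neg; try assumption.
    apply Ropp_lt_cancel, Rmult_lt_reg_l with (a * - d); lra.
Qed.

(** If [nu2] vanishes at the crossing, the sign of [a b] decides between the two kinds. *)
Lemma flip_at_of_crossing j0 tau :
  Rabs j0 < rho -> Rabs tau < rho -> nu1 j0 tau = 0 ->
  Derive (fun j => nu1 j tau) j0 <> 0 -> flip_at f j0 tau.
Proof.
  intros Hj0 Ht H0 Hc; destruct (leading_term_exists j0 tau) as [d [k HL]].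
  assert (Hd : d <> 0) by (destruct HL as [[E [-> _]]|[_ [-> _]]]; assumption).
  destruct (Rtotal_order (a * d) 0) as [H|[H|H]].
  - right; apply dual_ham_flip_at with d k; assumption.
  - apply Rmult_integral in H; tauto.
  - left; apply ham_flip_at with d k; assumption.
Qed.

(** Where [nu1] is nonzero it keeps its sign nearby, so the origin is stable on both sides of [j0]
    or on neither, whereas each kind of flip contains a change of stability. *)
Lemma nu1_zero_of_flip j0 tau :
  Rabs j0 < rho -> Rabs tau < rho -> flip_at f j0 tau -> nu1 j0 tau = 0.
Proof.
  intros Hj0 Ht HF; destruct (Req_dec (nu1 j0 tau) 0) as [|Hn]; [assumption|exfalso].
  assert (Hx : a * nu1 j0 tau <> 0) by (apply Rmult_integral_contrapositive_currified; assumption).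
  assert (Px := Rabs_pos_lt _ Hn).
  destruct (smooth4_cont (fun _ _ => nu1) 0 0 j0 tau _ (smooth2_smooth4 nu1 hnu1) Px) as [d1 [Hd1 K]].
  assert (Same : forall j, Rabs (j - j0) < d1 -> 0 < nu1 j0 tau * nu1 j tau).
  { intros j Hj; specialize (K 0 0 j tau).
    assert (Z : forall x, Rabs (x - x) < d1) by (intros; apply Rabs_self_lt, Hd1).
    specialize (K (Z 0) (Z 0) Hj (Z tau)); apply Rabs_def2 in K; revert K.
    unfold Rabs; destruct Rcase_abs; intros; nra. }
  assert (Key : forall s dl, (s = 1 \/ s = -1) -> 0 < dl ->
    exists j j', 0 < s * (j0 - j) < dl /\ 0 < s * (j' - j0) < dl /\
      ((stable (f j tau) origin /\ stable (f j' tau) origin) \/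
       (~ stable (f j tau) origin /\ ~ stable (f j' tau) origin))).
  { intros s dl Hs Hdl.
    set (h := Rmin dl (Rmin d1 (rho - Rabs j0)) / 2).
    assert (L0 : 0 < Rmin dl (Rmin d1 (rho - Rabs j0))) by (apply Rmin_glb_lt; [lra | apply Rmin_glb_lt; lra]).
    assert (L1 : h < dl) by (unfold h; pose proof (Rmin_l dl (Rmin d1 (rho - Rabs j0))); lra).
    assert (L2 : h < Rmin d1 (rho - Rabs j0))
      by (unfold h; pose proof (Rmin_r dl (Rmin d1 (rho - Rabs j0))); lra).
    pose proof (Rmin_l d1 (rho - Rabs j0)); pose proof (Rmin_r d1 (rho - Rabs j0)).
    assert (Hh : 0 < h) by (unfold h; lra).
    assert (Ash : Rabs (s * h) = h).
    { rewrite Rabs_mult, (Rabs_pos_eq h) by lra; destruct Hs as [->| ->];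
        [rewrite Rabs_R1 | rewrite Rabs_left by lra]; ring. }
    assert (Ess : s * (s * h) = h) by (destruct Hs as [->| ->]; ring).
    assert (B1 : Rabs (j0 - s * h - j0) < d1).
    { replace (j0 - s * h - j0) with (- (s * h)) by ring; rewrite Rabs_Ropp; lra. }
    assert (B2 : Rabs (j0 + s * h - j0) < d1).
    { replace (j0 + s * h - j0) with (s * h) by ring; lra. }
    assert (R1 : Rabs (j0 - s * h) < rho).
    { eapply Rle_lt_trans; [apply Rabs_triang|]; rewrite Rabs_Ropp; lra. }
    assert (R2 : Rabs (j0 + s * h) < rho).
    { eapply Rle_lt_trans; [apply Rabs_triang|]; lra. }
    exists (j0 - s * h), (j0 + s * h); split; [|split].
    - replace (s * (j0 - (j0 - s * h))) with (s * (s * h)) by ring; lra.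
    - replace (s * (j0 + s * h - j0)) with (s * (s * h)) by ring; lra.
    - specialize (Same _ B1) as S1; specialize (Same _ B2) as S2.
      destruct (Rlt_or_le 0 (a * nu1 j0 tau)) as [Hp|Hp].
      + left; split; apply origin_stable; try assumption;
          (apply mul_sign_pos with (nu1 j0 tau); assumption).
      + assert (Hp' : 0 < - a * nu1 j0 tau) by lra.
        right; split; apply origin_unstable; try assumption.
        * assert (0 < - a * nu1 (j0 - s * h) tau) by (apply mul_sign_pos with (nu1 j0 tau); assumption); lra.
        * assert (0 < - a * nu1 (j0 + s * h) tau) by (apply mul_sign_pos with (nu1 j0 tau); assumption); lra. }
  destruct HF as [[s [Hs [dl [r [Hdl [Hr [H1 [H2 _]]]]]]]]|[s [Hs [dl [r [Hdl [Hr [H1 [H2 _]]]]]]]]];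
    destruct (Key s dl Hs Hdl) as [j [j' [Kj [Kj' [[U V]|[U V]]]]]];
    destruct (H1 j Kj) as [W _]; specialize (H2 j' Kj'); contradiction.
Qed.

End Flip.

Theorem theorem3p6
  (a b : R) (nu1 nu2 : R -> R -> R) (f : R -> R -> R -> R -> R)
  (ha : a <> 0) (hb : b <> 0)
  (hnu1 : smooth2 nu1) (hnu2 : smooth2 nu2)
  (hnu1_0 : nu1 0 0 = 0) (hnu2_0 : nu2 0 0 = 0)
  (hnu1_j : Derive (fun j => nu1 j 0) 0 = 0)
  (hnu1_jj : Derive (fun j => Derive (fun j' => nu1 j' 0) j) 0 <> 0)
  (hnu1_t : Derive (fun t => nu1 0 t) 0 <> 0)
  (hf : smooth4 f)
  (hZ2 : forall j t q p, f j t (- q) (- p) = f j t q p)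
  (hcoord : exists (Phi1 Phi2 : R -> R -> R -> R -> R) (rho : R),
     0 < rho /\ smooth4 Phi1 /\ smooth4 Phi2 /\
     forall j t, Rabs j < rho -> Rabs t < rho ->
       Phi1 j t 0 0 = 0 /\ Phi2 j t 0 0 = 0 /\
       Derive (fun q => Phi1 j t q 0) 0 * Derive (fun p => Phi2 j t 0 p) 0
         - Derive (fun p => Phi1 j t 0 p) 0 * Derive (fun q => Phi2 j t q 0) 0 <> 0 /\
       same_6jet (fun q p => f j t (Phi1 j t q p) (Phi2 j t q p))
                 (Hnf a b nu1 nu2 j t)) :
  double_flip f /\
  exists eps eta, 0 < eps /\ 0 < eta /\
    forall tau j0, Rabs tau < eta -> Rabs j0 < eps ->
      nu1 j0 tau = 0 -> nu2 j0 tau <> 0 ->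
      (a * nu2 j0 tau < 0 -> dual_ham_flip (fun j => f j tau) j0) /\
      (a * nu2 j0 tau > 0 -> ham_flip (fun j => f j tau) j0).
Proof.
  destruct hcoord as [A [B [rho [Hrho [hA [hB hC]]]]]].
  destruct (fold_zero_set nu1 hnu1 hnu1_0 hnu1_j hnu1_jj hnu1_t)
    as [s [e0 [Hs [He0 [Hpos [Htr Htwo]]]]]].
  set (e := Rmin e0 rho / 2).
  pose proof (Rmin_l e0 rho); pose proof (Rmin_r e0 rho).
  assert (Hm : 0 < Rmin e0 rho) by (apply Rmin_glb_lt; lra).
  assert (He : 0 < e) by (unfold e; lra).
  assert (Hee : e < e0) by (unfold e; lra).
  assert (Her : e < rho) by (unfold e; lra).
  assert (Abs : forall t x, 0 < x * t -> (x = 1 \/ x = -1) -> Rabs t = x * t).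
  { intros t x Hx [->| ->]; [rewrite Rabs_pos_eq | rewrite Rabs_left]; lra. }
  (* [t <> 0] excludes the only non-transversal zero of [nu1] in the box, the origin of the
     parameter plane. *)
  assert (Iff : forall j t, Rabs j < e -> Rabs t < e -> t <> 0 -> (flip_at f j t <-> nu1 j t = 0)).
  { intros j t Hj Ht Hn; split; intros HF.
    - apply (nu1_zero_of_flip a b nu1 nu2 f A B rho ha hnu1 hnu2 hf hA hB hC); try assumption; lra.
    - apply (flip_at_of_crossing a b nu1 nu2 f A B rho ha hb hnu1 hnu2 hf hA hB hC); try assumption; try lra.
      intros E; destruct (Htr j t); try assumption; try lra; contradiction. }
  split.
  - destruct (Htwo e ltac:(lra)) as [eta1 [Heta1 K1]].
    set (eta := Rmin e eta1).
    assert (eta <= e) by apply Rmin_l; assert (eta <= eta1) by apply Rmin_r.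
    assert (Heta : 0 < eta) by (apply Rmin_glb_lt; lra).
    assert (Hms : - s = 1 \/ - s = -1) by lra.
    exists s; split; [exact Hs|]; exists e, eta; split; [exact He|]; split; [exact Heta|].
    split; [|split].
    + intros t Ht j Hj HF; assert (At := Abs t s (proj1 Ht) Hs).
      assert (t <> 0) by (intros ->; lra).
      apply Iff in HF; try lra; apply (Hpos j t); lra.
    + intros t Ht; assert (At := Abs t (- s) (proj1 Ht) Hms).
      assert (t <> 0) by (intros ->; lra).
      destruct (K1 t ltac:(lra)) as [jm [jp [N [B1 [B2 Kz]]]]].
      exists jm, jp; split; [exact N|]; split; [exact B1|]; split; [exact B2|]; intros j Hj.
      rewrite (Iff j t Hj) by lra; apply Kz; lra.
    + intros eps' He'.
      set (e' := Rmin e eps').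
      assert (e' <= e) by apply Rmin_l; assert (e' <= eps') by apply Rmin_r.
      assert (0 < e') by (apply Rmin_glb_lt; lra).
      (* The two zeros now lie within [e'], yet remain the only ones up to [e0]; so every flip with
         [|j| < e] is one of them and satisfies [|j| < eps']. *)
      destruct (Htwo e' ltac:(lra)) as [eta2 [Heta2 K2]].
      exists (Rmin e eta2); split; [apply Rmin_glb_lt; lra|].
      pose proof (Rmin_l e eta2); pose proof (Rmin_r e eta2).
      intros t Ht j Hj HF; assert (At := Abs t (- s) (proj1 Ht) Hms).
      assert (t <> 0) by (intros ->; lra).
      apply Iff in HF; try lra.
      destruct (K2 t ltac:(lra)) as [jm [jp [N [B1 [B2 Kz]]]]].
      apply Kz in HF; [|lra]; destruct HF as [->| ->]; lra.
  - exists e, e; split; [exact He|]; split; [exact He|]; intros tau j0 Ht Hj Hz Hn2.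
    assert (Hc : Derive (fun j => nu1 j tau) j0 <> 0).
    (* A non-transversal zero would be [(0, 0)], where [nu2] vanishes, contrary to [Hn2]. *)
    { intros E; destruct (Htr j0 tau ltac:(lra) ltac:(lra) Hz E) as [-> ->]; contradiction. }
    assert (HL : leading_term b nu2 j0 tau (nu2 j0 tau) 2) by (left; auto).
    split; intros Hsgn.
    + apply (dual_ham_flip_at a b nu1 nu2 f A B rho ha hb hnu1 hnu2 hf hA hB hC j0 tau (nu2 j0 tau) 2);
        try assumption; lra.
    + apply (ham_flip_at a b nu1 nu2 f A B rho ha hb hnu1 hnu2 hf hA hB hC j0 tau (nu2 j0 tau) 2);
        try assumption; lra.
Qed.
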